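(* Let $S\subset\mathbb{R}^2$ be a set of at least $9$ points in general position. Every geometric graph on $S$ that is supporting for $S$ has two edges that cross (i.e. it is not a plane drawing).
   Context: General position: no three points collinear. Two labeled point sets in general position have the same order type under a bijection $\varphi$ if every triple $(p,q,r)$ of distinct points has the same orientation as $(\varphi(p),\varphi(q),\varphi(r))$. A geometric graph on $S$ is a graph with vertex set $S$ whose edges are drawn as straight segments between their endpoints. An ambient isotopy of $\mathbb{R}^2$ is a continuous map $f:\mathbb{R}^2\times[0,1]\to\mathbb{R}^2$ with $f(\cdot,t)$ a homeomorphism for every $t$ and $f(\cdot,0)$ the identity. A geometric graph $G$ on $S$ is supporting for $S$ if every ambient isotopy $f$ such that for every $t\in[0,1]$ the image under $f(\cdot,t)$ of each edge of $G$ is a straight segment and no four points of $f(S,t)$ are collinear, preserves the order type, i.e. for each $t$ with $f(S,t)$ in general position, $f(S,t)$ has the same order type as $S$ under $s\mapsto f(s,t)$. *)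

(* Defs.v *)
From Stdlib Require Import Reals List.
Import ListNotations.
Open Scope R_scope.

Definition point : Type := (R * R)%type.

(* orientation determinant of (p,q,r): >0 ccw, <0 cw, =0 collinear *)
Definition orient (p q r : point) : R :=
  (fst q - fst p) * (snd r - snd p) - (snd q - snd p) * (fst r - fst p).

Definition collinear (p q r : point) : Prop := orient p q r = 0.

Definition same_orient (a b : R) : Prop :=
  (0 < a <-> 0 < b) /\ (a < 0 <-> b < 0) /\ (a = 0 <-> b = 0).

Definition general_position (S : list point) : Prop :=
  forall p q r, In p S -> In q S -> In r S ->
    p <> q -> q <> r -> p <> r -> ~ collinear p q r.

Definition dist (p q : point) : R :=
  sqrt ((fst p - fst q)^2 + (snd p - snd q)^2).

Definition continuous2 (h : point -> point) : Prop :=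
  forall x eps, 0 < eps -> exists delta, 0 < delta /\
    forall y, dist x y < delta -> dist (h x) (h y) < eps.

Definition homeomorphism (h : point -> point) : Prop :=
  exists g : point -> point,
    (forall x, g (h x) = x) /\ (forall y, h (g y) = y) /\
    continuous2 h /\ continuous2 g.

(* ambient isotopy f : R^2 x [0,1] -> R^2 (values outside [0,1] irrelevant) *)
Definition ambient_isotopy (f : point -> R -> point) : Prop :=
  (forall x t eps, 0 <= t <= 1 -> 0 < eps -> exists delta, 0 < delta /\
     forall y s, 0 <= s <= 1 -> dist x y < delta -> Rabs (t - s) < delta ->
       dist (f x t) (f y s) < eps) /\
  (forall t, 0 <= t <= 1 -> homeomorphism (fun x => f x t)) /\
  (forall x, f x 0 = x).

Definition segment (a b : point) : point -> Prop :=
  fun x => exists l, 0 <= l <= 1 /\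
    x = ((1 - l) * fst a + l * fst b, (1 - l) * snd a + l * snd b).

Definition image_is_segment (h : point -> point) (p q : point) : Prop :=
  exists a b, forall y, (exists x, segment p q x /\ y = h x) <-> segment a b y.

(* a geometric graph on S: edges are pairs of distinct points of S,
   drawn as straight segments *)
Definition geometric_graph (S : list point) (E : list (point * point)) : Prop :=
  forall e, In e E -> In (fst e) S /\ In (snd e) S /\ fst e <> snd e.

Definition no_four_collinear (S : list point) (h : point -> point) : Prop :=
  forall p1 p2 p3 p4, In p1 S -> In p2 S -> In p3 S -> In p4 S ->
    p1 <> p2 -> p1 <> p3 -> p1 <> p4 -> p2 <> p3 -> p2 <> p4 -> p3 <> p4 ->
    ~ (collinear (h p1) (h p2) (h p3) /\ collinear (h p1) (h p2) (h p4)).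

Definition image_general_position (S : list point) (h : point -> point) : Prop :=
  forall p q r, In p S -> In q S -> In r S ->
    p <> q -> q <> r -> p <> r -> ~ collinear (h p) (h q) (h r).

Definition same_order_type (S : list point) (h : point -> point) : Prop :=
  forall p q r, In p S -> In q S -> In r S ->
    p <> q -> q <> r -> p <> r ->
    same_orient (orient p q r) (orient (h p) (h q) (h r)).

Definition supporting (S : list point) (E : list (point * point)) : Prop :=
  forall f : point -> R -> point,
    ambient_isotopy f ->
    (forall t, 0 <= t <= 1 ->
       (forall e, In e E -> image_is_segment (fun x => f x t) (fst e) (snd e)) /\
       no_four_collinear S (fun x => f x t)) ->
    forall t, 0 <= t <= 1 -> image_general_position S (fun x => f x t) ->
      same_order_type S (fun x => f x t).

(* two edges cross: their drawn segments share a point other than a common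
   endpoint (in general position this means: disjoint endpoint sets and
   intersecting segments, but we state the general notion) *)
Definition has_crossing (E : list (point * point)) : Prop :=
  exists e1 e2, In e1 E /\ In e2 E /\
    exists x, segment (fst e1) (snd e1) x /\ segment (fst e2) (snd e2) x /\
      ~ ((x = fst e1 \/ x = snd e1) /\ (x = fst e2 \/ x = snd e2)) /\
      ~ (fst e1 = fst e2 /\ snd e1 = snd e2) /\
      ~ (fst e1 = snd e2 /\ snd e1 = fst e2).

(* Main.v *)
Require Import Defs.
From Stdlib Require Import Reals List Lra Lia Psatz Classical ClassicalEpsilon.
Import ListNotations.
Open Scope R_scope.

(* Extend E to a maximal noncrossing graph on S, which is still supporting. If a vertex v moves
   along a short path on which only the triple v, a, b changes its orientation, the isotopy
   z |-> z + t phi(z) u, with phi a piecewise linear function equal to 1 at v and falling to 0 along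
   the edges at v, realises the move, unless v or an edge at v runs into an edge or a vertex; by
   maximality that happens only if v, a, b is a triangle of the graph (a face at v). Hence E is
   rigid: a position of v with the same orientation of all faces at v keeps all orientations of
   triples containing v.

   If v could be contracted along an edge v x keeping the orientation of its other faces, then v and
   x would be separated by no line through two other points; placing v in different positions
   close to x contradicts rigidity as soon as S has five points. Such a contraction exists
   whenever v is an interior vertex with at most five faces (a star-shaped polygon with at most five
   corners is seen from one of them) or a boundary vertex with at most two. Count every face at its
   lexicographically middle vertex: an interior vertex is middle for at most two faces, a
   boundary vertex for at most one, the first vertex for none. So the sum of the numbers of
   faces at the vertices, which is three times the number of faces, is too small. *)

(** * Shear isotopies *)

(** Every edge has to stay straight at every time, so [phi] must be affine along each edge, and
    prescribing it at the vertices is not enough. Moving all points in one fixed direction [u] makes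
    bijectivity a one-dimensional matter: the map is increasing on each line parallel to [u] as soon
    as [phi] falls there with slope below 1. Since [v] itself moves by the full vector [u], the hat
    over an edge [v x] cannot be much shorter than the triangle [v w x] swept by that edge; thin
    hats over these triangles, of slope just below 1, meet an edge only if it meets the closed
    triangle. This is the origin of the list of obstructions. Perturbing the target makes the
    triples flip one at a time, so that only the first flip has to be analysed. A face is a local
    notion, two consecutive neighbours of [v] at an angle below pi, and interior and boundary
    vertices are told apart by their neighbours alone; counting at the middle corner takes the role
    of Euler's formula. *)

Definition shift (p u : point) (s : R) : point := (fst p + s * fst u, snd p + s * snd u).

Definition norm1 (p q : point) : R := Rabs (fst p - fst q) + Rabs (snd p - snd q).

Lemma norm1_nonneg p q : 0 <= norm1 p q.
Proof. unfold norm1; pose proof (Rabs_pos (fst p - fst q)); pose proof (Rabs_pos (snd p - snd q)); lra. Qed.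

Lemma dist_le_norm1 p q : Defs.dist p q <= norm1 p q.
Proof.
  unfold Defs.dist, norm1.
  set (a := fst p - fst q); set (b := snd p - snd q).
  pose proof (Rabs_pos a); pose proof (Rabs_pos b).
  rewrite <- (sqrt_pow2 (Rabs a + Rabs b)) by lra.
  apply sqrt_le_1_alt.
  rewrite <- (pow2_abs a), <- (pow2_abs b); nra.
Qed.

Lemma norm1_le_dist p q : norm1 p q <= 2 * Defs.dist p q.
Proof.
  unfold Defs.dist, norm1.
  set (a := fst p - fst q); set (b := snd p - snd q).
  assert (Rabs a <= sqrt (a ^ 2 + b ^ 2)).
  { rewrite <- (sqrt_pow2 (Rabs a)) by apply Rabs_pos.
    apply sqrt_le_1_alt; rewrite pow2_abs; nra. }
  assert (Rabs b <= sqrt (a ^ 2 + b ^ 2)).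
  { rewrite <- (sqrt_pow2 (Rabs b)) by apply Rabs_pos.
    apply sqrt_le_1_alt; rewrite pow2_abs; nra. }
  lra.
Qed.

Lemma norm1_lipschitz_continuous2 h C :
  (forall x y, norm1 (h x) (h y) <= C * norm1 x y) -> continuous2 h.
Proof.
  intros H x eps He.
  assert (HC : 0 < Rabs C + 1) by (pose proof (Rabs_pos C); lra).
  exists (eps / (2 * (Rabs C + 1))). split.
  { apply Rdiv_lt_0_compat; lra. }
  intros y Hy.
  pose proof (dist_le_norm1 (h x) (h y)). pose proof (H x y).
  pose proof (norm1_le_dist x y). pose proof (norm1_nonneg x y).
  assert (C * norm1 x y <= (Rabs C + 1) * norm1 x y).
  { apply Rmult_le_compat_r; [easy|]. pose proof (Rle_abs C); lra. }
  assert ((Rabs C + 1) * norm1 x y <= (Rabs C + 1) * (2 * Defs.dist x y)) by (apply Rmult_le_compat_l; lra).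
  assert ((Rabs C + 1) * (2 * Defs.dist x y) < (Rabs C + 1) * (2 * (eps / (2 * (Rabs C + 1))))) by nra.
  replace ((Rabs C + 1) * (2 * (eps / (2 * (Rabs C + 1))))) with eps in * by (field; lra).
  lra.
Qed.

Section Flow.

Variables (phi : point -> R) (u : point) (L K : R).
Hypothesis phi_nonneg : forall p, 0 <= phi p.
Hypothesis phi_lip : forall p q, Rabs (phi p - phi q) <= L * norm1 p q.
Hypothesis K_range : 0 <= K < 1.
Hypothesis phi_slope : forall p s, 0 <= s -> phi p - K * s <= phi (shift p u s).

(** Each point slides along its own line parallel to [u]. By [phi_slope], [phi] falls in this
    direction at a rate of at most [K], which is below 1, so no point overtakes another on its
    line. *)
Definition flow (z : point) (t : R) : point := shift z u (t * phi z).

Lemma shift_shift p s s' : shift (shift p u s) u s' = shift p u (s + s').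
Proof. unfold shift; simpl; f_equal; ring. Qed.

Lemma shift_0 p : shift p u 0 = p.
Proof. unfold shift; destruct p; simpl; f_equal; ring. Qed.

Lemma lipschitz_constant_nonneg : 0 <= L.
Proof.
  pose proof (phi_lip (1, 0) (0, 0)) as H. unfold norm1 in H; simpl in H.
  rewrite Rminus_0_r, Rminus_0_r, Rabs_R1, Rabs_R0 in H.
  pose proof (Rabs_pos (phi (1, 0) - phi (0, 0))); lra.
Qed.

Lemma phi_shift_continuous z : continuity (fun s => phi (shift z u s)).
Proof.
  intros s eps He.
  set (U := Rabs (fst u) + Rabs (snd u)).
  assert (HU : 0 <= U) by (unfold U; pose proof (Rabs_pos (fst u)); pose proof (Rabs_pos (snd u)); lra).
  pose proof lipschitz_constant_nonneg.
  assert (0 < L * U + 1) by nra.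
  exists (eps / (L * U + 1)). split; [apply Rdiv_lt_0_compat; lra|].
  intros s' [_ Hs]. simpl in *. unfold Rdist in *.
  eapply Rle_lt_trans; [apply phi_lip|].
  assert (norm1 (shift z u s') (shift z u s) = Rabs (s' - s) * U).
  { unfold norm1, shift, U; simpl.
    replace (fst z + s' * fst u - (fst z + s * fst u)) with ((s' - s) * fst u) by ring.
    replace (snd z + s' * snd u - (snd z + s * snd u)) with ((s' - s) * snd u) by ring.
    rewrite !Rabs_mult; ring. }
  rewrite H1.
  pose proof (Rabs_pos (s' - s)).
  apply Rle_lt_trans with ((L * U + 1) * Rabs (s' - s)); [nra|].
  apply Rlt_le_trans with ((L * U + 1) * (eps / (L * U + 1))); [apply Rmult_lt_compat_l; lra|].
  right; field; lra.
Qed.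

(** The intermediate value theorem on the line through [y] parallel to [u]: a zero of [g] is the
    position from which the flow arrives at [y]. *)
Lemma flow_surj t : 0 <= t <= 1 -> forall y, exists z, flow z t = y.
Proof.
  intros Ht y.
  set (g := fun s => s + t * phi (shift y u s)).
  assert (Hc : continuity g).
  { intros s. apply continuity_pt_plus; [apply derivable_continuous_pt, derivable_pt_id|].
    apply continuity_pt_scal, phi_shift_continuous. }
  (* Going back by [b] raises [phi] to at most [phi y + K * b], and this is at most [b] for the
     chosen value; hence [g (- b) <= 0]. *)
  set (b := phi y / (1 - K) + 1).
  assert (Hb : 0 < b).
  { unfold b. assert (0 <= phi y / (1 - K)).
    { apply Rmult_le_pos; [apply phi_nonneg|]. left; apply Rinv_0_lt_compat; lra. } lra. }
  assert (Hneg : g (- b) <= 0).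
  { unfold g. pose proof (phi_slope (shift y u (- b)) b ltac:(lra)) as H.
    rewrite shift_shift in H. replace (- b + b) with 0 in H by ring. rewrite shift_0 in H.
    pose proof (phi_nonneg (shift y u (-b))).
    assert (t * phi (shift y u (- b)) <= phi y + K * b) by nra.
    assert (phi y = (b - 1) * (1 - K)) by (unfold b; field; lra). nra. }
  assert (Hpos : 0 <= g 0).
  { unfold g. pose proof (phi_nonneg (shift y u 0)); nra. }
  destruct (IVT_cor g (- b) 0 Hc ltac:(lra) ltac:(nra)) as [s [_ Hs]].
  exists (shift y u s). unfold flow. rewrite shift_shift.
  unfold g in Hs. rewrite Hs. apply shift_0.
Qed.

(** A lower Lipschitz bound, which yields injectivity and continuity of the inverse together. With
    [k] the difference of the two shifts, [z'] and [shift z u (- k)] are as far apart as the images,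
    so [phi] differs there by at most [L * N]; the slope bound between [z] and [shift z u (- k)]
    then gives [(1 - K) * Rabs k <= L * N]. *)
Lemma flow_expand t z z' : 0 <= t <= 1 ->
  norm1 z z' <= (1 + L * (Rabs (fst u) + Rabs (snd u)) / (1 - K)) * norm1 (flow z t) (flow z' t).
Proof.
  intros Ht.
  set (U := Rabs (fst u) + Rabs (snd u)).
  set (r := (fst (flow z' t) - fst (flow z t), snd (flow z' t) - snd (flow z t))).
  set (k := t * phi z' - t * phi z).
  assert (Hz : z' = shift (fst z + fst r, snd z + snd r) u (- k)).
  { apply injective_projections; unfold r, k, flow, shift; simpl; ring. }
  set (N := norm1 (flow z t) (flow z' t)).
  assert (HN : 0 <= N) by apply norm1_nonneg.
  assert (HNr : N = Rabs (fst r) + Rabs (snd r)).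
  { unfold N, norm1, r; simpl. f_equal; apply Rabs_minus_sym. }
  pose proof lipschitz_constant_nonneg as HL.
  assert (H1 : Rabs (phi z' - phi (shift z u (- k))) <= L * N).
  { eapply Rle_trans; [apply phi_lip|]. apply Rmult_le_compat_l; [easy|].
    rewrite Hz at 1. rewrite HNr. right. unfold norm1, shift. cbn [fst snd].
    apply f_equal2; apply f_equal; ring. }
  assert (Hk : Rabs k * (1 - K) <= L * N).
  { pose proof (Rle_abs (phi z' - phi (shift z u (- k)))).
    pose proof (Rle_abs (- (phi z' - phi (shift z u (- k))))) as H2. rewrite Rabs_Ropp in H2.
    destruct (Rle_or_lt 0 k) as [Hk|Hk].
    - rewrite Rabs_pos_eq by easy.
      pose proof (phi_slope (shift z u (- k)) k Hk) as Hs.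
      rewrite shift_shift in Hs. replace (- k + k) with 0 in Hs by ring. rewrite shift_0 in Hs.
      assert (phi z' - phi z <= L * N + K * k) by lra.
      assert (k <= L * N + K * k); [|lra].
      assert (0 <= L * N + K * k) by nra. unfold k at 1.
      destruct (Rle_or_lt 0 (phi z' - phi z)); nra.
    - rewrite Rabs_left by easy.
      pose proof (phi_slope z (- k) ltac:(lra)) as Hs.
      assert (- (L * N + K * (- k)) <= phi z' - phi z) by lra.
      assert (- k <= L * N + K * (- k)); [|lra].
      assert (0 <= L * N + K * (- k)) by nra. unfold k at 1.
      destruct (Rle_or_lt 0 (phi z' - phi z)); nra. }
  assert (Hk' : Rabs k <= L * N / (1 - K)).
  { apply Rmult_le_reg_r with (1 - K); [lra|]. unfold Rdiv. rewrite Rmult_assoc, Rinv_l by lra. lra. }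
  assert (Hf : fst z - fst z' = - fst r + k * fst u) by (rewrite Hz; unfold shift; simpl; ring).
  assert (Hsn : snd z - snd z' = - snd r + k * snd u) by (rewrite Hz; unfold shift; simpl; ring).
  unfold norm1 at 1. rewrite Hf, Hsn.
  pose proof (Rabs_triang (- fst r) (k * fst u)). pose proof (Rabs_triang (- snd r) (k * snd u)).
  rewrite Rabs_Ropp, Rabs_mult in H, H0.
  fold N. replace ((1 + L * U / (1 - K)) * N) with (N + (L * N / (1 - K)) * U) by (field; lra).
  assert (0 <= U) by (unfold U; pose proof (Rabs_pos (fst u)); pose proof (Rabs_pos (snd u)); lra).
  apply Rle_trans with (N + Rabs k * U); [|nra].
  unfold U. lra.
Qed.

Lemma norm1_0 z z' : norm1 z z' <= 0 -> z = z'.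
Proof.
  unfold norm1. intros H.
  pose proof (Rabs_pos (fst z - fst z')); pose proof (Rabs_pos (snd z - snd z')).
  apply injective_projections.
  - destruct (Req_dec (fst z - fst z') 0) as [E|E]; [lra|]. apply Rabs_pos_lt in E; lra.
  - destruct (Req_dec (snd z - snd z') 0) as [E|E]; [lra|]. apply Rabs_pos_lt in E; lra.
Qed.

Lemma flow_lipschitz t z z' : 0 <= t <= 1 ->
  norm1 (flow z t) (flow z' t) <= (1 + L * (Rabs (fst u) + Rabs (snd u))) * norm1 z z'.
Proof.
  intros Ht. unfold flow, shift, norm1 at 1; simpl.
  pose proof (phi_lip z z') as H. set (d := phi z - phi z') in *.
  replace (fst z + t * phi z * fst u - (fst z' + t * phi z' * fst u)) with ((fst z - fst z') + (t * d) * fst u) by (unfold d; ring).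
  replace (snd z + t * phi z * snd u - (snd z' + t * phi z' * snd u)) with ((snd z - snd z') + (t * d) * snd u) by (unfold d; ring).
  pose proof (Rabs_triang (fst z - fst z') (t * d * fst u)).
  pose proof (Rabs_triang (snd z - snd z') (t * d * snd u)).
  rewrite !Rabs_mult in H0, H1. rewrite (Rabs_pos_eq t) in H0, H1 by lra.
  pose proof (Rabs_pos (fst u)); pose proof (Rabs_pos (snd u)); pose proof (Rabs_pos d).
  assert (Hd : t * Rabs d <= L * norm1 z z').
  { apply Rle_trans with (1 * Rabs d); [apply Rmult_le_compat_r; lra|lra]. }
  assert (t * Rabs d * Rabs (fst u) <= L * norm1 z z' * Rabs (fst u)) by (apply Rmult_le_compat_r; lra).
  assert (t * Rabs d * Rabs (snd u) <= L * norm1 z z' * Rabs (snd u)) by (apply Rmult_le_compat_r; lra).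
  replace ((1 + L * (Rabs (fst u) + Rabs (snd u))) * norm1 z z') with
    (norm1 z z' + L * norm1 z z' * Rabs (fst u) + L * norm1 z z' * Rabs (snd u)) by ring.
  unfold norm1 at 1. lra.
Qed.

Lemma flow_isotopy : ambient_isotopy flow.
Proof.
  split; [|split].
  - intros x t eps Ht He.
    set (U := Rabs (fst u) + Rabs (snd u)).
    assert (HU : 0 <= U) by (unfold U; pose proof (Rabs_pos (fst u)); pose proof (Rabs_pos (snd u)); lra).
    pose proof lipschitz_constant_nonneg as HL. pose proof (phi_nonneg x) as Hp.
    (* The first summand pays for the distance of [x] and [y], where [norm1] costs the factor 2, the
       second for the difference in time, and the 1 makes the final inequality strict. *)
    set (C := 2 * (1 + L * U) + phi x * U + 1).
    assert (HC : 0 < C) by (unfold C; nra).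
    exists (eps / C). split; [apply Rdiv_lt_0_compat; lra|].
    intros y s Hs Hd Hts.
    pose proof (norm1_le_dist x y) as Hn. pose proof (flow_lipschitz s x y Hs) as Hf. fold U in Hf.
    eapply Rle_lt_trans; [apply dist_le_norm1|].
    assert (Hm : norm1 (flow x t) (flow x s) = Rabs (t - s) * (phi x * U)).
    { unfold norm1, flow, shift; simpl.
      replace (fst x + t * phi x * fst u - (fst x + s * phi x * fst u)) with ((t - s) * (phi x) * fst u) by ring.
      replace (snd x + t * phi x * snd u - (snd x + s * phi x * snd u)) with ((t - s) * (phi x) * snd u) by ring.
      rewrite !Rabs_mult, (Rabs_pos_eq (phi x)) by easy. unfold U; ring. }
    assert (Htri : norm1 (flow x t) (flow y s) <= norm1 (flow x t) (flow x s) + norm1 (flow x s) (flow y s)).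
    { unfold norm1.
      pose proof (Rabs_triang (fst (flow x t) - fst (flow x s)) (fst (flow x s) - fst (flow y s))) as T1.
      pose proof (Rabs_triang (snd (flow x t) - snd (flow x s)) (snd (flow x s) - snd (flow y s))) as T2.
      match type of T1 with Rabs ?a <= _ => replace a with (fst (flow x t) - fst (flow y s)) in T1 by ring end.
      match type of T2 with Rabs ?a <= _ => replace a with (snd (flow x t) - snd (flow y s)) in T2 by ring end.
      lra. }
    assert (He2 : eps = C * (eps / C)) by (field; lra).
    set (e := eps / C) in *.
    assert (0 <= Defs.dist x y) by (unfold Defs.dist; apply sqrt_pos).
    assert ((1 + L * U) * norm1 x y <= (1 + L * U) * (2 * e)) by (apply Rmult_le_compat_l; nra).
    assert (Rabs (t - s) * (phi x * U) <= e * (phi x * U)) by (apply Rmult_le_compat_r; nra).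
    assert (0 < e) by lra.
    rewrite He2. unfold C. rewrite Hm in Htri. nra.
  - intros t Ht.
    set (g := fun y => proj1_sig (constructive_indefinite_description _ (flow_surj t Ht y))).
    assert (Hg : forall y, flow (g y) t = y).
    { intros y. unfold g. apply proj2_sig. }
    assert (Hinj : forall z z', flow z t = flow z' t -> z = z').
    { intros z z' H. apply norm1_0. pose proof (flow_expand t z z' Ht) as He.
      rewrite H in He. replace (norm1 (flow z' t) (flow z' t)) with 0 in He; [lra|].
      unfold norm1. rewrite !Rminus_diag, Rabs_R0; ring. }
    exists g. split; [|split; [|split]].
    + intros x. apply Hinj, Hg.
    + exact Hg.
    + apply norm1_lipschitz_continuous2 with (1 + L * (Rabs (fst u) + Rabs (snd u))).
      intros x y. apply flow_lipschitz; easy.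
    + apply norm1_lipschitz_continuous2 with (1 + L * (Rabs (fst u) + Rabs (snd u)) / (1 - K)).
      intros x y. eapply Rle_trans; [apply (flow_expand t); easy|]. rewrite !Hg. lra.
  - intros x. unfold flow. rewrite Rmult_0_l. apply shift_0.
Qed.

End Flow.

(** * Orientations and tent functions *)

Definition lerp (t : R) (p q : point) : point :=
  ((1 - t) * fst p + t * fst q, (1 - t) * snd p + t * snd q).

Lemma orient_lerp t p q a b : orient (lerp t p q) a b = (1 - t) * orient p a b + t * orient q a b.
Proof. unfold orient, lerp; simpl; ring. Qed.

Lemma orient_lerp3 t p q a b : orient p q (lerp t a b) = (1 - t) * orient p q a + t * orient p q b.
Proof. unfold orient, lerp; simpl; ring. Qed.

Lemma orient_rot a b c : orient a b c = orient b c a.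
Proof. unfold orient; ring. Qed.

Lemma orient_swap a b c : orient a c b = - orient a b c.
Proof. unfold orient; ring. Qed.

Lemma orient_swap12 a b c : orient b a c = - orient a b c.
Proof. unfold orient; ring. Qed.

Lemma orient_eq1 a b : orient a a b = 0.
Proof. unfold orient; ring. Qed.

Lemma orient_eq2 a b : orient a b b = 0.
Proof. unfold orient; ring. Qed.

Lemma orient_eq3 a b : orient a b a = 0.
Proof. unfold orient; ring. Qed.

Lemma orient_sum v a b c : orient a b c = orient v a b + orient v b c - orient v a c.
Proof. unfold orient; ring. Qed.

(** The three-term Grassmann-Plücker relation for the vectors from [v] to the four points. *)
Lemma orient_plucker v a b c d :
  orient v a b * orient v c d - orient v a c * orient v b d + orient v a d * orient v b c = 0.
Proof. unfold orient; ring. Qed.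

Definition cfilter {A} (P : A -> Prop) (l : list A) : list A :=
  filter (fun x => if excluded_middle_informative (P x) then true else false) l.

Lemma in_cfilter {A} (P : A -> Prop) l x : In x (cfilter P l) <-> In x l /\ P x.
Proof.
  unfold cfilter. rewrite filter_In.
  destruct (excluded_middle_informative (P x)); intuition discriminate.
Qed.

(** * Properties that hold for all sufficiently small positive parameters *)

Definition ev (P : R -> Prop) : Prop := exists e, 0 < e /\ forall s, 0 < s < e -> P s.

Lemma ev_ex P : ev P -> exists s, 0 < s /\ P s.
Proof. intros [e [He H]]. exists (e / 2). split; [lra|]. apply H; lra. Qed.

Lemma ev_mono P Q : (forall s, P s -> Q s) -> ev P -> ev Q.
Proof. intros H [e [He HP]]. exists e; split; [easy|]. intros s Hs; apply H, HP, Hs. Qed.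

Lemma ev_and P Q : ev P -> ev Q -> ev (fun s => P s /\ Q s).
Proof.
  intros [e [He HP]] [e' [He' HQ]]. exists (Rmin e e'). split; [apply Rmin_glb_lt; easy|].
  intros s Hs. pose proof (Rmin_l e e'); pose proof (Rmin_r e e').
  split; [apply HP|apply HQ]; lra.
Qed.

Lemma ev_lt b : 0 < b -> ev (fun s => 0 < s < b).
Proof. intros Hb; exists b; split; auto. Qed.

Lemma ev_all {A} (l : list A) (P : A -> R -> Prop) :
  (forall x, In x l -> ev (P x)) -> ev (fun s => forall x, In x l -> P x s).
Proof.
  induction l as [|a l IH]; intros H.
  - exists 1; split; [lra|]. intros s _ x [].
  - pose proof (ev_and _ _ (H a (or_introl eq_refl)) (IH (fun x Hx => H x (or_intror Hx)))) as H'.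
    revert H'; apply ev_mono. intros s [H1 H2] x [<-|Hx]; auto.
Qed.

Lemma ev_affine a b : 0 < a -> ev (fun s => 0 < a + s * b).
Proof.
  intros Ha. exists (a / (Rabs b + 1)).
  assert (0 < Rabs b + 1) by (pose proof (Rabs_pos b); lra).
  split; [apply Rdiv_lt_0_compat; lra|]. intros s [H1 H2].
  assert (s * (Rabs b + 1) < a).
  { apply Rmult_lt_reg_r with (/ (Rabs b + 1)); [apply Rinv_0_lt_compat; lra|].
    rewrite Rmult_assoc, Rinv_r by lra. unfold Rdiv in H2; lra. }
  pose proof (Rle_abs (- b)) as Hb. rewrite Rabs_Ropp in Hb. nra.
Qed.

Lemma ev_big a b : 0 < b -> ev (fun s => a <= b / s).
Proof.
  intros Hb. destruct (ev_affine b (- a) Hb) as [e [He H]]. exists e; split; [easy|].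
  intros s Hs. specialize (H s Hs).
  apply Rmult_le_reg_r with s; [lra|]. unfold Rdiv. rewrite Rmult_assoc, Rinv_l by lra. lra.
Qed.

Section Tent.

Variables v w x : point.
Hypothesis Hx : orient v x w <> 0.

(* [lc] and [mc] are the coordinates of [z - v] in the basis [(x - v, w - v)]. *)
Definition lc (z : point) : R := orient v z w / orient v x w.
Definition mc (z : point) : R := orient v x z / orient v x w.

(* A hat over the triangle [v w x], equal to [1 - t] at [lerp t v x], with slope at least
   [-(1 - e)] in direction [w - v] and support shrinking to the triangle as [e] tends to 0. *)
Definition tent (e : R) (z : point) : R :=
  Rmin (Rmin (1 - lc z - (1 - e) * mc z) (1 + lc z / e - (1 - e) * mc z))
       (Rmin (1 - lc z + mc z / e) (1 + lc z / e + mc z / e)).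

Lemma lc_lerp t p q : lc (lerp t p q) = (1 - t) * lc p + t * lc q.
Proof. unfold lc, Rdiv. rewrite (orient_rot v), orient_lerp, <- !(orient_rot v). ring. Qed.

Lemma mc_lerp t p q : mc (lerp t p q) = (1 - t) * mc p + t * mc q.
Proof. unfold mc, Rdiv. rewrite <- (orient_rot _ v x), orient_lerp, !(orient_rot _ v x). ring. Qed.

Lemma lc_v : lc v = 0. Proof. unfold lc. rewrite orient_eq1. unfold Rdiv; ring. Qed.
Lemma mc_v : mc v = 0. Proof. unfold mc. rewrite orient_eq3. unfold Rdiv; ring. Qed.
Lemma lc_x : lc x = 1. Proof. unfold lc. field; easy. Qed.
Lemma mc_x : mc x = 0. Proof. unfold mc. rewrite orient_eq2. unfold Rdiv; ring. Qed.

Lemma orient_v_x a : orient v x a = orient v x w * mc a.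
Proof. unfold mc. field; easy. Qed.

Lemma orient_w_x a : orient w x a = orient v x w * (lc a + mc a - 1).
Proof. unfold lc, mc. field_simplify; [|easy]. unfold orient; ring. Qed.

Lemma orient_coord a b z :
  orient a b z = orient a b v + lc z * (orient a b x - orient a b v) + mc z * (orient a b w - orient a b v).
Proof. unfold lc, mc. apply Rmult_eq_reg_r with (orient v x w); [|easy]. field_simplify; [|easy]. unfold orient; ring. Qed.

Lemma tent_le_iff e z c :
  1 - lc z - (1 - e) * mc z <= c \/ 1 + lc z / e - (1 - e) * mc z <= c \/
  1 - lc z + mc z / e <= c \/ 1 + lc z / e + mc z / e <= c -> tent e z <= c.
Proof.
  unfold tent. set (a1 := 1 - lc z - _). set (a2 := 1 + lc z / e - _).
  set (a3 := 1 - lc z + _). set (a4 := 1 + lc z / e + _).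
  pose proof (Rmin_l (Rmin a1 a2) (Rmin a3 a4)). pose proof (Rmin_r (Rmin a1 a2) (Rmin a3 a4)).
  pose proof (Rmin_l a1 a2). pose proof (Rmin_r a1 a2). pose proof (Rmin_l a3 a4). pose proof (Rmin_r a3 a4).
  intros [|[|[|]]]; lra.
Qed.

(** A shift by [w - v] leaves [lc] fixed and raises [mc]. Of the four affine pieces only the two
    with coefficient [-(1 - e)] decrease. *)
Lemma tent_slope e z s : 0 < e < 1 -> 0 <= s ->
  tent e z - (1 - e) * s <= tent e (shift z (fst w - fst v, snd w - snd v) s).
Proof.
  intros He Hs. set (z' := shift z _ s).
  assert (El : lc z' = lc z).
  { unfold lc. f_equal. unfold z', shift, orient; simpl; ring. }
  assert (Em : mc z' = mc z + s).
  { unfold mc. apply Rmult_eq_reg_r with (orient v x w); [|easy]. field_simplify; [|easy|easy].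
    unfold z', shift, orient; simpl; ring. }
  unfold tent. rewrite El, Em.
  assert (0 <= s / e) by (apply Rmult_le_pos; [easy|left; apply Rinv_0_lt_compat; lra]).
  replace ((mc z + s) / e) with (mc z / e + s / e) by (field; lra).
  repeat apply Rmin_glb;
  unfold Rmin; repeat destruct Rle_dec; nra.
Qed.

Lemma Rabs_Rmin_le a b c d B : Rabs (a - c) <= B -> Rabs (b - d) <= B -> Rabs (Rmin a b - Rmin c d) <= B.
Proof. unfold Rmin, Rabs; repeat destruct Rle_dec; repeat destruct Rcase_abs; lra. Qed.

Definition lipschitz (h : point -> R) : Prop :=
  exists L, forall p q, Rabs (h p - h q) <= L * norm1 p q.

Lemma lipschitz_linear a b c : lipschitz (fun z => a * fst z + b * snd z + c).
Proof.
  exists (Rabs a + Rabs b). intros p q. unfold norm1.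
  replace (a * fst p + b * snd p + c - (a * fst q + b * snd q + c))
    with (a * (fst p - fst q) + b * (snd p - snd q)) by ring.
  eapply Rle_trans; [apply Rabs_triang|]. rewrite !Rabs_mult.
  pose proof (Rabs_pos a); pose proof (Rabs_pos b);
  pose proof (Rabs_pos (fst p - fst q)); pose proof (Rabs_pos (snd p - snd q)); nra.
Qed.

Lemma lipschitz_ext h k : (forall z, h z = k z) -> lipschitz h -> lipschitz k.
Proof. intros H [L HL]. exists L. intros p q. rewrite <- !H. apply HL. Qed.

Lemma lipschitz_max_common h k : lipschitz h -> lipschitz k ->
  exists L, (forall p q, Rabs (h p - h q) <= L * norm1 p q) /\ (forall p q, Rabs (k p - k q) <= L * norm1 p q).
Proof.
  intros [L HL] [L' HL']. exists (Rmax L L').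
  split; intros p q; (eapply Rle_trans; [apply HL || apply HL'|]);
  (apply Rmult_le_compat_r; [apply norm1_nonneg|]); [apply Rmax_l|apply Rmax_r].
Qed.

Lemma lipschitz_min h k : lipschitz h -> lipschitz k -> lipschitz (fun z => Rmin (h z) (k z)).
Proof.
  intros Hh Hk. destruct (lipschitz_max_common h k Hh Hk) as [L [H1 H2]].
  exists L. intros p q. apply Rabs_Rmin_le; auto.
Qed.

Lemma lipschitz_max h k : lipschitz h -> lipschitz k -> lipschitz (fun z => Rmax (h z) (k z)).
Proof.
  intros Hh Hk. destruct (lipschitz_max_common h k Hh Hk) as [L [H1 H2]].
  exists L. intros p q. specialize (H1 p q); specialize (H2 p q). revert H1 H2.
  unfold Rmax, Rabs; repeat destruct Rle_dec; repeat destruct Rcase_abs; lra.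
Qed.

Lemma tent_lipschitz e : lipschitz (tent e).
Proof.
  unfold tent.
  assert (G : forall a b c, lipschitz (fun z => a + b * lc z + c * mc z)).
  { intros a b c.
    set (D := orient v x w).
    apply lipschitz_ext with (fun z =>
      (b * (snd w - snd v) / D - c * (snd x - snd v) / D) * fst z
      + (- b * (fst w - fst v) / D + c * (fst x - fst v) / D) * snd z
      + (a + b * (snd v * (fst w - fst v) - fst v * (snd w - snd v)) / D
         + c * (fst v * (snd x - snd v) - snd v * (fst x - fst v)) / D)).
    - intros z. unfold lc, mc. fold D. unfold orient. field. exact Hx.
    - apply lipschitz_linear. }
  repeat apply lipschitz_min.
  - eapply lipschitz_ext; [|apply (G 1 (-1) (- (1 - e)))]. intros z; simpl; ring.
  - eapply lipschitz_ext; [|apply (G 1 (/ e) (- (1 - e)))]. intros z; simpl; unfold Rdiv; ring.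
  - eapply lipschitz_ext; [|apply (G 1 (-1) (/ e))]. intros z; simpl; unfold Rdiv; ring.
  - eapply lipschitz_ext; [|apply (G 1 (/ e) (/ e))]. intros z; simpl; unfold Rdiv; ring.
Qed.

(* The four premises say that the tent over the triangle is positive at the point with coordinates
   [l], [m]. Such points are close to the triangle, where the affine function with values
   [gv], [gw], [gx] at the corners is positive. *)
Lemma tent_pos_side gv gw gx : 0 < gv -> 0 < gw -> 0 < gx ->
  ev (fun e => forall l m,
    0 < 1 - l - (1 - e) * m -> 0 < 1 + l / e - (1 - e) * m -> 0 < 1 - l + m / e -> 0 < 1 + l / e + m / e ->
    0 < gv + l * (gx - gv) + m * (gw - gv)).
Proof.
  intros Hv Hw Hx'.
  pose proof (ev_and _ _ (ev_lt 1 Rlt_0_1) (ev_and _ _ (ev_affine gv (- (gx + gw)) Hv) (ev_affine gw (- gv) Hw))) as H.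
  revert H; apply ev_mono. intros e [He [H1 H2]] l m L1 L2 L3 L4.
  set (l' := l / e) in *. set (m' := m / e) in *.
  assert (El : l = e * l') by (unfold l'; field; lra).
  assert (Em : m = e * m') by (unfold m'; field; lra).
  (* By quadrants of [(l, m)]: the affine function is a barycentric combination of its corner
     values, and the premises bound each negative weight by a multiple of [e] that the positive part
     absorbs. *)
  destruct (Rle_or_lt 0 m) as [Hm|Hm], (Rle_or_lt 0 l) as [Hl|Hl].
  - destruct (Rle_or_lt 0 (1 - l - m)) as [Hk|Hk].
    + destruct (Rle_or_lt l (1/2)); destruct (Rle_or_lt m (1/4)); nra.
    + assert (0 < m) by nra. nra.
  - assert (l' < 0) by nra.
    replace (gv + l * (gx - gv) + m * (gw - gv)) with ((1 - l - m) * gv + l * gx + m * gw) by ring.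
    assert (- l' - e * m - l < 1 - l - m) by lra.
    assert ((- l' - e * m - l) * gv <= (1 - l - m) * gv) by nra.
    assert (0 <= m * (gw - e * gv)) by nra.
    assert (0 < (- l') * (gv - e * gx)) by nra.
    nra.
  - assert (m' < 0) by nra.
    replace (gv + l * (gx - gv) + m * (gw - gv)) with ((1 - l - m) * gv + l * gx + m * gw) by ring.
    assert (0 < (- m') * (gv - e * gw)) by nra.
    nra.
  - replace (gv + l * (gx - gv) + m * (gw - gv)) with ((1 - l - m) * gv + l * gx + m * gw) by ring.
    assert (- l < e /\ - m < e) by nra. nra.
Qed.

End Tent.

(** * Moving one vertex *)

Definition crosses (a b c d : point) : Prop :=
  orient a b c * orient a b d < 0 /\ orient c d a * orient c d b < 0.

Definition adj (E : list (point * point)) (a b : point) : Prop := In (a, b) E \/ In (b, a) E.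

Definition noncrossing (E : list (point * point)) : Prop :=
  forall a b c d, In (a, b) E -> In (c, d) E -> ~ crosses a b c d.

Lemma adj_sym E a b : adj E a b -> adj E b a.
Proof. unfold adj; tauto. Qed.

Lemma crosses_sym a b c d : crosses a b c d -> crosses c d a b.
Proof. unfold crosses; tauto. Qed.

Lemma crosses_swap a b c d : crosses a b c d -> crosses b a c d.
Proof.
  unfold crosses. rewrite (orient_swap12 a b c), (orient_swap12 a b d). intros [H1 H2]; split; lra.
Qed.

Lemma noncrossing_adj E a b c d : noncrossing E -> adj E a b -> adj E c d -> ~ crosses a b c d.
Proof.
  intros HE [H1|H1] [H2|H2] HX.
  - exact (HE _ _ _ _ H1 H2 HX).
  - apply (HE _ _ _ _ H1 H2). apply crosses_sym, crosses_swap, crosses_sym, HX.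
  - apply (HE _ _ _ _ H1 H2). apply crosses_swap, HX.
  - apply (HE _ _ _ _ H1 H2). apply crosses_swap, crosses_sym, crosses_swap, crosses_sym, HX.
Qed.

Lemma adj_in S E a b : geometric_graph S E -> adj E a b -> In a S /\ In b S /\ a <> b.
Proof. intros HE [H|H]; apply HE in H; simpl in H; intuition. Qed.

Lemma point_eq_dec (p q : point) : {p = q} + {p <> q}.
Proof. decide equality; apply Req_dec_T. Qed.

Lemma lerp_swap t a b : lerp t a b = lerp (1 - t) b a.
Proof. unfold lerp; f_equal; ring. Qed.

Lemma Rmult_pos_cases a b : 0 < a * b -> (0 < a /\ 0 < b) \/ (a < 0 /\ b < 0).
Proof. intros H. destruct (Rtotal_order a 0) as [Ha|[Ha|Ha]]; [right|subst; lra|left]; split; nra. Qed.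

Lemma Rmult_neg_cases a b : a * b < 0 -> (0 < a /\ b < 0) \/ (a < 0 /\ 0 < b).
Proof. intros H. destruct (Rtotal_order a 0) as [Ha|[Ha|Ha]]; [right|subst; lra|left]; split; nra. Qed.

Lemma convex_same_sign p q t : 0 < p * q -> 0 <= t <= 1 -> 0 < p * ((1 - t) * p + t * q).
Proof.
  intros H Ht. replace (p * ((1 - t) * p + t * q)) with ((1 - t) * (p * p) + t * (p * q)) by ring.
  assert (0 < p * p) by (destruct (Rmult_pos_cases _ _ H); nra).
  destruct (Rle_or_lt t (1/2)); nra.
Qed.

Definition same_pair (a b a0 b0 : point) : Prop := (a = a0 /\ b = b0) \/ (a = b0 /\ b = a0).

Section Move.

Variables (S : list point) (E : list (point * point)).
Hypothesis HS : general_position S.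
Hypothesis HE : geometric_graph S E.
Hypothesis HN : noncrossing E.
(** The move under study: [v] travels straight to [w], only the triple [v], [a0], [b0] changes its
    orientation, and it does so at the point [c]. [Hgen] makes [x - v] and [w - v] a basis for every
    other vertex [x]. *)
Variables v w a0 b0 : point.
Hypothesis Hv : In v S.
Hypothesis Ha0 : In a0 S.
Hypothesis Hb0 : In b0 S.
Hypothesis Hva0 : v <> a0.
Hypothesis Hvb0 : v <> b0.
Hypothesis Ha0b0 : a0 <> b0.
Hypothesis Hother : forall a b, In a S -> In b S -> a <> v -> b <> v -> a <> b ->
  ~ same_pair a b a0 b0 -> 0 < orient v a b * orient w a b.
Hypothesis Hspec : orient v a0 b0 * orient w a0 b0 < 0.
Hypothesis Hgen : forall x, In x S -> x <> v -> orient v x w <> 0.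
Variables (t0 th0 : R) (c : point).
Hypothesis Ht0 : 0 < t0 < 1.
Hypothesis Hc : c = lerp t0 v w.
Hypothesis Hcab : c = lerp th0 a0 b0.
Hypothesis Hth0 : th0 <> 0.
Hypothesis Hth1 : th0 <> 1.

(* The obstructions to moving [v] through [c]: [c] lies on the edge [a b], or the edge [v b] would
   sweep over [a]. *)
Definition exit_edge (a b : point) : Prop :=
  (exists th, 0 < th < 1 /\ c = lerp th a b /\ adj E a b) \/
  (exists th, th < 0 /\ c = lerp th a b /\ adj E v b).

Hypothesis Hno : forall a b, same_pair a b a0 b0 -> ~ exit_edge a b.

Lemma same_pair_param a b : same_pair a b a0 b0 -> exists th, c = lerp th a b /\ th <> 0 /\ th <> 1.
Proof.
  intros [[-> ->]|[-> ->]]; [exists th0; auto|].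
  exists (1 - th0). rewrite lerp_swap. replace (1 - (1 - th0)) with th0 by ring.
  repeat split; [easy|lra|lra].
Qed.

Lemma orient_path a b t : In a S -> In b S -> a <> v -> b <> v -> a <> b -> ~ same_pair a b a0 b0 ->
  0 <= t <= 1 -> 0 < orient v a b * orient (lerp t v w) a b.
Proof.
  intros. rewrite orient_lerp. apply convex_same_sign; [apply Hother|]; auto.
Qed.

Definition split_at (x a : point) : Prop :=
  same_pair x a a0 b0 /\ exists th, 0 < th < 1 /\ c = lerp th x a.

(** If the triple with [x] and [a] keeps its orientation, the line [x a] does not separate [v] from
    [w], so [a] lies beyond the line [w x] or on the far side of [v x]. For the special pair, the
    position of [c] on the line [x a] decides: if [a] were between [x] and [c], the edge [v x] would
    sweep over [a], which [Hno] forbids; if [c] is between [x] and [a], the third alternative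
    arises. *)
Lemma point_type x a : adj E v x -> In a S -> a <> v -> a <> x ->
  (0 < mc v w x a /\ 1 < lc v w x a + mc v w x a) \/ mc v w x a < 0 \/
  (lc v w x a < 0 /\ 0 < mc v w x a /\ split_at x a).
Proof.
  intros Hx Ha Hav Hax.
  destruct (adj_in S E _ _ HE Hx) as [_ [HxS Hvx]].
  assert (HD : orient v x w <> 0) by (apply Hgen; auto).
  destruct (classic (same_pair x a a0 b0)) as [Hs|Hs].
  - destruct (same_pair_param _ _ Hs) as [th [Hth [Hn0 Hn1]]].
    assert (El : (1 - th) + th * lc v w x a = 0).
    { pose proof (lc_lerp v w x th x a) as H1. rewrite <- Hth, Hc, lc_lerp, lc_v, lc_x in H1 by easy.
      replace (lc v w x w) with 0 in H1; [lra|]. unfold lc. rewrite orient_eq2. unfold Rdiv; ring. }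
    assert (Em : th * mc v w x a = t0).
    { pose proof (mc_lerp v w x th x a) as H1. rewrite <- Hth, Hc, mc_lerp, mc_v, mc_x in H1.
      replace (mc v w x w) with 1 in H1; [lra|]. unfold mc. field. easy. }
    destruct (Rtotal_order th 0) as [H|[H|H]]; [|easy|].
    + right; left. nra.
    + destruct (Rtotal_order th 1) as [H'|[H'|H']]; [|easy|].
      * right; right. split; [nra|]. split; [nra|]. split; [easy|]. exists th; split; [lra|easy].
      * exfalso. apply (Hno a x); [unfold same_pair in *; tauto|].
        right. exists (1 - th). split; [lra|]. split; [rewrite Hth; apply lerp_swap|easy].
  - pose proof (Hother x a HxS Ha ltac:(auto) Hav ltac:(auto) Hs) as H.
    rewrite (orient_v_x v w x HD a), (orient_w_x v w x HD a) in H.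
    set (D := orient v x w) in *. set (A := lc v w x a) in *. set (B := mc v w x a) in *.
    assert (0 < B * (A + B - 1)).
    { apply Rmult_lt_reg_l with (D * D); [nra|]. lra. }
    apply Rmult_pos_cases in H0. destruct H0; [left|right; left]; lra.
Qed.

(** One affine piece of the tent is nonpositive at [a]. Since the pieces equal 1 at [v], this also
    bounds the tent by [1 - l] along the segment from [v] to [a], as a second edge at [v]
    requires. *)
Definition covered (x : point) (e : R) (a : point) : Prop :=
  1 - lc v w x a - (1 - e) * mc v w x a <= 0 \/
  1 + lc v w x a / e - (1 - e) * mc v w x a <= 0 \/
  1 - lc v w x a + mc v w x a / e <= 0.

Lemma ev_beyond A B : 0 < B -> 1 < A + B -> ev (fun e => 1 - A - (1 - e) * B <= 0).
Proof.
  intros H1 H2. apply (ev_mono (fun s => 0 < (A + B - 1) + s * (- B))); [intros; lra|].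
  apply ev_affine; lra.
Qed.

Lemma ev_below A B : B < 0 -> ev (fun e => 1 - A + B / e <= 0).
Proof.
  intros H1. apply (ev_mono (fun s => 1 - A <= (- B) / s)); [|apply ev_big; lra].
  intros s. unfold Rdiv. lra.
Qed.

Lemma ev_left A B : A < 0 -> 0 < B -> ev (fun e => 1 + A / e - (1 - e) * B <= 0).
Proof.
  intros H1 H2. apply (ev_mono (fun s => 0 < s < 1 /\ 1 <= (- A) / s)).
  - intros s. unfold Rdiv. intros [Hs H]. nra.
  - apply ev_and; [apply ev_lt; lra|apply ev_big; lra].
Qed.

Lemma ev_covered x a : adj E v x -> In a S -> a <> v -> a <> x -> ev (fun e => covered x e a).
Proof.
  intros Hx Ha Hav Hax. destruct (point_type x a Hx Ha Hav Hax) as [[H1 H2]|[H|[H1 [H2 _]]]].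
  - eapply ev_mono; [|apply (ev_beyond _ _ H1 H2)]. intros; left; easy.
  - eapply ev_mono; [|apply (ev_below (lc v w x a) _ H)]. intros; right; right; easy.
  - eapply ev_mono; [|apply (ev_left _ _ H1 H2)]. intros; right; left; easy.
Qed.

(** A line that has [v], [w] and [x] strictly on one side misses the closed triangle, hence also the
    positive part of every sufficiently thin tent over it. *)
Lemma same_side_covered x a b : orient v x w <> 0 ->
  0 < orient a b v * orient a b w -> 0 < orient a b v * orient a b x ->
  ev (fun e => forall t, 0 <= t <= 1 -> tent v w x e (lerp t a b) <= 0).
Proof.
  intros HD H1 H2.
  assert (Hz : forall t, orient a b (lerp t a b) = 0).
  { intros t. rewrite <- orient_rot, orient_lerp, orient_eq1, orient_eq3. ring. }
  (* [s] is 1 or -1 and records the side of the line [a b] on which the triangle lies. *)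
  assert (G : forall s, s * s = 1 -> 0 < s * orient a b v -> ev (fun e => forall t, 0 <= t <= 1 -> tent v w x e (lerp t a b) <= 0)).
  { intros s Hss Hs.
    assert (G0 : forall y, 0 < orient a b v * orient a b y -> 0 < s * orient a b y).
    { intros y Hy.
      assert (Hy' : 0 < (s * orient a b v) * (s * orient a b y)).
      { replace ((s * orient a b v) * (s * orient a b y)) with ((s * s) * (orient a b v * orient a b y)) by ring. rewrite Hss; lra. }
      apply Rmult_pos_cases in Hy'. lra. }
    pose proof (G0 _ H1) as Hw. pose proof (G0 _ H2) as Hxx.
    eapply ev_mono; [|apply (tent_pos_side _ _ _ Hs Hw Hxx)].
    intros e He t Ht. simpl in He.
    apply tent_le_iff. set (z := lerp t a b).
    destruct (Rle_or_lt (1 - lc v w x z - (1 - e) * mc v w x z) 0) as [G1|G1]; [auto|].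
    destruct (Rle_or_lt (1 + lc v w x z / e - (1 - e) * mc v w x z) 0) as [G2|G2]; [auto|].
    destruct (Rle_or_lt (1 - lc v w x z + mc v w x z / e) 0) as [G3|G3]; [auto|].
    destruct (Rle_or_lt (1 + lc v w x z / e + mc v w x z / e) 0) as [G4|G4]; [auto|].
    exfalso. specialize (He _ _ G1 G2 G3 G4).
    pose proof (orient_coord v w x HD a b z) as Ez.
    replace (orient a b z) with 0 in Ez by (symmetry; apply Hz).
    match type of Ez with 0 = ?r => match type of He with 0 < ?q => replace q with (s * r) in He by ring end end.
    rewrite <- Ez in He. lra. }
  destruct (Rmult_pos_cases _ _ H1) as [[H _]|[H _]].
  - apply (G 1); lra.
  - apply (G (-1)); lra.
Qed.

Lemma affine_le_0 t P Q : 0 <= t <= 1 -> P <= 0 -> Q <= 0 -> (1 - t) * P + t * Q <= 0.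
Proof. intros; nra. Qed.

(** The piece that is nonpositive at [b] vanishes at [x], hence is nonpositive on the whole edge.
    The alternative [split_at] would put [c] on the edge [x b]. *)
Lemma ev_segment_endpoint x b : adj E v x -> adj E x b -> b <> v ->
  ev (fun e => forall t, 0 <= t <= 1 -> tent v w x e (lerp t x b) <= 0).
Proof.
  intros Hx Hab Hbv.
  destruct (adj_in S E _ _ HE Hx) as [_ [HxS Hvx]]. destruct (adj_in S E _ _ HE Hab) as [_ [HbS Hxb]].
  assert (HD : orient v x w <> 0) by (apply Hgen; auto).
  destruct (point_type x b Hx HbS Hbv ltac:(auto)) as [[H1 H2]|[H|[H1 [H2 [H3 [th [H4 H5]]]]]]].
  - eapply ev_mono; [|apply (ev_beyond _ _ H1 H2)]. intros e He t Ht. apply tent_le_iff. left.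
    rewrite lc_lerp, mc_lerp, lc_x, mc_x by easy. nra.
  - eapply ev_mono; [|apply (ev_below (lc v w x b) _ H)]. intros e He t Ht. apply tent_le_iff. right; right; left.
    rewrite lc_lerp, mc_lerp, lc_x, mc_x by easy. simpl in He. unfold Rdiv in *. nra.
  - exfalso. apply (Hno x b H3). left. exists th; auto.
Qed.

(** Cases by the types of [a] and [b]. Two ends of the same kind share one nonpositive affine piece.
    Ends on different sides of the line [v x] leave [v] and [x] on one side of [a b], as the edges
    do not cross, and [w] is there too unless [c] lies on the edge. If [c] lies between [x] and one
    end, [x] and [c] are on the same side of the line [a b], and [c] is on the side of [v] because
    that triple does not flip. *)
Lemma ev_segment x a b : adj E v x -> adj E a b -> a <> v -> b <> v ->
  ev (fun e => forall t, 0 <= t <= 1 -> tent v w x e (lerp t a b) <= 0).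
Proof.
  intros Hx Hab Hav Hbv.
  destruct (adj_in S E _ _ HE Hx) as [_ [HxS Hvx]]. destruct (adj_in S E _ _ HE Hab) as [HaS [HbS Hneab]].
  assert (HD : orient v x w <> 0) by (apply Hgen; auto).
  destruct (point_eq_dec a x) as [->|Hax]; [apply ev_segment_endpoint; easy|].
  destruct (point_eq_dec b x) as [->|Hbx].
  { eapply ev_mono; [|apply (ev_segment_endpoint x a Hx (adj_sym _ _ _ Hab) Hav)].
    intros e He t Ht. rewrite lerp_swap. apply He. lra. }
  assert (Nab : orient a b v <> 0) by (apply HS; auto).
  assert (Nabx : orient a b x <> 0) by (apply HS; auto).
  assert (Split : forall a b, adj E a b -> a <> x -> b <> x -> a <> v -> b <> v -> orient a b x <> 0 -> split_at x b ->
    ev (fun e => forall t, 0 <= t <= 1 -> tent v w x e (lerp t a b) <= 0)).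
  { clear a b Hab Hav Hbv HaS HbS Hneab Hax Hbx Nab Nabx.
    intros a b Hab Hax Hbx Hav Hbv Nabx [Hs [th [Hth Ec]]].
    destruct (adj_in S E _ _ HE Hab) as [HaS [HbS Hneab]].
    assert (Hns : ~ same_pair a b a0 b0) by (intros H; unfold same_pair in *; intuition congruence).
    pose proof (Hother a b HaS HbS Hav Hbv Hneab Hns) as G1.
    pose proof (orient_path a b t0 HaS HbS Hav Hbv Hneab Hns ltac:(lra)) as G2.
    rewrite <- Hc, Ec, orient_lerp in G2.
    assert (Eb : orient b a b = 0) by apply orient_eq3. rewrite Eb in G2.
    rewrite (orient_rot x a b) in G2.
    rewrite (orient_rot v a b) in G1, G2. rewrite (orient_rot w a b) in G1.
    apply same_side_covered; [easy|easy|].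
    apply Rmult_lt_reg_l with (1 - th); [lra|]. lra. }
  assert (Mixed : forall a b, adj E a b -> a <> x -> b <> x -> a <> v -> b <> v ->
    orient a b v <> 0 -> orient a b x <> 0 ->
    0 < mc v w x a -> mc v w x b < 0 ->
    ev (fun e => forall t, 0 <= t <= 1 -> tent v w x e (lerp t a b) <= 0)).
  { clear a b Hab Hav Hbv HaS HbS Hneab Hax Hbx Nab Nabx.
    intros a b Hab Hax Hbx Hav Hbv Nab Nabx Ba Bb.
    destruct (adj_in S E _ _ HE Hab) as [HaS [HbS Hneab]].
    assert (HO : orient v x a * orient v x b < 0).
    { rewrite (orient_v_x v w x HD a), (orient_v_x v w x HD b).
      assert (0 < orient v x w * orient v x w) by nra.
      assert (mc v w x a * mc v w x b < 0) by nra. nra. }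
    assert (G2 : 0 < orient a b v * orient a b x).
    { destruct (Rlt_or_le 0 (orient a b v * orient a b x)) as [G|G]; [easy|exfalso].
      apply (noncrossing_adj E v x a b HN Hx Hab). split; [easy|].
      destruct G as [G|G]; [easy|]. now apply (Rmult_integral_contrapositive_currified _ _ Nab Nabx) in G. }
    apply same_side_covered; [easy| |easy].
    rewrite <- (orient_rot v a b), <- (orient_rot w a b).
    apply Hother; auto.
    intros Hs. destruct (same_pair_param _ _ Hs) as [th [Hth [Hn0 Hn1]]].
    assert (Hsa : ~ same_pair x a a0 b0) by (intros H; unfold same_pair in *; intuition congruence).
    assert (Hsb : ~ same_pair x b a0 b0) by (intros H; unfold same_pair in *; intuition congruence).
    assert (P1 : 0 < orient v x a * orient c x a) by (rewrite Hc; apply orient_path; auto; lra).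
    assert (P2 : 0 < orient v x b * orient c x b) by (rewrite Hc; apply orient_path; auto; lra).
    assert (P3 : (1 - th) * orient c x a + th * orient c x b = 0).
    { rewrite <- orient_lerp3, <- Hth. apply orient_eq3. }
    assert (P4 : orient c x a * orient c x b < 0).
    { set (pa := orient c x a) in *. set (pb := orient c x b) in *.
      set (qa := orient v x a) in *. set (qb := orient v x b) in *.
      destruct (Rmult_pos_cases _ _ P1), (Rmult_pos_cases _ _ P2); nra. }
    assert (0 < th < 1).
    { set (pa := orient c x a) in *. set (pb := orient c x b) in *. destruct (Rmult_neg_cases _ _ P4); nra. }
    apply (Hno a b Hs). left. exists th; auto. }
  assert (Swap : ev (fun e => forall t, 0 <= t <= 1 -> tent v w x e (lerp t b a) <= 0) ->
     ev (fun e => forall t, 0 <= t <= 1 -> tent v w x e (lerp t a b) <= 0)).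
  { apply ev_mono. intros e He t Ht. rewrite lerp_swap. apply He; lra. }
  assert (Nba : orient b a v <> 0) by (rewrite orient_swap12; lra).
  assert (Nbax : orient b a x <> 0) by (rewrite orient_swap12; lra).
  destruct (point_type x a Hx HaS Hav Hax) as [[A1 A2]|[A1|[A1 [A2 A3]]]];
  destruct (point_type x b Hx HbS Hbv Hbx) as [[B1 B2]|[B1|[B1 [B2 B3]]]];
  try (apply Split; easy); try (apply Swap, Split; auto using adj_sym; fail).
  - eapply ev_mono; [|apply (ev_and _ _ (ev_beyond _ _ A1 A2) (ev_beyond _ _ B1 B2))].
    intros e [He1 He2] t Ht. apply tent_le_iff. left. rewrite lc_lerp, mc_lerp by easy.
    pose proof (affine_le_0 t _ _ Ht He1 He2). lra.
  - apply Mixed; auto.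
  - apply Swap, Mixed; auto using adj_sym.
  - eapply ev_mono; [|apply (ev_and _ _ (ev_below (lc v w x a) _ A1) (ev_below (lc v w x b) _ B1))].
    intros e [He1 He2] t Ht. apply tent_le_iff. right; right; left. rewrite lc_lerp, mc_lerp by easy.
    pose proof (affine_le_0 t _ _ Ht He1 He2). unfold Rdiv in *. lra.
Qed.

Lemma covered_tent x e a : covered x e a -> tent v w x e a <= 0.
Proof. intros H. apply tent_le_iff. unfold covered in H. tauto. Qed.

Lemma covered_spoke x e y l : orient v x w <> 0 -> covered x e y -> 0 <= l <= 1 ->
  tent v w x e (lerp l v y) <= 1 - l.
Proof.
  intros HD H Hl. apply tent_le_iff. rewrite lc_lerp, mc_lerp, lc_v, mc_v by easy.
  destruct H as [H|[H|H]]; [left|right; left|right; right; left]; unfold Rdiv in *; nra.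
Qed.

Definition nbrs : list point := cfilter (adj E v) S.

Lemma in_nbrs x : In x nbrs <-> adj E v x.
Proof.
  unfold nbrs. rewrite in_cfilter. split; [tauto|].
  intros H. split; [apply (adj_in S E _ _ HE) in H; tauto|easy].
Qed.

Lemma nbr_gen x : adj E v x -> orient v x w <> 0.
Proof. intros H. apply (adj_in S E _ _ HE) in H. apply Hgen; intuition. Qed.

Definition bump (l : list point) (e : R) (z : point) : R :=
  fold_right (fun x acc => Rmax (tent v w x e z) acc) 0 l.

Lemma bump_nonneg l e z : 0 <= bump l e z.
Proof. induction l; simpl; [lra|]. eapply Rle_trans; [apply IHl|apply Rmax_r]. Qed.

Lemma bump_ge l e z x : In x l -> tent v w x e z <= bump l e z.
Proof.
  induction l as [|y l IH]; simpl; [easy|]. intros [->|H]; [apply Rmax_l|].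
  eapply Rle_trans; [apply IH, H|apply Rmax_r].
Qed.

Lemma bump_le l e z k : 0 <= k -> (forall x, In x l -> tent v w x e z <= k) -> bump l e z <= k.
Proof.
  intros Hk. induction l as [|y l IH]; simpl; [easy|]. intros H. apply Rmax_lub; auto.
Qed.

Lemma bump_lipschitz l e : (forall x, In x l -> adj E v x) -> lipschitz (bump l e).
Proof.
  induction l as [|y l IH]; intros H.
  - exists 0. intros p q. simpl. rewrite Rminus_diag, Rabs_R0; lra.
  - apply (lipschitz_max (tent v w y e) (bump l e)).
    + apply tent_lipschitz, nbr_gen, H; left; easy.
    + apply IH. intros x Hx; apply H; right; easy.
Qed.

Lemma bump_slope l e z s : (forall x, In x l -> adj E v x) -> 0 < e < 1 -> 0 <= s ->
  bump l e z - (1 - e) * s <= bump l e (shift z (fst w - fst v, snd w - snd v) s).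
Proof.
  intros H He Hs. induction l as [|y l IH].
  - simpl. nra.
  - assert (H1 : tent v w y e z - (1 - e) * s <= tent v w y e (shift z (fst w - fst v, snd w - snd v) s)).
    { apply tent_slope; [apply nbr_gen, H; left; easy|easy|easy]. }
    assert (H2 : bump l e z - (1 - e) * s <= bump l e (shift z (fst w - fst v, snd w - snd v) s)).
    { apply IH. intros x Hx; apply H; right; easy. }
    cbn [bump fold_right]. fold (bump l e z). fold (bump l e (shift z (fst w - fst v, snd w - snd v) s)).
    revert H1 H2. unfold Rmax; repeat destruct Rle_dec; lra.
Qed.

(** One [e] serves the finitely many neighbours, vertices and edges. On an edge [v y] the tent of
    [y] itself contributes [1 - t], and [covered_spoke] keeps the other tents below this value. *)
Lemma bump_exists : exists e, 0 < e < 1 /\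
  (forall a, In a S -> a <> v -> bump nbrs e a = 0) /\
  (forall a b t, adj E a b -> a <> v -> b <> v -> 0 <= t <= 1 -> bump nbrs e (lerp t a b) = 0) /\
  (forall y t, adj E v y -> 0 <= t <= 1 -> bump nbrs e (lerp t v y) = 1 - t).
Proof.
  assert (H1 : ev (fun e => forall x, In x nbrs -> forall a, In a S -> a <> v -> a <> x -> covered x e a)).
  { apply ev_all. intros x Hx. apply in_nbrs in Hx. apply ev_all. intros a Ha.
    destruct (classic (a <> v /\ a <> x)) as [[Hav Hax]|Hn].
    - eapply ev_mono; [|apply (ev_covered x a Hx Ha Hav Hax)]. auto.
    - exists 1. split; [lra|]. intros; tauto. }
  assert (H2 : ev (fun e => forall x, In x nbrs -> forall ab, In ab E -> fst ab <> v -> snd ab <> v ->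
      forall t, 0 <= t <= 1 -> tent v w x e (lerp t (fst ab) (snd ab)) <= 0)).
  { apply ev_all. intros x Hx. apply in_nbrs in Hx. apply ev_all. intros [a b] Hab. simpl.
    destruct (classic (a <> v /\ b <> v)) as [[Hav Hbv]|Hn].
    - eapply ev_mono; [|apply (ev_segment x a b Hx (or_introl Hab) Hav Hbv)]. auto.
    - exists 1. split; [lra|]. intros; tauto. }
  destruct (ev_ex _ (ev_and _ _ (ev_lt 1 Rlt_0_1) (ev_and _ _ H1 H2))) as [e [_ [He [G1 G2]]]].
  exists e. split; [easy|]. split; [|split].
  - intros a Ha Hav. apply Rle_antisym; [|apply bump_nonneg].
    apply bump_le; [lra|]. intros x Hx.
    destruct (point_eq_dec a x) as [->|Hax]; [|apply covered_tent; auto].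
    apply in_nbrs, nbr_gen in Hx. apply tent_le_iff. left. rewrite lc_x, mc_x by easy. lra.
  - intros a b t Hab Hav Hbv Ht. apply Rle_antisym; [|apply bump_nonneg].
    apply bump_le; [lra|]. intros x Hx.
    destruct Hab as [Hab|Hab].
    + apply (G2 x Hx _ Hab); easy.
    + rewrite lerp_swap. apply (G2 x Hx _ Hab); simpl; easy || lra.
  - intros y t Hy Ht. apply Rle_antisym.
    + apply bump_le; [lra|]. intros x Hx. pose proof (proj1 (in_nbrs x) Hx) as Hx'.
      destruct (point_eq_dec y x) as [->|Hyx].
      * apply tent_le_iff. left. rewrite lc_lerp, mc_lerp, lc_v, mc_v, lc_x, mc_x by (apply nbr_gen; easy). lra.
      * apply covered_spoke; [apply nbr_gen; easy| |easy]. apply G1; [easy| | |easy]; apply (adj_in S E _ _ HE) in Hy; intuition.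
    + apply Rle_trans with (tent v w y e (lerp t v y)); [|apply bump_ge, in_nbrs, Hy].
      pose proof (nbr_gen y Hy) as HD.
      unfold tent. rewrite lc_lerp, mc_lerp, lc_v, mc_v, lc_x, mc_x by easy.
      replace ((1 - t) * 0 + t * 1) with t by ring. replace ((1 - t) * 0 + t * 0) with 0 by ring.
      assert (0 <= t / e) by (apply Rmult_le_pos; [lra|left; apply Rinv_0_lt_compat; lra]).
      replace (0 / e) with 0 by (field; lra).
      repeat apply Rmin_glb; lra.
Qed.

Lemma lerp_0 p q : lerp 0 p q = p.
Proof. unfold lerp; destruct p, q; simpl; f_equal; ring. Qed.

(** The flow of the bump takes [v] straight to [w], fixes the other vertices, and is affine on every
    edge because the bump is. At time 1 the points are in general position with the triple [v],
    [a0], [b0] reversed. The neighbour [y0] ensures that the bump equals 1 at [v]; without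
    neighbours it would be 0. *)
Lemma move_not_supporting y0 : adj E v y0 -> ~ supporting S E.
Proof.
  intros Hy0 Hsup.
  destruct bump_exists as [e [He [B1 [B2 B3]]]].
  set (u := (fst w - fst v, snd w - snd v)).
  set (f := flow (bump nbrs e) u).
  assert (Hnb : forall x, In x nbrs -> adj E v x) by (intros x; apply in_nbrs).
  destruct (bump_lipschitz nbrs e Hnb) as [L HL].
  assert (Hiso : ambient_isotopy f).
  { apply (flow_isotopy _ _ L (1 - e)); [apply bump_nonneg|exact HL|lra|].
    intros p s Hs. apply bump_slope; easy. }
  assert (Fv : forall t, f v t = lerp t v w).
  { intros t. unfold f, flow.
    rewrite <- (lerp_0 v y0) at 2. rewrite B3 by (easy || lra).
    unfold shift, u, lerp; simpl; f_equal; ring. }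
  assert (Fa : forall a t, In a S -> a <> v -> f a t = a).
  { intros a t Ha Hav. unfold f, flow. rewrite B1 by easy. rewrite Rmult_0_r. apply shift_0. }
  assert (Fspoke : forall y t l, adj E v y -> 0 <= l <= 1 -> f (lerp l v y) t = lerp l (lerp t v w) y).
  { intros y t l Hy Hl. unfold f, flow. rewrite B3 by easy. unfold shift, u, lerp; simpl; f_equal; ring. }
  assert (Fedge : forall a b t l, adj E a b -> a <> v -> b <> v -> 0 <= l <= 1 -> f (lerp l a b) t = lerp l a b).
  { intros a b t l Hab Hav Hbv Hl. unfold f, flow. rewrite B2 by easy. rewrite Rmult_0_r. apply shift_0. }
  assert (Hnonzero : forall a b t, In a S -> In b S -> a <> v -> b <> v -> a <> b -> ~ same_pair a b a0 b0 ->
     0 <= t <= 1 -> orient (lerp t v w) a b <> 0).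
  { intros a b t Ha Hb Hav Hbv Hab Hs Ht Hz.
    pose proof (orient_path a b t Ha Hb Hav Hbv Hab Hs Ht) as P. rewrite Hz in P. lra. }
  assert (Hsegs : forall p q t, 0 <= t <= 1 -> In (p, q) E -> image_is_segment (fun x => f x t) p q).
  { intros p q t Ht Hpq. pose proof (HE _ Hpq) as [Hp [Hq Hne]]. simpl in *.
    destruct (point_eq_dec p v) as [->|Hpv]; [|destruct (point_eq_dec q v) as [->|Hqv]].
    - exists (lerp t v w), q. intros y. split.
      + intros [x [[l [Hl ->]] ->]]. exists l. split; [easy|]. apply (Fspoke q t l); [left|]; easy.
      + intros [l [Hl ->]]. exists (lerp l v q). split; [exists l; easy|].
        symmetry. apply (Fspoke q t l); [left|]; easy.
    - exists p, (lerp t v w). intros y. split.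
      + intros [x [[l [Hl ->]] ->]]. exists l. split; [easy|].
        fold (lerp l p v). fold (lerp l p (lerp t v w)). rewrite (lerp_swap l p v), (lerp_swap l p).
        apply Fspoke; [right; easy|lra].
      + intros [l [Hl ->]]. exists (lerp l p v). split; [exists l; easy|].
        fold (lerp l p (lerp t v w)). rewrite (lerp_swap l p v), (lerp_swap l p).
        symmetry. apply Fspoke; [right; easy|lra].
    - exists p, q. intros y. split.
      + intros [x [[l [Hl ->]] ->]]. exists l. split; [easy|]. apply (Fedge p q t l); auto. left; easy.
      + intros [l [Hl ->]]. exists (lerp l p q). split; [exists l; easy|].
        symmetry. apply (Fedge p q t l); auto. left; easy. }
  assert (Hfour : forall t, 0 <= t <= 1 -> no_four_collinear S (fun x => f x t)).
  { intros t Ht p1 p2 p3 p4 I1 I2 I3 I4 N12 N13 N14 N23 N24 N34 [C1 C2].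
    unfold collinear in C1, C2.
    (* Two different pairs of fixed points cannot both be the special pair, so at any time at least
       one of the two triples is not collinear. *)
    assert (Key : forall p2 p3 p4, In p2 S -> In p3 S -> In p4 S -> p2 <> v -> p3 <> v -> p4 <> v ->
      p2 <> p3 -> p2 <> p4 -> p3 <> p4 -> ~ (orient (lerp t v w) p2 p3 = 0 /\ orient (lerp t v w) p2 p4 = 0)).
    { clear p1 p2 p3 p4 I1 I2 I3 I4 N12 N13 N14 N23 N24 N34 C1 C2.
      intros p2 p3 p4 I2 I3 I4 V2 V3 V4 N23 N24 N34 [Z1 Z2].
      destruct (classic (same_pair p2 p3 a0 b0)) as [Hs|Hs].
      - apply (Hnonzero p2 p4 t); auto. intros Hs'. unfold same_pair in *. intuition congruence.
      - apply (Hnonzero p2 p3 t); auto. }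
    destruct (point_eq_dec p1 v) as [->|V1]; [|destruct (point_eq_dec p2 v) as [->|V2]].
    - rewrite Fv in C1, C2. rewrite !Fa in C1, C2 by auto. apply (Key p2 p3 p4); auto.
    - rewrite Fv in C1, C2. rewrite !Fa in C1, C2 by auto.
      rewrite orient_swap12 in C1, C2. apply (Key p1 p3 p4); auto. split; lra.
    - destruct (point_eq_dec p3 v) as [->|V3].
      + rewrite !Fa in C2 by auto. apply (HS p1 p2 p4); auto.
      + rewrite !Fa in C1 by auto. apply (HS p1 p2 p3); auto. }
  pose proof (Hsup f Hiso) as Hord.
  assert (Hord' : image_general_position S (fun x => f x 1) -> same_order_type S (fun x => f x 1)).
  { apply Hord; [|lra]. intros t Ht. split; [|auto]. intros [p q]; simpl; auto. }
  clear Hord.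
  assert (Fw : f v 1 = w).
  { rewrite Fv. unfold lerp; destruct v, w; simpl; f_equal; ring. }
  assert (Hw : forall a b, In a S -> In b S -> a <> v -> b <> v -> a <> b -> orient w a b <> 0).
  { intros a b Ha Hb Hav Hbv Hab Hz. destruct (classic (same_pair a b a0 b0)) as [[[-> ->]|[-> ->]]|Hs].
    - rewrite Hz in Hspec. lra.
    - rewrite orient_swap in Hz. assert (Hz' : orient w a0 b0 = 0) by lra. rewrite Hz' in Hspec. lra.
    - pose proof (Hother a b Ha Hb Hav Hbv Hab Hs) as P. rewrite Hz in P. lra. }
  assert (Hgp : image_general_position S (fun x => f x 1)).
  { intros p q r Hp Hq Hr Hpq Hqr Hpr Hz. unfold collinear in Hz.
    destruct (point_eq_dec p v) as [->|Vp]; [|destruct (point_eq_dec q v) as [->|Vq]; [|destruct (point_eq_dec r v) as [->|Vr]]].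
    - rewrite Fw in Hz. rewrite !Fa in Hz by auto. apply (Hw q r); auto.
    - rewrite Fw in Hz. rewrite !Fa in Hz by auto. rewrite orient_rot in Hz. apply (Hw r p); auto.
    - rewrite Fw in Hz. rewrite !Fa in Hz by auto. apply (Hw p q); auto. rewrite orient_rot. easy.
    - rewrite !Fa in Hz by auto. apply (HS p q r); auto. }
  specialize (Hord' Hgp v a0 b0 Hv Ha0 Hb0 Hva0 Ha0b0 Hvb0). simpl in Hord'.
  rewrite Fw in Hord'. rewrite !Fa in Hord' by auto.
  destruct Hord' as [[O1 O2] [[O3 O4] _]].
  destruct (Rmult_neg_cases _ _ Hspec); intuition lra.
Qed.

End Move.

(** * Rigidity *)

Definition maximal (S : list point) (E : list (point * point)) : Prop :=
  forall a b, In a S -> In b S -> a <> b -> ~ adj E a b -> exists c d, In (c, d) E /\ crosses a b c d.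

(** Encoded as a corner: an angle below pi, counterclockwise from [x] to [y], between consecutive
    neighbours of [v]. That it closes up to an empty triangle of the graph follows from maximality
    in [face_opposite] and [face_empty]. *)
Definition face (E : list (point * point)) (v x y : point) : Prop :=
  adj E v x /\ adj E v y /\ 0 < orient v x y /\
  forall z, adj E v z -> 0 < orient v x z -> 0 < orient v z y -> False.

Lemma exists_not_in (S l : list point) : NoDup S -> (length l < length S)%nat -> exists q, In q S /\ ~ In q l.
Proof.
  intros HS Hl. destruct (classic (exists q, In q S /\ ~ In q l)) as [H|H]; [easy|exfalso].
  assert (incl S l).
  { intros q Hq. destruct (classic (In q l)); [easy|]. exfalso; eauto. }
  pose proof (NoDup_incl_length HS H0). lia.
Qed.

Lemma collinear_param c a b : a <> b -> orient c a b = 0 -> exists th, c = lerp th a b.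
Proof.
  intros Hab Hc. unfold orient in Hc.
  destruct (Req_dec (fst b - fst a) 0) as [H|H].
  - assert (H' : snd b - snd a <> 0).
    { intros H'. apply Hab, injective_projections; lra. }
    exists ((snd c - snd a) / (snd b - snd a)). unfold lerp. apply injective_projections; simpl.
    + assert (Hf : (fst a - fst c) * (snd b - snd a) = 0).
      { replace (fst b) with (fst a) in Hc by lra. lra. }
      apply Rmult_integral in Hf. destruct Hf; [|contradiction].
      replace (fst b) with (fst a) by lra. transitivity (fst a); [lra|ring].
    + field; easy.
  - exists ((fst c - fst a) / (fst b - fst a)). unfold lerp. apply injective_projections; simpl.
    + field; easy.
    + apply Rmult_eq_reg_r with (fst b - fst a); [|easy]. field_simplify; [|easy]. lra.
Qed.

Definition affine (G : point -> R) : Prop :=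
  forall t p q, G (lerp t p q) = (1 - t) * G p + t * G q.

Lemma affine_nonzero_near G p q : affine G -> G p <> 0 -> ev (fun s => G (lerp s p q) <> 0).
Proof.
  intros HG Hp.
  destruct (Rtotal_order (G p) 0) as [H|[H|H]]; [|easy|].
  - eapply ev_mono; [|apply (ev_affine (- G p) (- (G q - G p))); lra].
    intros s Hs. rewrite HG. lra.
  - eapply ev_mono; [|apply (ev_affine (G p) (G q - G p)); lra].
    intros s Hs. rewrite HG. lra.
Qed.

Lemma affine_pos_near G p q : affine G -> 0 < G p -> ev (fun s => 0 < G (lerp s p q)).
Proof.
  intros HG Hp. eapply ev_mono; [|apply (ev_affine (G p) (G q - G p)); lra].
  intros s Hs. rewrite HG. lra.
Qed.

(** A function of [l] vanishing at the current point becomes nonzero after a small step towards a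
    point where it does not vanish; the strict conditions already achieved survive small steps. *)
Lemma generic_near (l m : list (point -> R)) w :
  (forall G, In G l -> affine G /\ exists p, G p <> 0) ->
  (forall G, In G m -> affine G /\ 0 < G w) ->
  exists w', (forall G, In G l -> G w' <> 0) /\ (forall G, In G m -> 0 < G w').
Proof.
  induction l as [|G l IH]; intros Hl Hm.
  - exists w. split; [easy|]. apply Hm.
  - destruct IH as [w1 [H1 H2]]; [intros; apply Hl; right; easy|easy|].
    destruct (Hl G (or_introl eq_refl)) as [HG [p Hp]].
    destruct (Req_dec (G w1) 0) as [Hz|Hz].
    + assert (E1 : ev (fun s => forall G, In G l -> G (lerp s w1 p) <> 0)).
      { apply ev_all. intros G' HG'. apply affine_nonzero_near; [apply Hl; right; easy|auto]. }
      assert (E2 : ev (fun s => forall G, In G m -> 0 < G (lerp s w1 p))).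
      { apply ev_all. intros G' HG'. apply affine_pos_near; [apply Hm; easy|auto]. }
      destruct (ev_ex _ (ev_and _ _ E1 E2)) as [s [Hs [S1 S2]]].
      exists (lerp s w1 p). split; [|easy]. intros G' [<-|HG']; [|auto].
      rewrite HG, Hz. assert (s * G p <> 0) by (apply Rmult_integral_contrapositive; split; [lra|easy]). lra.
    + exists w1. split; [|easy]. intros G' [<-|HG']; auto.
Qed.

Lemma list_argmin {A} (f : A -> R) l : l <> [] -> exists x, In x l /\ forall y, In y l -> f x <= f y.
Proof.
  induction l as [|a l IH]; [easy|]. intros _.
  destruct l as [|b l].
  - exists a. split; [left; easy|]. intros y [<-|[]]; lra.
  - destruct IH as [x [Hx H]]; [easy|].
    destruct (Rle_or_lt (f a) (f x)).
    + exists a. split; [left; easy|]. intros y [<-|Hy]; [lra|]. specialize (H y Hy); lra.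
    + exists x. split; [right; easy|]. intros y [<-|Hy]; [lra|auto].
Qed.

Section Rigid.

Variables (S : list point) (E : list (point * point)).
Hypothesis HND : NoDup S.
Hypothesis Hlen : (5 <= length S)%nat.
Hypothesis HS : general_position S.
Hypothesis HE : geometric_graph S E.
Hypothesis HN : noncrossing E.
Hypothesis HM : maximal S E.
Hypothesis Hsup : supporting S E.

Lemma orient_neq0_distinct a b c : orient a b c <> 0 -> a <> b /\ b <> c /\ a <> c.
Proof.
  intros H. split; [|split]; intros ->; apply H; [apply orient_eq1|apply orient_eq2|apply orient_eq3].
Qed.

Lemma mult_neg_neq0 a b : a * b < 0 -> a <> 0 /\ b <> 0.
Proof. intros H; split; intros ->; lra. Qed.

Section Flip.

Variables v w a0 b0 : point.
Hypothesis Hv : In v S.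
Hypothesis Ha0 : In a0 S.
Hypothesis Hb0 : In b0 S.
Hypothesis Hva0 : v <> a0.
Hypothesis Hvb0 : v <> b0.
Hypothesis Ha0b0 : a0 <> b0.
Hypothesis Hother : forall a b, In a S -> In b S -> a <> v -> b <> v -> a <> b ->
  ~ same_pair a b a0 b0 -> 0 < orient v a b * orient w a b.
Variables (t0 : R) (c : point).
Hypothesis Ht0 : 0 < t0 < 1.
Hypothesis Hc : c = lerp t0 v w.

Lemma path_sign a b : In a S -> In b S -> a <> v -> b <> v -> a <> b -> ~ same_pair a b a0 b0 ->
  0 < orient v a b * orient c a b.
Proof. intros. rewrite Hc, orient_lerp. apply convex_same_sign; [apply Hother; auto|lra]. Qed.

Lemma prod_sign_trans x y z u : 0 < x * y -> 0 < z * u -> x * z < 0 -> y * u < 0.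
Proof.
  intros H1 H3 H2. destruct (Rmult_pos_cases _ _ H1), (Rmult_pos_cases _ _ H3), (Rmult_neg_cases _ _ H2); nra.
Qed.

(** Otherwise, by maximality, an edge [p q] crosses [v a]. Up to [c] no other orientation changes,
    so the line [p q] also separates [c] from [a], and [p], [q] lie on different sides of the line
    [a b]. Hence [p q] crosses the edge [a b] if [c] is on it, and the edge [v b] if [a] is between
    [c] and [b]. *)
Lemma exit_adj a b th : same_pair a b a0 b0 -> c = lerp th a b ->
  (0 < th < 1 /\ adj E a b) \/ (th < 0 /\ adj E v b) -> adj E v a.
Proof.
  intros Hs Hth Hex.
  assert (Hab : In a S /\ In b S /\ v <> a /\ v <> b /\ a <> b).
  { destruct Hs as [[-> ->]|[-> ->]]; auto 10. }
  destruct Hab as [HaS [HbS [Hva [Hvb Hab]]]].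
  destruct (classic (adj E v a)) as [H|Hna]; [easy|exfalso].
  destruct (HM v a Hv HaS Hva Hna) as [p [q [Hpq [X1 X2]]]].
  destruct (HE _ Hpq) as [HpS [HqS Hpq']]; simpl in *.
  assert (Np : p <> v /\ p <> a /\ q <> v /\ q <> a).
  { destruct (mult_neg_neq0 _ _ X1) as [Z1 Z2]. apply orient_neq0_distinct in Z1, Z2. intuition. }
  destruct Np as [Npv [Npa [Nqv Nqa]]].
  assert (Hth1 : th < 1) by (destruct Hex as [[? _]|[? _]]; lra).
  (* The crossing edge cannot end at [b]: the orientation with [b] and [q] is the same at [v] and
     [c], and [c] lies on the same side of [b q] as [a], since [th < 1]. *)
  assert (Endpoint : forall q, In q S -> b <> q -> q <> v -> q <> a -> ~ orient b q v * orient b q a < 0).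
  { clear - Hth Hth1 Hs HbS Hvb Hother Hv Ht0 Hc. intros q HqS Hbq Nqv Nqa Z.
    assert (Hns : ~ same_pair b q a0 b0) by (intros H; unfold same_pair in *; intuition congruence).
    pose proof (path_sign b q HbS HqS ltac:(auto) Nqv Hbq Hns) as P.
    rewrite Hth, orient_lerp, orient_eq1 in P.
    rewrite (orient_rot v b q), (orient_rot a b q) in P.
    destruct (Rmult_neg_cases _ _ Z); nra. }
  destruct (point_eq_dec p b) as [->|Npb]; [apply (Endpoint q); auto|].
  destruct (point_eq_dec q b) as [->|Nqb].
  { apply (Endpoint p); auto. rewrite !(orient_swap12 p b). rewrite <- Rmult_opp_opp in X2. easy. }
  assert (Npq : ~ same_pair p q a0 b0) by (intros H; unfold same_pair in *; intuition congruence).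
  assert (Nap : ~ same_pair a p a0 b0) by (intros H; unfold same_pair in *; intuition congruence).
  assert (Naq : ~ same_pair a q a0 b0) by (intros H; unfold same_pair in *; intuition congruence).
  assert (Nbp : ~ same_pair b p a0 b0) by (intros H; unfold same_pair in *; intuition congruence).
  assert (Nbq : ~ same_pair b q a0 b0) by (intros H; unfold same_pair in *; intuition congruence).
  pose proof (path_sign p q HpS HqS Npv Nqv Hpq' Npq) as Ppq.
  pose proof (path_sign a p HaS HpS ltac:(auto) Npv ltac:(auto) Nap) as Pap.
  pose proof (path_sign a q HaS HqS ltac:(auto) Nqv ltac:(auto) Naq) as Paq.
  pose proof (path_sign b p HbS HpS ltac:(auto) Npv ltac:(auto) Nbp) as Pbp.
  pose proof (path_sign b q HbS HqS ltac:(auto) Nqv ltac:(auto) Nbq) as Pbq.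
  pose proof (prod_sign_trans _ _ _ _ Pap Paq X1) as Q1.
  rewrite Hth, !orient_lerp, !orient_eq1 in Q1. rewrite !(orient_swap12 a b) in Q1.
  rewrite <- !(orient_rot _ p q) in X2.
  rewrite Hth, orient_lerp in Ppq.
  assert (Q2 : orient a b p * orient a b q < 0).
  { assert (0 < th * th) by (destruct Hex as [[? _]|[? _]]; nra).
    set (m1 := orient a b p) in *. set (m2 := orient a b q) in *.
    assert ((th * th) * (m1 * m2) < 0) by lra. nra. }
  destruct Hex as [[Hth' Hadj]|[Hth' Hadj]].
  - apply (noncrossing_adj E a b p q HN Hadj (or_introl Hpq)). split; [easy|].
    rewrite <- !(orient_rot _ p q).
    set (ov := orient v p q) in *. set (oa := orient a p q) in *. set (ob := orient b p q) in *.
    destruct (Rmult_neg_cases _ _ X2), (Rmult_pos_cases _ _ Ppq); nra.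
  - apply (noncrossing_adj E v b p q HN Hadj (or_introl Hpq)). split.
    + rewrite Hth, orient_lerp, orient_eq1 in Pbp, Pbq.
      set (m1 := orient a b p) in *. set (m2 := orient a b q) in *.
      set (n1 := orient v b p) in *. set (n2 := orient v b q) in *.
      destruct (Rmult_neg_cases _ _ Q2), (Rmult_pos_cases _ _ Pbp), (Rmult_pos_cases _ _ Pbq); nra.
    + rewrite <- !(orient_rot _ p q).
      set (ov := orient v p q) in *. set (oa := orient a p q) in *. set (ob := orient b p q) in *.
      destruct (Rmult_neg_cases _ _ X2), (Rmult_pos_cases _ _ Ppq); nra.
Qed.

(** A neighbour [z] inside the angle keeps its orientations with [a] and [b] up to [c]. If [c] is on
    the edge [a b], this places [z] beyond that edge, and [v z] crosses it; if [th < 0], the two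
    orientations contradict each other. *)
Lemma exit_between a b th z : same_pair a b a0 b0 -> c = lerp th a b ->
  (0 < th < 1 /\ adj E a b) \/ (th < 0 /\ adj E v b) -> adj E v z ->
  0 < orient v a z * orient v a b -> 0 < orient v z b * orient v a b -> False.
Proof.
  intros Hs Hth Hex Hz Z1 Z2.
  assert (Hab : In a S /\ In b S /\ v <> a /\ v <> b /\ a <> b).
  { destruct Hs as [[-> ->]|[-> ->]]; auto 10. }
  destruct Hab as [HaS [HbS [Hva [Hvb Hab]]]].
  destruct (adj_in S E _ _ HE Hz) as [_ [HzS Hvz]].
  assert (Hza : a <> z) by (intros ->; rewrite orient_eq2 in Z1; lra).
  assert (Hzb : z <> b) by (intros ->; rewrite orient_eq2 in Z2; lra).
  assert (Naz : ~ same_pair a z a0 b0) by (intros H; unfold same_pair in *; intuition congruence).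
  assert (Nzb : ~ same_pair z b a0 b0) by (intros H; unfold same_pair in *; intuition congruence).
  pose proof (path_sign a z HaS HzS ltac:(auto) ltac:(auto) Hza Naz) as P1.
  pose proof (path_sign z b HzS HbS ltac:(auto) ltac:(auto) Hzb Nzb) as P2.
  rewrite Hth, orient_lerp, orient_eq1, (orient_swap12 a b z) in P1.
  rewrite Hth, orient_lerp, orient_eq3, (orient_swap a b z) in P2.
  assert (Hm : orient a b v = orient v a b) by (symmetry; apply orient_rot).
  set (m := orient a b z) in *. set (s := orient v a b) in *.
  destruct Hex as [[Hth' Hadj]|[Hth' Hadj]].
  - apply (noncrossing_adj E v z a b HN Hz Hadj). split.
    + rewrite (orient_swap v a z).
      destruct (Rmult_pos_cases _ _ Z1), (Rmult_pos_cases _ _ Z2); nra.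
    + fold m. rewrite Hm.
      destruct (Rmult_pos_cases _ _ Z1), (Rmult_pos_cases _ _ P1); nra.
  - destruct (Rmult_pos_cases _ _ Z1), (Rmult_pos_cases _ _ Z2), (Rmult_pos_cases _ _ P1), (Rmult_pos_cases _ _ P2); nra.
Qed.

(** Either the move is unobstructed, which contradicts [supporting], or the obstruction makes the
    flipped pair the two ends of a face at [v]. *)
Lemma flip_face y0 :
  orient v a0 b0 * orient w a0 b0 < 0 -> (forall x, In x S -> x <> v -> orient v x w <> 0) ->
  (exists th, c = lerp th a0 b0 /\ th <> 0 /\ th <> 1) -> adj E v y0 ->
  exists a b, face E v a b /\ orient w a b < 0.
Proof.
  intros Hspec Hgen [th0 [Hth0 [Hn0 Hn1]]] Hy0.
  destruct (classic (exists a b, same_pair a b a0 b0 /\ exit_edge E v c a b)) as [[a [b [Hs Hex]]]|Hno].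
  - assert (Hex' : exists th, c = lerp th a b /\ ((0 < th < 1 /\ adj E a b) \/ (th < 0 /\ adj E v b))).
    { destruct Hex as [[th [H1 [H2 H3]]]|[th [H1 [H2 H3]]]]; exists th; auto. }
    destruct Hex' as [th [Hth Hex']].
    pose proof (exit_adj a b th Hs Hth Hex') as Hva.
    assert (Hvb : adj E v b).
    { destruct Hex' as [[H1 H2]|[H1 H2]]; [|easy].
      apply (exit_adj b a (1 - th)).
      - unfold same_pair in *; tauto.
      - rewrite Hth; apply lerp_swap.
      - left. split; [lra|apply adj_sym; easy]. }
    pose proof (fun z => exit_between a b th z Hs Hth Hex') as Hbt.
    assert (Hsp : orient v a b * orient w a b < 0).
    { destruct Hs as [[-> ->]|[-> ->]]; [easy|]. rewrite (orient_swap v a0 b0), (orient_swap w a0 b0). lra. }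
    destruct (Rmult_neg_cases _ _ Hsp) as [[H1 H2]|[H1 H2]].
    + exists a, b. split; [|easy]. split; [easy|]. split; [easy|]. split; [easy|].
      intros z Hz Z1 Z2. apply (Hbt z Hz); nra.
    + exists b, a. rewrite (orient_swap w a b). split; [|lra]. split; [easy|]. split; [easy|].
      split; [rewrite orient_swap; lra|].
      intros z Hz Z1 Z2. rewrite orient_swap in Z1, Z2. apply (Hbt z Hz); nra.
  - exfalso.
    apply (move_not_supporting S E HS HE HN v w a0 b0 Hv Ha0 Hb0 Hva0 Hvb0 Ha0b0 Hother Hspec Hgen
             t0 th0 c Ht0 Hc Hth0 Hn0 Hn1) with y0; auto.
    intros a b Hs Hex. apply Hno; eauto.
Qed.

End Flip.

Lemma affine_orient1 a b : affine (fun p => orient p a b).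
Proof. intros t p q; apply orient_lerp. Qed.

Lemma affine_orient2 v x : affine (fun p => orient v p x).
Proof. intros t p q. rewrite !(orient_rot v), orient_lerp. ring. Qed.

Lemma orient_direction v x : v <> x -> exists p, orient v p x <> 0.
Proof.
  intros H. destruct (Req_dec (fst x) (fst v)) as [Hf|Hf].
  - exists (fst v + 1, snd v). unfold orient; simpl. intros Hz. apply H, injective_projections; lra.
  - exists (fst v, snd v + 1). unfold orient; simpl. intros Hz. lra.
Qed.

(** The target is perturbed to a generic [w'] that still violates the claim. On the way from [v] to
    [w'] the first triple to flip does so alone, so by [flip_face] a face flips; but a face is
    positive at [v] and at [w'], hence all along the segment. The conclusion is weak because [w] may
    lie on a line through two points. *)
Lemma rigid v w : In v S -> (exists y0, adj E v y0) ->
  (forall a b, face E v a b -> 0 < orient w a b) ->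
  forall a b, In a S -> In b S -> a <> v -> b <> v -> 0 < orient v a b -> 0 <= orient w a b.
Proof.
  intros Hv [y0 Hy0] Hface a1 b1 Ha1 Hb1 Ha1v Hb1v Hpos.
  destruct (Rle_or_lt 0 (orient w a1 b1)) as [H|Hneg]; [easy|exfalso].
  set (Q := cfilter (fun ab => fst ab <> v /\ snd ab <> v /\ fst ab <> snd ab) (list_prod S S)).
  assert (HQ : forall a b, In (a, b) Q <-> In a S /\ In b S /\ a <> v /\ b <> v /\ a <> b).
  { intros a b. unfold Q. rewrite in_cfilter, in_prod_iff. simpl. tauto. }
  assert (HQ0 : forall a b, In (a, b) Q -> orient v a b <> 0).
  { intros a b H. apply HQ in H. apply HS; intuition. }
  set (L1 := map (fun x p => orient v p x) (cfilter (fun x => x <> v) S)).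
  set (L2 := map (fun (ab : point * point) p => orient p (fst ab) (snd ab)) Q).
  (* A zero of such a function would be a target for which two different pairs become collinear with
     the moving point at the same time. *)
  set (L3 := map (fun (q : (point * point) * (point * point)) p =>
       orient v (fst (fst q)) (snd (fst q)) * orient p (fst (snd q)) (snd (snd q))
       - orient v (fst (snd q)) (snd (snd q)) * orient p (fst (fst q)) (snd (fst q)))
     (cfilter (fun q => ~ same_pair (fst (fst q)) (snd (fst q)) (fst (snd q)) (snd (snd q))) (list_prod Q Q))).
  set (M := (fun p => - orient p a1 b1) ::
     map (fun (ab : point * point) p => orient p (fst ab) (snd ab))
       (cfilter (fun ab => face E v (fst ab) (snd ab)) (list_prod S S))).
  destruct (generic_near (L1 ++ L2 ++ L3) M w) as [w' [G1 G2]].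
  { intros G HG. rewrite !in_app_iff in HG. destruct HG as [HG|[HG|HG]].
    - apply in_map_iff in HG. destruct HG as [x [<- Hx]]. apply in_cfilter in Hx.
      split; [apply affine_orient2|apply orient_direction; intuition].
    - apply in_map_iff in HG. destruct HG as [[a b] [<- Hab]].
      split; [apply affine_orient1|exists v; apply HQ0; easy].
    - apply in_map_iff in HG. destruct HG as [[[a b] [c d]] [<- Hq]]. simpl.
      apply in_cfilter in Hq. rewrite in_prod_iff in Hq. simpl in Hq. destruct Hq as [[Hab Hcd] Hns].
      split.
      { intros t p q. rewrite !orient_lerp. ring. }
      pose proof (HQ0 _ _ Hab) as Z1. pose proof (HQ0 _ _ Hcd) as Z2.
      apply HQ in Hab, Hcd.
      (* The subtracted term vanishes at [a] and at [b]; one of these two points is outside the pair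
         [c], [d], and the other term is nonzero there. *)
      destruct (classic (a = c \/ a = d)) as [Ha|Ha].
      + assert (Hb : b <> c /\ b <> d).
        { unfold same_pair in Hns. intuition congruence. }
        exists b. rewrite orient_eq3. assert (orient b c d <> 0) by (apply HS; intuition).
        rewrite Rmult_0_r, Rminus_0_r. apply Rmult_integral_contrapositive; auto.
      + exists a. rewrite orient_eq1. assert (orient a c d <> 0) by (apply HS; intuition).
        rewrite Rmult_0_r, Rminus_0_r. apply Rmult_integral_contrapositive; auto. }
  { intros G [<-|HG].
    - split; [|lra]. intros t p q. rewrite orient_lerp. ring.
    - apply in_map_iff in HG. destruct HG as [[a b] [<- Hab]]. apply in_cfilter in Hab.
      split; [apply affine_orient1|apply Hface, Hab]. }
  assert (W1 : forall x, In x S -> x <> v -> orient v w' x <> 0).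
  { intros x Hx Hxv. apply (G1 (fun p => orient v p x)). rewrite !in_app_iff. left.
    apply (in_map (fun x p => orient v p x)). apply in_cfilter; auto. }
  assert (W2 : forall a b, In (a, b) Q -> orient w' a b <> 0).
  { intros a b H. apply (G1 (fun p => orient p a b)). rewrite !in_app_iff. right; left.
    apply (in_map (fun (ab : point * point) p => orient p (fst ab) (snd ab)) Q (a, b) H). }
  assert (W3 : forall a b c d, In (a, b) Q -> In (c, d) Q -> ~ same_pair a b c d ->
      orient v a b * orient w' c d - orient v c d * orient w' a b <> 0).
  { intros a b c d Hab Hcd Hns.
    apply (G1 (fun p => orient v a b * orient p c d - orient v c d * orient p a b)). rewrite !in_app_iff. right; right.
    apply in_map_iff. exists ((a, b), (c, d)). split; [easy|]. apply in_cfilter. rewrite in_prod_iff. auto. }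
  assert (W4 : forall a b, face E v a b -> 0 < orient w' a b).
  { intros a b Hab. apply (G2 (fun p => orient p a b)). right.
    apply in_map_iff. exists (a, b). split; [easy|]. apply in_cfilter. rewrite in_prod_iff. simpl.
    split; [|easy]. destruct Hab as [Ha [Hb _]].
    apply (adj_in S E _ _ HE) in Ha, Hb. tauto. }
  assert (W5 : orient w' a1 b1 < 0).
  { pose proof (G2 (fun p => - orient p a1 b1) (or_introl eq_refl)). simpl in H. lra. }
  clear G1 G2 L1 L2 L3 M Hneg Hface w.
  set (C := cfilter (fun ab => orient v (fst ab) (snd ab) * orient w' (fst ab) (snd ab) < 0) Q).
  (* The parameter at which the moving point meets the line through the pair; the minimum over the
     flipping pairs is the first flip. *)
  set (T := fun ab : point * point => orient v (fst ab) (snd ab) / (orient v (fst ab) (snd ab) - orient w' (fst ab) (snd ab))).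
  assert (Hne1 : a1 <> b1) by (intros ->; rewrite orient_eq2 in W5; lra).
  assert (HC1 : In (a1, b1) C).
  { apply in_cfilter. split; [apply HQ; auto|]. simpl. nra. }
  destruct (list_argmin T C) as [[a0 b0] [H0 Hmin]].
  { intros Hnil. rewrite Hnil in HC1. destruct HC1. }
  apply in_cfilter in H0. simpl in H0. destruct H0 as [HQ00 Hspec].
  pose proof HQ00 as HQ0'. apply HQ in HQ0'. destruct HQ0' as [Ha0 [Hb0 [Ha0v [Hb0v Ha0b0]]]].
  set (t0 := T (a0, b0)).
  assert (Ht0 : 0 < t0 < 1 /\ orient v a0 b0 + t0 * (orient w' a0 b0 - orient v a0 b0) = 0).
  { unfold t0, T; simpl. set (p := orient v a0 b0) in *. set (q := orient w' a0 b0) in *.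
    assert (Hpq : p - q <> 0) by (intros Hz; nra).
    split; [|field; easy].
    destruct (Rmult_neg_cases _ _ Hspec) as [[H1 H2]|[H1 H2]].
    - split; [apply Rdiv_lt_0_compat; lra|].
      apply Rmult_lt_reg_r with (p - q); [lra|]. unfold Rdiv. rewrite Rmult_assoc, Rinv_l by easy. lra.
    - replace (p / (p - q)) with ((- p) / (q - p)) by (field; split; lra).
      split; [apply Rdiv_lt_0_compat; lra|].
      apply Rmult_lt_reg_r with (q - p); [lra|]. unfold Rdiv. rewrite Rmult_assoc, Rinv_l by lra. lra. }
  destruct Ht0 as [Ht0 Hroot].
  assert (Hbefore : forall a b, In (a, b) Q -> ~ same_pair a b a0 b0 ->
     0 < orient v a b * (orient v a b + t0 * (orient w' a b - orient v a b))).
  { intros a b Hab Hns.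
    pose proof (W2 a b Hab) as N2. pose proof (HQ0 a b Hab) as N1.
    destruct (Rtotal_order (orient v a b * orient w' a b) 0) as [Hlt|[Hz|Hgt]].
    - assert (Hin : In (a, b) C) by (apply in_cfilter; auto).
      specialize (Hmin _ Hin). fold t0 in Hmin.
      pose proof (W3 _ _ _ _ Hab HQ00 Hns) as N3.
      unfold T in Hmin; simpl in Hmin.
      set (p := orient v a b) in *. set (q := orient w' a b) in *.
      set (p0 := orient v a0 b0) in *. set (q0 := orient w' a0 b0) in *.
      assert (Hpq : p - q <> 0) by (intros Hz; nra).
      set (r := p / (p - q)) in *.
      assert (Hr : p = r * (p - q)) by (unfold r; field; easy).
      assert (Htr : t0 <> r).
      { intros Heq. apply N3.
        assert (Hq : (1 - r) * p = - r * q) by lra. assert (Hq0 : (1 - r) * p0 = - r * q0) by (rewrite <- Heq; lra).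
        assert (r * (p * q0 - p0 * q) = 0).
        { replace (r * (p * q0 - p0 * q)) with (p0 * (- r * q) - p * (- r * q0)) by ring. rewrite <- Hq, <- Hq0. ring. }
        apply Rmult_integral in H. destruct H; [lra|easy]. }
      replace (p * (p + t0 * (q - p))) with ((r - t0) * (p * (p - q)))
        by (replace (p + t0 * (q - p)) with ((r - t0) * (p - q)) by lra; ring).
      assert (0 < p * (p - q)) by nra. nra.
    - apply Rmult_integral in Hz. tauto.
    - pose proof (convex_same_sign _ _ t0 Hgt ltac:(lra)). lra. }
  (* The move stops shortly after the first flip, before any other pair is reached. *)
  assert (Hev : ev (fun s => forall ab, In ab Q -> ~ same_pair (fst ab) (snd ab) a0 b0 ->
      0 < orient v (fst ab) (snd ab) * orient (lerp (t0 + s) v w') (fst ab) (snd ab))).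
  { apply ev_all. intros [a b] Hab; simpl.
    destruct (classic (same_pair a b a0 b0)) as [Hs|Hs]; [exists 1; split; [lra|intros; tauto]|].
    eapply ev_mono; [|apply (ev_affine _ (orient v a b * (orient w' a b - orient v a b)) (Hbefore a b Hab Hs))].
    intros s H _. rewrite orient_lerp. lra. }
  destruct (ev_ex _ (ev_and _ _ (ev_lt (1 - t0) ltac:(lra)) Hev)) as [s [Hs [Hs1 Hs2]]]. clear Hev.
  set (w1 := lerp (t0 + s) v w') in *.
  assert (Hother : forall a b, In a S -> In b S -> a <> v -> b <> v -> a <> b ->
    ~ same_pair a b a0 b0 -> 0 < orient v a b * orient w1 a b).
  { intros a b Ha Hb Hav Hbv Hab Hns. apply (Hs2 (a, b)); [apply HQ; auto|easy]. }
  set (c := lerp t0 v w').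
  assert (Hc : c = lerp (t0 / (t0 + s)) v w1).
  { unfold c, w1, lerp; simpl. apply injective_projections; simpl; field; lra. }
  assert (Ht : 0 < t0 / (t0 + s) < 1).
  { split; [apply Rdiv_lt_0_compat; lra|].
    apply Rmult_lt_reg_r with (t0 + s); [lra|]. unfold Rdiv. rewrite Rmult_assoc, Rinv_l by lra. lra. }
  assert (Hc0 : orient c a0 b0 = 0) by (unfold c; rewrite orient_lerp; lra).
  destruct (collinear_param c a0 b0 Ha0b0 Hc0) as [th Hth].
  (* A further point [q] shows that [c] is neither [a0] nor [b0]: there the orientation with [a0],
     [q] or with [b0], [q] would vanish, although it does not change. *)
  destruct (exists_not_in S [v; a0; b0]) as [q [Hq Hnq]]; [easy|simpl; lia|].
  assert (Hq' : q <> v /\ q <> a0 /\ q <> b0).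
  { simpl in Hnq. intuition. }
  destruct Hq' as [Hqv [Hqa Hqb]].
  assert (Hnc : forall a, a = a0 \/ a = b0 -> In a S -> a <> v -> c <> a).
  { intros a Ha HaS Hav Hca.
    assert (Hns : ~ same_pair a q a0 b0) by (unfold same_pair; intuition congruence).
    assert (Haq : a <> q) by (intuition congruence).
    pose proof (path_sign v w1 a0 b0 Hother _ c Ht Hc a q HaS Hq Hav Hqv Haq Hns) as P.
    rewrite Hca, orient_eq1 in P. lra. }
  destruct (flip_face v w1 a0 b0 Hv Ha0 Hb0 ltac:(auto) ltac:(auto) Ha0b0 Hother _ c Ht Hc y0) as [a [b [Hf Hlt]]].
  - unfold w1. rewrite orient_lerp.
    replace ((1 - (t0 + s)) * orient v a0 b0 + (t0 + s) * orient w' a0 b0) with (s * (orient w' a0 b0 - orient v a0 b0)) by lra.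
    destruct (Rmult_neg_cases _ _ Hspec) as [[H1 H2]|[H1 H2]].
    + assert (0 < orient v a0 b0 * (s * (orient v a0 b0 - orient w' a0 b0))).
      { apply Rmult_lt_0_compat; [easy|apply Rmult_lt_0_compat; lra]. } lra.
    + assert (0 < (- orient v a0 b0) * (s * (orient w' a0 b0 - orient v a0 b0))).
      { apply Rmult_lt_0_compat; [lra|apply Rmult_lt_0_compat; lra]. } lra.
  - intros x Hx Hxv. rewrite orient_swap. unfold w1. rewrite (affine_orient2 v x), orient_eq1.
    pose proof (W1 x Hx Hxv) as N. intros Hz.
    assert (Hz' : (t0 + s) * orient v w' x = 0) by lra.
    apply Rmult_integral in Hz'. destruct Hz'; [lra|easy].
  - exists th. split; [easy|]. split; intros ->.
    + apply (Hnc a0); auto. rewrite Hth. apply lerp_0.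
    + apply (Hnc b0); auto. rewrite Hth, lerp_swap, Rminus_diag. apply lerp_0.
  - easy.
  - pose proof (W4 a b Hf). destruct Hf as [_ [_ [Hp _]]].
    unfold w1 in Hlt. rewrite orient_lerp in Hlt.
    assert (0 <= (1 - (t0 + s)) * orient v a b) by (apply Rmult_le_pos; lra).
    assert (0 < (t0 + s) * orient w' a b) by (apply Rmult_lt_0_compat; lra). lra.
Qed.

End Rigid.

(** * Faces of a maximal noncrossing graph *)

Lemma crosses_point a b c d : crosses a b c d ->
  exists s t, 0 < s < 1 /\ 0 < t < 1 /\ lerp s a b = lerp t c d.
Proof.
  intros [H1 H2].
  assert (R : forall p q, p * q < 0 -> 0 < p / (p - q) < 1 /\ p - q <> 0).
  { intros p q H. destruct (Rmult_neg_cases _ _ H) as [[Hp Hq]|[Hp Hq]].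
    - split; [|lra]. split; [apply Rdiv_lt_0_compat; lra|].
      apply Rmult_lt_reg_r with (p - q); [lra|]. unfold Rdiv. rewrite Rmult_assoc, Rinv_l by lra. lra.
    - split; [|lra]. replace (p / (p - q)) with ((- p) / (q - p)) by (field; lra).
      split; [apply Rdiv_lt_0_compat; lra|].
      apply Rmult_lt_reg_r with (q - p); [lra|]. unfold Rdiv. rewrite Rmult_assoc, Rinv_l by lra. lra. }
  destruct (R _ _ H1) as [H3 N1]. destruct (R _ _ H2) as [H4 N2].
  exists (orient c d a / (orient c d a - orient c d b)), (orient a b c / (orient a b c - orient a b d)).
  split; [easy|]. split; [easy|].
  unfold lerp, orient in *. apply injective_projections; simpl; field; split; easy.
Qed.

Section Triangles.

Variables (S : list point) (E : list (point * point)).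
Hypothesis HS : general_position S.
Hypothesis HE : geometric_graph S E.
Hypothesis HN : noncrossing E.
Hypothesis HM : maximal S E.

Lemma orient_zero_eq v x p : In v S -> In x S -> In p S -> v <> x -> p <> v -> orient v x p = 0 -> p = x.
Proof.
  intros Hv Hx Hp Hvx Hpv Hz. destruct (point_eq_dec p x) as [|Hpx]; [easy|].
  exfalso. apply (HS v x p); auto.
Qed.

Lemma face_unique_r v a b b' : face E v a b -> face E v a b' -> b = b'.
Proof.
  intros [Ha [Hb [Hab H]]] [_ [Hb' [Hab' H']]].
  destruct (adj_in S E _ _ HE Hb) as [Hv [HbS Hvb]]. destruct (adj_in S E _ _ HE Hb') as [_ [HbS' Hvb']].
  destruct (Rtotal_order (orient v b b') 0) as [G|[G|G]].
  - exfalso. apply (H b' Hb' Hab'). rewrite orient_swap; lra.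
  - symmetry. apply (orient_zero_eq v b b'); auto.
  - exfalso. apply (H' b Hb Hab G).
Qed.

Lemma face_unique_l v a a' b : face E v a b -> face E v a' b -> a = a'.
Proof.
  intros [Ha [Hb [Hab H]]] [Ha' [_ [Hab' H']]].
  destruct (adj_in S E _ _ HE Ha) as [Hv [HaS Hva]]. destruct (adj_in S E _ _ HE Ha') as [_ [HaS' Hva']].
  destruct (Rtotal_order (orient v a a') 0) as [G|[G|G]].
  - exfalso. apply (H' a Ha); [rewrite orient_swap; lra|easy].
  - symmetry. apply (orient_zero_eq v a a'); auto.
  - exfalso. apply (H a' Ha' G Hab').
Qed.

(** A zero of [orient p q] inside the edge [v x] puts [v] and [x] on different sides of [p q], the
    missing half of a crossing. *)
Lemma no_cross_side v x p q e s : In v S -> In p S -> In q S -> v <> p -> v <> q ->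
  adj E v x -> adj E p q -> e = lerp s v x -> orient p q e = 0 ->
  orient v x p * orient v x q < 0 -> 0 < s < 1 -> False.
Proof.
  intros Hv Hp Hq Hvp Hvq Hvx Hpq He Hz Hopp Hs.
  destruct (adj_in S E _ _ HE Hpq) as [_ [_ Npq]].
  apply (noncrossing_adj E v x p q HN Hvx Hpq). split; [easy|].
  rewrite He, orient_lerp3 in Hz.
  assert (N : orient p q v <> 0) by (apply HS; auto).
  set (a := orient p q v) in *. set (b := orient p q x) in *.
  assert (Ha : 0 < (1 - s) * (a * a)).
  { apply Rmult_lt_0_compat; [lra|]. destruct (Rtotal_order a 0) as [G|[G|G]]; [nra|easy|nra]. }
  assert (Hab : (1 - s) * (a * a) + s * (a * b) = 0).
  { replace ((1 - s) * (a * a) + s * (a * b)) with (a * ((1 - s) * a + s * b)) by ring. rewrite Hz; ring. }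
  destruct (Rlt_or_le (a * b) 0) as [|G]; [easy|exfalso].
  assert (0 <= s * (a * b)) by (apply Rmult_le_pos; lra). lra.
Qed.

Section Face.

Variables v x y : point.
Hypothesis Hf : face E v x y.

Lemma face_coord z :
  z = (fst v + orient v z y / orient v x y * (fst x - fst v) + orient v x z / orient v x y * (fst y - fst v),
       snd v + orient v z y / orient v x y * (snd x - snd v) + orient v x z / orient v x y * (snd y - snd v)).
Proof.
  destruct Hf as [_ [_ [HD _]]]. assert (HD' : orient v x y <> 0) by lra.
  apply injective_projections; simpl;
  (apply Rmult_eq_reg_r with (orient v x y); [|easy]; field_simplify; [|easy]; unfold orient; ring).
Qed.

(** The unnormalised barycentric coordinate of [z] at [v]: zero on the line [x y] and positive on
    the side of [v]. *)
Lemma face_level z : orient z x y = orient v x y - orient v z y - orient v x z.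
Proof. unfold orient; ring. Qed.

(* Follows the edge [p q] from the point [c] of the open sector at [v] towards [p]: the edge
   either ends in the sector or leaves it beyond the line [x y]. *)
Lemma sector_exit p q c t : adj E p q -> p <> v -> q <> v -> 0 < t < 1 -> c = lerp t p q ->
  0 < orient v c y -> 0 < orient v x c ->
  (0 < orient v p y /\ 0 < orient v x p) \/ p = x \/ p = y \/
  exists m, 0 < m < 1 /\ orient (lerp m c p) x y <= 0.
Proof.
  intros Hpq Hpv Hqv Ht Hc Hal Hbe.
  pose proof Hf as [Hx [Hy [HD _]]].
  destruct (adj_in S E _ _ HE Hpq) as [HpS [HqS Npq]].
  destruct (adj_in S E _ _ HE Hx) as [HvS [HxS Nvx]].
  destruct (adj_in S E _ _ HE Hy) as [_ [HyS Nvy]].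
  assert (Ap : forall m, orient v (lerp m c p) y = (1 - m) * orient v c y + m * orient v p y).
  { intros m. rewrite !(orient_rot v). apply orient_lerp. }
  assert (Bp : forall m, orient v x (lerp m c p) = (1 - m) * orient v x c + m * orient v x p) by (intros; apply orient_lerp3).
  assert (Ac : orient v c y = (1 - t) * orient v p y + t * orient v q y).
  { rewrite Hc, !(orient_rot v). apply orient_lerp. }
  assert (Bc : orient v x c = (1 - t) * orient v x p + t * orient v x q) by (rewrite Hc; apply orient_lerp3).
  assert (Hline : forall m, orient p q (lerp m c p) = 0).
  { intros m. rewrite orient_lerp3, Hc, orient_lerp3, !orient_eq2, !orient_eq3. ring. }
  assert (Nv : orient p q v <> 0) by (apply HS; auto).
  destruct (Req_dec (orient v p y) 0) as [Z|Za].
  { right; right; left. apply (orient_zero_eq v y p); auto. rewrite orient_swap; lra. }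
  destruct (Req_dec (orient v x p) 0) as [Z|Zb].
  { right; left. apply (orient_zero_eq v x p); auto. }
  assert (Frac : forall a b, 0 < a -> b < 0 -> exists m, 0 < m < 1 /\ (1 - m) * a + m * b = 0).
  { intros a b Ha Hb. exists (a / (a - b)). split; [|field; lra].
    split; [apply Rdiv_lt_0_compat; lra|].
    apply Rmult_lt_reg_r with (a - b); [lra|]. unfold Rdiv. rewrite Rmult_assoc, Rinv_l by lra. lra. }
  (* Leaving through the ray from [v] through [x] before the line [x y] would mean crossing the edge
     [v x] or passing through [v]. *)
  assert (ViaB : forall m, 0 < m < 1 -> orient v x p < 0 -> orient v x (lerp m c p) = 0 ->
     0 <= orient v (lerp m c p) y -> orient (lerp m c p) x y <= 0).
  { intros m Hm Hneg Hz Hge. set (e := lerp m c p) in *.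
    destruct (Rle_or_lt (orient e x y) 0) as [|Hpos]; [easy|exfalso].
    rewrite (face_level e) in Hpos.
    assert (Ee : e = lerp (orient v e y / orient v x y) v x).
    { rewrite (face_coord e) at 1. rewrite Hz. unfold lerp. f_equal; field; lra. }
    destruct (Rle_lt_or_eq_dec _ _ Hge) as [Hgt|Heq].
    - apply (no_cross_side v x p q e (orient v e y / orient v x y)); auto.
      + apply Hline.
      + assert (0 < orient v x q) by nra. nra.
      + split; [apply Rdiv_lt_0_compat; lra|].
        apply Rmult_lt_reg_r with (orient v x y); [lra|]. unfold Rdiv. rewrite Rmult_assoc, Rinv_l by lra. lra.
    - apply Nv. rewrite <- Heq in Ee. unfold Rdiv in Ee. rewrite Rmult_0_l, lerp_0 in Ee.
      rewrite <- Ee. apply Hline. }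
  assert (ViaA : forall m, 0 < m < 1 -> orient v p y < 0 -> orient v (lerp m c p) y = 0 ->
     0 <= orient v x (lerp m c p) -> orient (lerp m c p) x y <= 0).
  { intros m Hm Hneg Hz Hge. set (e := lerp m c p) in *.
    destruct (Rle_or_lt (orient e x y) 0) as [|Hpos]; [easy|exfalso].
    rewrite (face_level e) in Hpos.
    assert (Ee : e = lerp (orient v x e / orient v x y) v y).
    { rewrite (face_coord e) at 1. rewrite Hz. unfold lerp. f_equal; field; lra. }
    destruct (Rle_lt_or_eq_dec _ _ Hge) as [Hgt|Heq].
    - apply (no_cross_side v y p q e (orient v x e / orient v x y)); auto.
      + apply Hline.
      + rewrite (orient_swap v p y), (orient_swap v q y). assert (0 < orient v q y) by nra. nra.
      + split; [apply Rdiv_lt_0_compat; lra|].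
        apply Rmult_lt_reg_r with (orient v x y); [lra|]. unfold Rdiv. rewrite Rmult_assoc, Rinv_l by lra. lra.
    - apply Nv. rewrite <- Heq in Ee. unfold Rdiv in Ee. rewrite Rmult_0_l, lerp_0 in Ee.
      rewrite <- Ee. apply Hline. }
  destruct (Rlt_or_le 0 (orient v p y)) as [Pa|Pa], (Rlt_or_le 0 (orient v x p)) as [Pb|Pb].
  - left; auto.
  - right; right; right. destruct (Frac (orient v x c) (orient v x p)) as [m [Hm Hz]]; [lra|lra|].
    exists m. split; [easy|]. apply ViaB; [easy|lra|rewrite Bp; easy|rewrite Ap; nra].
  - right; right; right. destruct (Frac (orient v c y) (orient v p y)) as [m [Hm Hz]]; [lra|lra|].
    exists m. split; [easy|]. apply ViaA; [easy|lra|rewrite Ap; easy|rewrite Bp; nra].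
  (* Here [p] is beyond both rays, and the ray that is met first is the one to use. *)
  - right; right; right. destruct (Frac (orient v x c) (orient v x p)) as [m [Hm Hz]]; [lra|lra|].
    destruct (Rle_or_lt 0 (orient v (lerp m c p) y)) as [G|G].
    + exists m. split; [easy|]. apply ViaB; [easy|lra|rewrite Bp; easy|easy].
    + rewrite Ap in G. destruct (Frac (orient v c y) (orient v p y)) as [m' [Hm' Hz']]; [lra|lra|].
      exists m'. split; [easy|]. apply ViaA; [easy|lra|rewrite Ap; easy|]. rewrite Bp.
      assert (m' < m) by nra. nra.
Qed.

(** Among the points in the triangle let [z] be farthest from the line [x y]. It is no neighbour of
    [v], so some edge crosses [v z], at a point [c] farther from [x y] than [z]. Followed in either
    direction from [c], this edge ends in the triangle, at a corner [x] or [y], or after crossing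
    [x y]; so both its ends are at a lower level than [c], which is a convex combination of them. *)
Lemma face_empty w : In w S -> 0 < orient v x w -> 0 < orient v w y -> 0 < orient w x y -> False.
Proof.
  intros Hw0 B0 A0 L0.
  pose proof Hf as [Hx [Hy [HD Hbt]]].
  destruct (adj_in S E _ _ HE Hx) as [HvS [HxS Nvx]].
  set (l := cfilter (fun w => 0 < orient v x w /\ 0 < orient v w y /\ 0 < orient w x y) S).
  destruct (list_argmin (fun z => - orient z x y) l) as [z [Hz Hmin]].
  { intros Hnil. assert (In w l) by (apply in_cfilter; auto). rewrite Hnil in H. destruct H. }
  apply in_cfilter in Hz. destruct Hz as [HzS [B [A L]]].
  assert (Nvz : v <> z) by (intros <-; rewrite orient_eq3 in B; lra).
  assert (Nadj : ~ adj E v z) by (intros H; apply (Hbt z H B A)).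
  destruct (HM v z HvS HzS Nvz Nadj) as [p [q [Hpq HX]]].
  destruct (HE _ Hpq) as [HpS [HqS Npq]]; simpl in *.
  assert (Np : p <> v /\ q <> v).
  { destruct HX as [HX _]. destruct (mult_neg_neq0 _ _ HX) as [Z1 Z2]. apply orient_neq0_distinct in Z1, Z2. intuition. }
  destruct Np as [Npv Nqv].
  destruct (crosses_point _ _ _ _ HX) as [s [t [Hs [Ht Hc]]]].
  set (c := lerp s v z) in *.
  assert (Ac : orient v c y = s * orient v z y).
  { unfold c. rewrite !(orient_rot v), orient_lerp, orient_eq3. ring. }
  assert (Bc : orient v x c = s * orient v x z).
  { unfold c. rewrite orient_lerp3, orient_eq3. ring. }
  assert (Lc : orient z x y < orient c x y).
  { rewrite (face_level c), (face_level z), Ac, Bc. nra. }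
  assert (Key : forall p q t, adj E p q -> p <> v -> q <> v -> 0 < t < 1 -> c = lerp t p q -> orient p x y < orient c x y).
  { clear p q t Hpq HX HpS HqS Npq Npv Nqv Ht Hc. intros p q t Hpq Npv Nqv Ht Hc.
    destruct (adj_in S E _ _ HE Hpq) as [HpS [HqS Npq]].
    destruct (sector_exit p q c t Hpq Npv Nqv Ht Hc ltac:(nra) ltac:(nra)) as [[G1 G2]|[->|[->|[m [Hm G]]]]].
    - destruct (Rle_or_lt (orient p x y) 0) as [G|G]; [lra|].
      specialize (Hmin p). assert (In p l) by (apply in_cfilter; auto). specialize (Hmin H). lra.
    - rewrite orient_eq1. lra.
    - rewrite orient_eq3. lra.
    - rewrite orient_lerp in G. nra. }
  pose proof (Key p q t (or_introl Hpq) Npv Nqv Ht Hc) as K1.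
  pose proof (Key q p (1 - t) (or_intror Hpq) Nqv Npv ltac:(lra) ltac:(rewrite Hc; apply lerp_swap)) as K2.
  rewrite Hc, orient_lerp in K1, K2. nra.
Qed.

(** Otherwise an edge crosses [x y], and its end on the side of [v] is either [v], giving a
    neighbour inside the angle, or a point in the triangle; by [sector_exit] nothing else is
    possible. *)
Lemma face_opposite : adj E x y.
Proof.
  pose proof Hf as [Hx [Hy [HD Hbt]]].
  destruct (adj_in S E _ _ HE Hx) as [HvS [HxS Nvx]].
  destruct (adj_in S E _ _ HE Hy) as [_ [HyS Nvy]].
  destruct (classic (adj E x y)) as [|Nadj]; [easy|exfalso].
  assert (Nxy : x <> y) by (intros ->; rewrite orient_eq2 in HD; lra).
  destruct (HM x y HxS HyS Nxy Nadj) as [p [q [Hpq HX]]].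
  destruct (crosses_point _ _ _ _ HX) as [s [t [Hs [Ht Hc]]]].
  set (c := lerp s x y) in *.
  assert (Ac : 0 < orient v c y).
  { unfold c. rewrite !(orient_rot v), orient_lerp, orient_eq1, <- orient_rot. nra. }
  assert (Bc : 0 < orient v x c).
  { unfold c. rewrite orient_lerp3, orient_eq2. nra. }
  assert (Lc : orient c x y = 0) by (unfold c; rewrite orient_lerp, orient_eq1, orient_eq3; ring).
  assert (Key : forall p q t, adj E p q -> 0 < t < 1 -> c = lerp t p q -> q <> v -> orient p x y <= 0).
  { clear p q t Hpq HX Ht Hc. intros p q t Hpq Ht Hc Nqv.
    destruct (adj_in S E _ _ HE Hpq) as [HpS [HqS Npq]].
    destruct (point_eq_dec p v) as [->|Npv].
    - exfalso. apply (Hbt q Hpq).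
      + rewrite Hc, orient_lerp3, orient_eq3 in Bc. nra.
      + rewrite Hc in Ac. rewrite (orient_rot v), orient_lerp, orient_eq3, <- orient_rot in Ac. nra.
    - destruct (sector_exit p q c t Hpq Npv Nqv Ht Hc Ac Bc) as [[G1 G2]|[->|[->|[m [Hm G]]]]].
      + destruct (Rle_or_lt (orient p x y) 0) as [G|G]; [easy|]. exfalso; apply (face_empty p); easy.
      + rewrite orient_eq1; lra.
      + rewrite orient_eq3; lra.
      + rewrite orient_lerp, Lc in G. nra. }
  destruct HX as [HX _]. rewrite <- !(orient_rot _ x y) in HX.
  assert (Hq : q <> v \/ p <> v).
  { destruct (HE _ Hpq) as [_ [_ Npq]]; simpl in Npq. destruct (point_eq_dec q v); [right|left]; congruence. }
  assert (Kp : q <> v -> orient p x y <= 0) by (apply (Key p q t); [left; easy|easy|easy]).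
  assert (Kq : p <> v -> orient q x y <= 0).
  { apply (Key q p (1 - t)); [right; easy|lra|rewrite Hc; apply lerp_swap]. }
  destruct (point_eq_dec p v) as [->|Npv]; [|destruct (point_eq_dec q v) as [->|Nqv]].
  - assert (Kp' : orient v x y <= 0) by (apply Kp; intuition). lra.
  - assert (Kp' : orient v x y <= 0) by (apply Kq; intuition). lra.
  - specialize (Kp Nqv). specialize (Kq Npv). nra.
Qed.

(** A neighbour of [x] inside the angle at [x] lies in the triangle, against [face_empty], or behind
    [v y], so that its edge crosses [v y]. *)
Lemma face_rot : face E x y v.
Proof.
  pose proof face_opposite as Hxy. pose proof Hf as [Hx [Hy [HD Hbt]]].
  destruct (adj_in S E _ _ HE Hx) as [HvS [HxS Nvx]].
  destruct (adj_in S E _ _ HE Hy) as [_ [HyS Nvy]].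
  split; [easy|]. split; [apply adj_sym; easy|]. split; [rewrite <- orient_rot; easy|].
  intros z Hz Z1 Z2.
  destruct (adj_in S E _ _ HE Hz) as [_ [HzS Nxz]].
  rewrite <- orient_rot in Z2.
  destruct (Rtotal_order (orient v z y) 0) as [G|[G|G]].
  - apply (noncrossing_adj E x z v y HN Hz Hy). split.
    + rewrite (orient_swap x y z), <- (orient_rot v x z). nra.
    + rewrite (orient_swap v x y), (orient_swap v z y). nra.
  - assert (z = y); [|subst; rewrite orient_eq2 in Z1; lra].
    apply (orient_zero_eq v y z); auto; [|rewrite orient_swap; lra].
    intros ->. rewrite orient_eq3 in Z2. lra.
  - apply (face_empty z); auto. rewrite orient_rot. easy.
Qed.

End Face.

End Triangles.

(** * Twin vertices *)

Section Twins.

Variables (S : list point) (E : list (point * point)).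
Hypothesis HND : NoDup S.
Hypothesis Hlen : (5 <= length S)%nat.
Hypothesis HS : general_position S.
Hypothesis HE : geometric_graph S E.
Hypothesis HN : noncrossing E.
Hypothesis HM : maximal S E.
Hypothesis Hsup : supporting S E.

(** The ends of an edge that no line through two other points separates. One implication suffices:
    general position makes the relation symmetric. *)
Definition twins (x y : point) : Prop :=
  adj E x y /\ forall a b, In a S -> In b S -> a <> x -> a <> y -> b <> x -> b <> y ->
    0 < orient x a b -> 0 < orient y a b.

Lemma twins_sym x y : twins x y -> twins y x.
Proof.
  intros [H1 H2]. split; [apply adj_sym; easy|].
  intros a b Ha Hb Hax Hay Hbx Hby H.
  destruct (Rtotal_order (orient x a b) 0) as [G|[G|G]]; [| |easy].
  - assert (G' : 0 < orient y b a) by (apply H2; auto; rewrite orient_swap; lra).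
    rewrite orient_swap in G'. lra.
  - exfalso. assert (a <> b) by (intros ->; rewrite orient_eq2 in H; lra).
    destruct (adj_in S E _ _ HE H1) as [Hx _]. apply (HS x a b); auto.
Qed.

(* Rigidity allows [y] to jump next to [x], to the point [lerp s x p] for small [s]. *)
Lemma twins_rotate x y p : twins x y ->
  (forall c, face E y x c -> 0 < orient p x c) ->
  (forall c, face E y c x -> 0 < orient p c x) ->
  forall z, In z S -> z <> x -> z <> y ->
    (0 < orient y x z -> 0 <= orient p x z) /\ (0 < orient y z x -> 0 <= orient p z x).
Proof.
  intros [Hxy Htw] H1 H2 z HzS Hzx Hzy.
  destruct (adj_in S E _ _ HE Hxy) as [HxS [HyS Nxy]].
  assert (Hev : ev (fun s => forall ab, In ab (list_prod S S) -> face E y (fst ab) (snd ab) ->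
     0 < orient (lerp s x p) (fst ab) (snd ab))).
  { apply ev_all. intros [a b] _; simpl.
    destruct (classic (face E y a b)) as [Hf|Hf]; [|exists 1; split; [lra|intros; tauto]].
    pose proof Hf as [Ha [Hb [Hab _]]].
    destruct (adj_in S E _ _ HE Ha) as [_ [HaS Nya]]. destruct (adj_in S E _ _ HE Hb) as [_ [HbS Nyb]].
    destruct (point_eq_dec a x) as [->|Nax]; [|destruct (point_eq_dec b x) as [->|Nbx]].
    - exists 1. split; [lra|]. intros s Hs _. rewrite orient_lerp, orient_eq1.
      assert (0 < s * orient p x b) by (apply Rmult_lt_0_compat; [lra|auto]). lra.
    - exists 1. split; [lra|]. intros s Hs _. rewrite orient_lerp, orient_eq3.
      assert (0 < s * orient p a x) by (apply Rmult_lt_0_compat; [lra|auto]). lra.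
    - assert (Hxab : 0 < orient x a b) by (apply (twins_sym x y (conj Hxy Htw)); auto).
      eapply ev_mono; [|apply (affine_pos_near (fun w => orient w a b) x p (affine_orient1 a b) Hxab)].
      auto. }
  destruct (ev_ex _ Hev) as [s [Hs Hw]].
  assert (Hface : forall a b, face E y a b -> 0 < orient (lerp s x p) a b).
  { intros a b Hf. apply (Hw (a, b)); [|easy]. apply in_prod_iff.
    destruct Hf as [Ha [Hb _]]. apply (adj_in S E _ _ HE) in Ha, Hb. tauto. }
  pose proof (rigid S E HND Hlen HS HE HN HM Hsup y (lerp s x p) HyS
     (ex_intro _ x (adj_sym _ _ _ Hxy)) Hface) as HR.
  split; intros Hz.
  - assert (G : 0 <= orient (lerp s x p) x z) by (apply HR; auto).
    rewrite orient_lerp, orient_eq1 in G. nra.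
  - assert (G : 0 <= orient (lerp s x p) z x) by (apply HR; auto).
    rewrite orient_lerp, orient_eq3 in G. nra.
Qed.

Lemma orient_pos_distinct a b c : 0 < orient a b c -> a <> b /\ b <> c /\ a <> c.
Proof. intros H. apply orient_neq0_distinct. lra. Qed.

Definition offset (x c z : point) (k1 k2 : R) : point :=
  (fst x + k1 * (fst c - fst x) + k2 * (fst z - fst x), snd x + k1 * (snd c - snd x) + k2 * (snd z - snd x)).

Lemma orient_offset_l x c z k1 k2 a : orient (offset x c z k1 k2) x a = k1 * orient c x a + k2 * orient z x a.
Proof. unfold offset, orient; simpl; ring. Qed.

Lemma orient_offset_r x c z k1 k2 a : orient (offset x c z k1 k2) a x = k1 * orient c a x + k2 * orient z a x.
Proof. unfold offset, orient; simpl; ring. Qed.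

Lemma other_points (l : list point) : (length l <= 4)%nat -> exists q, In q S /\ ~ In q l.
Proof. intros H. apply exists_not_in; [easy|lia]. Qed.

(** The first coefficient makes [orient p x z] the negative of [orient y x z] times a square, so a
    jump of [y] next to [x] towards [p] reverses the triple with [x] and [z]. The second coefficient
    remains free for satisfying the faces along the edge. *)
Lemma twins_blocked x y z c k2 : twins x y -> In c S -> In z S -> c <> x -> c <> y -> z <> x -> z <> y -> z <> c ->
  let p := offset x c z (- (orient y x z * orient z c x)) k2 in
  (forall c', face E y x c' -> 0 < orient p x c') -> (forall c', face E y c' x -> 0 < orient p c' x) -> False.
Proof.
  intros Htw HcS HzS Ncx Ncy Nzx Nzy Nzc p H1 H2.
  pose proof Htw as [Hxy _]. destruct (adj_in S E _ _ HE Hxy) as [HxS [HyS Nxy]].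
  assert (N1 : orient z c x <> 0) by (apply HS; auto).
  assert (N2 : orient y x z <> 0) by (apply HS; auto).
  destruct (twins_rotate x y p Htw H1 H2 z HzS Nzx Nzy) as [R1 R2].
  unfold p in R1, R2. rewrite orient_offset_l, (orient_eq3 z), <- (orient_rot z c x) in R1.
  rewrite orient_offset_r, orient_eq1, (orient_swap12 z c x) in R2. rewrite (orient_swap y x z) in R2.
  set (m := orient z c x) in *. set (k := orient y x z) in *.
  assert (Hm : 0 < m * m) by (destruct (Rtotal_order m 0) as [|[|]]; [nra|easy|nra]).
  destruct (Rtotal_order k 0) as [G|[G|G]]; [|easy|].
  - specialize (R2 ltac:(lra)). assert (0 < - k * (m * m)) by (apply Rmult_lt_0_compat; lra). lra.
  - specialize (R1 G). assert (0 < k * (m * m)) by (apply Rmult_lt_0_compat; lra). lra.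
Qed.

(** Without a face on this side of the edge, at most one face at [y] involves [x], and the sign of
    the free coefficient in [twins_blocked] satisfies it. *)
Lemma twins_face_r x y : twins x y -> exists c, face E y x c.
Proof.
  intros Htw. destruct (classic (exists c, face E y x c)) as [H|Hno]; [easy|exfalso].
  pose proof Htw as [Hxy _]. destruct (adj_in S E _ _ HE Hxy) as [HxS [HyS Nxy]].
  assert (Hc : exists c, In c S /\ c <> x /\ c <> y /\ forall c', face E y c' x -> c' = c).
  { destruct (classic (exists c, face E y c x)) as [[c Hc]|Hno'].
    - exists c. pose proof Hc as [Ha [_ [Hp _]]]. destruct (adj_in S E _ _ HE Ha) as [_ [HcS Nyc]].
      split; [easy|]. split; [intros ->; rewrite orient_eq2 in Hp; lra|]. split; [auto|].
      intros c' Hc'. apply (face_unique_l S E HS HE y c' c x); easy.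
    - destruct (other_points [x; y]) as [c [HcS Hc]]; [simpl; lia|]. simpl in Hc.
      exists c. split; [easy|]. split; [intuition|]. split; [intuition|].
      intros c' Hc'. exfalso; eauto. }
  destruct Hc as [c [HcS [Ncx [Ncy Huniq]]]].
  destruct (other_points [x; y; c]) as [z [HzS Hz]]; [simpl; lia|]. simpl in Hz.
  assert (Nz : z <> x /\ z <> y /\ z <> c) by intuition. destruct Nz as [Nzx [Nzy Nzc]].
  assert (N1 : orient z c x <> 0) by (apply HS; auto).
  apply (twins_blocked x y z c (orient z c x) Htw); auto.
  - intros c' Hc'. exfalso; eauto.
  - intros c' Hc'. rewrite (Huniq c' Hc'), orient_offset_r, orient_eq1.
    destruct (Rtotal_order (orient z c x) 0) as [|[|]]; [nra|easy|nra].
Qed.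

Lemma twins_face_l x y : twins x y -> exists c, face E y c x.
Proof.
  intros Htw. destruct (classic (exists c, face E y c x)) as [H|Hno]; [easy|exfalso].
  destruct (twins_face_r x y Htw) as [c Hc].
  pose proof Htw as [Hxy _]. destruct (adj_in S E _ _ HE Hxy) as [HxS [HyS Nxy]].
  pose proof Hc as [_ [Ha [Hp _]]]. destruct (adj_in S E _ _ HE Ha) as [_ [HcS Nyc]].
  assert (Ncx : c <> x) by (intros ->; rewrite orient_eq2 in Hp; lra).
  destruct (other_points [x; y; c]) as [z [HzS Hz]]; [simpl; lia|]. simpl in Hz.
  assert (Nz : z <> x /\ z <> y /\ z <> c) by intuition. destruct Nz as [Nzx [Nzy Nzc]].
  assert (N1 : orient z c x <> 0) by (apply HS; auto).
  apply (twins_blocked x y z c (- orient z c x) Htw); auto.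
  - intros c' Hc'. rewrite (face_unique_r S E HS HE y x c' c Hc' Hc), orient_offset_l, orient_eq3, (orient_swap z c x).
    destruct (Rtotal_order (orient z c x) 0) as [|[|]]; [nra|easy|nra].
  - intros c' Hc'. exfalso; eauto.
Qed.

Section Core.

Variables x y c c' : point.
Hypothesis Htw : twins x y.
Hypothesis Hfc : face E y x c.
Hypothesis Hfc' : face E y c' x.
Hypothesis Ho : 0 < orient x c c'.

(* Otherwise [y], moved next to [x], could cross the line [x z] while rotating about [x]. *)
Lemma wedge_free z : In z S -> z <> x -> z <> y -> z <> c -> z <> c' -> orient x z c' * orient x c z < 0.
Proof.
  intros HzS Nzx Nzy Nzc Nzc'.
  pose proof Htw as [Hxy _]. destruct (adj_in S E _ _ HE Hxy) as [HxS [HyS Nxy]].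
  pose proof Hfc as [_ [Hc _]]. pose proof Hfc' as [Hc' _].
  destruct (adj_in S E _ _ HE Hc) as [_ [HcS Nyc]]. destruct (adj_in S E _ _ HE Hc') as [_ [HcS' Nyc']].
  apply orient_pos_distinct in Ho as Ho'. destruct Ho' as [Nxc [Ncc' Nxc']].
  set (al := orient x z c'). set (be := orient x c z).
  assert (Na : al <> 0) by (apply HS; auto). assert (Nb : be <> 0) by (apply HS; auto).
  assert (Nyz : orient y x z <> 0) by (apply HS; auto).
  destruct (Rlt_or_le (al * be) 0) as [|G]; [easy|exfalso].
  assert (Hpos : 0 < al * be) by (destruct G as [G|G]; [easy|symmetry in G; apply Rmult_integral in G; tauto]).
  assert (Key : forall k1 k2, 0 < k1 -> 0 < k2 ->
     (0 < orient y x z -> 0 <= k2 * al - k1 * be) /\ (orient y x z < 0 -> k2 * al - k1 * be <= 0)).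
  { intros k1 k2 Hk1 Hk2.
    destruct (twins_rotate x y (offset x c c' k1 k2) Htw) with (z := z) as [R1 R2]; auto.
    - intros d Hd. rewrite (face_unique_r S E HS HE y x d c Hd Hfc), orient_offset_l, orient_eq3.
      rewrite <- (orient_rot x c c') in * || idtac. replace (orient c' x c) with (orient x c c') by (unfold orient; ring). nra.
    - intros d Hd. rewrite (face_unique_l S E HS HE y d c' x Hd Hfc'), orient_offset_r, orient_eq1.
      replace (orient c c' x) with (orient x c c') by (unfold orient; ring). nra.
    - rewrite orient_offset_l in R1. rewrite orient_offset_r, (orient_swap y x z) in R2.
      replace (orient c x z) with (- be) in R1 by (unfold be, orient; ring).
      replace (orient c' x z) with al in R1 by (unfold al, orient; ring).
      replace (orient c z x) with be in R2 by (unfold be, orient; ring).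
      replace (orient c' z x) with (- al) in R2 by (unfold al, orient; ring).
      split; intros G'; [specialize (R1 G')|specialize (R2 ltac:(lra))]; lra. }
  (* Coefficients in the ratio of [al] to [be] give a point on the line [x z]; doubling one of them
     moves it to the side opposite to [y]. *)
  destruct (Rmult_pos_cases _ _ Hpos) as [[A B]|[A B]];
  destruct (Rtotal_order (orient y x z) 0) as [G'|[G'|G']]; try easy.
  - destruct (Key al (2 * be)) as [_ K]; [lra|lra|]. specialize (K G'). nra.
  - destruct (Key (2 * al) be) as [K _]; [lra|lra|]. specialize (K G'). nra.
  - destruct (Key (- 2 * al) (- be)) as [_ K]; [lra|lra|]. specialize (K G'). nra.
  - destruct (Key (- al) (- 2 * be)) as [K _]; [lra|lra|]. specialize (K G'). nra.
Qed.

(** By [wedge_free] a further neighbour lies outside the wedge at [x], so its edge to [y] crosses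
    [x c] or [x c'], the edges closing the two faces. *)
Lemma twin_nbrs z : adj E y z -> z = x \/ z = c \/ z = c'.
Proof.
  intros Hz. destruct (classic (z = x \/ z = c \/ z = c')) as [|Hn]; [easy|exfalso].
  assert (Nzx : z <> x) by tauto. assert (Nzc : z <> c) by tauto. assert (Nzc' : z <> c') by tauto.
  destruct (adj_in S E _ _ HE Hz) as [HyS [HzS Nyz]].
  pose proof Htw as [Hxy Htwin]. destruct (adj_in S E _ _ HE Hxy) as [HxS [_ Nxy]].
  pose proof Hfc as [_ [Hc [P1 _]]]. pose proof Hfc' as [Hc' [_ [P2 _]]].
  destruct (adj_in S E _ _ HE Hc) as [_ [HcS Nyc]]. destruct (adj_in S E _ _ HE Hc') as [_ [HcS' Nyc']].
  apply orient_pos_distinct in Ho as Ho'. destruct Ho' as [Nxc [Ncc' Nxc']].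
  pose proof (wedge_free z HzS Nzx ltac:(auto) Nzc Nzc') as W.
  assert (P1' : 0 < orient x c y) by (replace (orient x c y) with (orient y x c) by (unfold orient; ring); easy).
  assert (P2' : 0 < orient x y c') by (replace (orient x y c') with (orient y c' x) by (unfold orient; ring); easy).
  pose proof (orient_plucker x y z c c') as Pl.
  rewrite (orient_swap x c y), (orient_swap x c z) in Pl.
  destruct (Rmult_neg_cases _ _ W) as [[A B]|[A B]].
  - assert (Hxc : adj E x c) by (apply (face_opposite S E HS HE HN HM y x c Hfc)).
    apply (noncrossing_adj E y z x c HN Hz Hxc). split.
    + assert (T : 0 < orient y z c) by (apply Htwin; auto; rewrite orient_swap; lra).
      replace (orient y z x) with (orient x y z) by (unfold orient; ring).
      assert (orient x y z < 0); nra.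
    + nra.
  - assert (Hxc : adj E c' x) by (apply (face_opposite S E HS HE HN HM y c' x Hfc')).
    apply (noncrossing_adj E y z x c' HN Hz (adj_sym _ _ _ Hxc)). split.
    + assert (T : 0 < orient y c' z) by (apply Htwin; auto; rewrite orient_swap; lra).
      rewrite orient_swap in T.
      replace (orient y z x) with (orient x y z) by (unfold orient; ring).
      assert (0 < orient x y z); nra.
    + rewrite (orient_swap x y c'), (orient_swap x z c'). nra.
Qed.

(** With only three neighbours, the faces at [y] are satisfied throughout the open triangle
    [x c c']. Rigidity thus lets [y] jump next to any of its corners. *)
Lemma twin_sees_corner p a b : p = x \/ p = c \/ p = c' -> In a S -> In b S -> a <> y -> b <> y ->
  0 < orient y a b -> 0 <= orient p a b.
Proof.
  intros Hp HaS HbS Nay Nby Hab.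
  pose proof Htw as [Hxy Htwin]. destruct (adj_in S E _ _ HE Hxy) as [HxS [HyS Nxy]].
  pose proof Hfc as [_ [Hc [P1 B1]]]. pose proof Hfc' as [Hc' [_ [P2 B2]]].
  destruct (adj_in S E _ _ HE Hc) as [_ [HcS Nyc]]. destruct (adj_in S E _ _ HE Hc') as [_ [HcS' Nyc']].
  apply orient_pos_distinct in Ho as Ho'. destruct Ho' as [Nxc [Ncc' Nxc']].
  assert (P3 : 0 < orient y c c') by (apply Htwin; auto).
  destruct (Rle_or_lt 0 (orient p a b)) as [|Hneg]; [easy|exfalso].
  assert (Corner : 0 <= orient p x c /\ 0 <= orient p c c' /\ 0 <= orient p c' x).
  { destruct Hp as [-> | [-> | ->]]; rewrite ?orient_eq1, ?orient_eq3.
    - repeat split; lra.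
    - replace (orient c c' x) with (orient x c c') by (unfold orient; ring). repeat split; lra.
    - replace (orient c' x c) with (orient x c c') by (unfold orient; ring). repeat split; lra. }
  destruct Corner as [C1 [C2 C3]].
  destruct (ev_ex _ (ev_and _ _ (ev_lt 1 Rlt_0_1)
     (affine_pos_near (fun w => - orient w a b) p y ltac:(intros t u w; rewrite orient_lerp; ring) ltac:(lra))))
    as [s [_ [Hs Hw]]].
  set (w := lerp s p y) in *.
  assert (W1 : 0 < orient w x c) by (unfold w; rewrite orient_lerp; nra).
  assert (W2 : 0 < orient w c c') by (unfold w; rewrite orient_lerp; nra).
  assert (W3 : 0 < orient w c' x) by (unfold w; rewrite orient_lerp; nra).
  assert (HR : 0 <= orient w a b); [|lra].
  apply (rigid S E HND Hlen HS HE HN HM Hsup y w HyS (ex_intro _ x (adj_sym _ _ _ Hxy))); auto.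
  intros d e [Hd [He [Hde Hb]]].
  destruct (twin_nbrs d Hd) as [-> | [-> | ->]], (twin_nbrs e He) as [-> | [-> | ->]]; try easy;
    try (rewrite orient_eq2 in Hde; lra).
  - rewrite orient_swap in Hde; lra.
  - rewrite orient_swap in Hde; lra.
  - rewrite orient_swap in Hde; lra.
Qed.

(** A fifth point [z] sees two sides of the triangle with the same orientation, so the line through
    [z] and their common corner separates the other two corners, although [twin_sees_corner] puts
    both on the side of [y]. *)
Lemma twins_core_absurd : False.
Proof.
  pose proof Htw as [Hxy Htwin]. destruct (adj_in S E _ _ HE Hxy) as [HxS [HyS Nxy]].
  pose proof Hfc as [_ [Hc [P1 B1]]]. pose proof Hfc' as [Hc' [_ [P2 B2]]].
  destruct (adj_in S E _ _ HE Hc) as [_ [HcS Nyc]]. destruct (adj_in S E _ _ HE Hc') as [_ [HcS' Nyc']].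
  apply orient_pos_distinct in Ho as Ho'. destruct Ho' as [Nxc [Ncc' Nxc']].
  destruct (other_points [x; y; c; c']) as [z [HzS Hz]]; [simpl; lia|]. simpl in Hz.
  assert (Nz : z <> x /\ z <> y /\ z <> c /\ z <> c') by intuition. destruct Nz as [Nzx [Nzy [Nzc Nzc']]].
  assert (Sep : forall q p1 p2, In q S -> q <> y -> q <> z ->
     (p1 = x \/ p1 = c \/ p1 = c') -> (p2 = x \/ p2 = c \/ p2 = c') ->
     orient p1 z q * orient p2 z q < 0 -> False).
  { intros q p1 p2 HqS Nqy Nqz H1 H2 Hopp.
    assert (N : orient y z q <> 0) by (apply HS; auto).
    destruct (Rtotal_order (orient y z q) 0) as [G|[G|G]]; [|easy|].
    - assert (G' : 0 < orient y q z) by (rewrite orient_swap; lra).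
      pose proof (twin_sees_corner p1 q z H1 HqS HzS Nqy Nzy G') as K1.
      pose proof (twin_sees_corner p2 q z H2 HqS HzS Nqy Nzy G') as K2.
      rewrite orient_swap in K1, K2. nra.
    - pose proof (twin_sees_corner p1 z q H1 HzS HqS Nzy Nqy G) as K1.
      pose proof (twin_sees_corner p2 z q H2 HzS HqS Nzy Nqy G) as K2. nra. }
  assert (N1 : orient z x c <> 0) by (apply HS; auto).
  assert (N2 : orient z c c' <> 0) by (apply HS; auto).
  assert (N3 : orient z c' x <> 0) by (apply HS; auto).
  set (s1 := orient z x c) in *. set (s2 := orient z c c') in *. set (s3 := orient z c' x) in *.
  assert (Hsgn : 0 < s1 * s2 \/ 0 < s2 * s3 \/ 0 < s3 * s1).
  { destruct (Rtotal_order s1 0) as [|[|]], (Rtotal_order s2 0) as [|[|]], (Rtotal_order s3 0) as [|[|]];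
      try easy; try (left; nra); try (right; left; nra); try (right; right; nra). }
  destruct Hsgn as [G|[G|G]].
  - apply (Sep c x c'); auto.
    replace (orient x z c) with (- s1) by (unfold s1, orient; ring).
    replace (orient c' z c) with s2 by (unfold s2, orient; ring). lra.
  - apply (Sep c' c x); auto.
    replace (orient c z c') with (- s2) by (unfold s2, orient; ring).
    replace (orient x z c') with s3 by (unfold s3, orient; ring). lra.
  - apply (Sep x c' c); auto.
    replace (orient c' z x) with (- s3) by (unfold s3, orient; ring).
    replace (orient c z x) with s1 by (unfold s1, orient; ring). lra.
Qed.

End Core.

(** The two faces along the edge determine [c] and [c']; if [orient x c c'] is negative, the roles
    of [x] and [y] are exchanged. *)
Lemma no_twins x y : ~ twins x y.
Proof.
  intros Htw.
  destruct (twins_face_r x y Htw) as [c Hc]. destruct (twins_face_l x y Htw) as [c' Hc'].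
  pose proof Htw as [Hxy Htwin]. destruct (adj_in S E _ _ HE Hxy) as [HxS [HyS Nxy]].
  pose proof Hc as [_ [H1 [P1 B1]]]. pose proof Hc' as [H2 [_ [P2 B2]]].
  destruct (adj_in S E _ _ HE H1) as [_ [HcS Nyc]]. destruct (adj_in S E _ _ HE H2) as [_ [HcS' Nyc']].
  assert (Nxc : x <> c) by (intros ->; rewrite orient_eq2 in P1; lra).
  assert (Nxc' : c' <> x) by (intros ->; rewrite orient_eq2 in P2; lra).
  assert (Ncc' : c <> c') by (intros ->; rewrite orient_swap in P2; lra).
  assert (No : orient x c c' <> 0) by (apply HS; auto).
  destruct (Rtotal_order (orient x c c') 0) as [G|[G|G]]; [|easy|].
  - apply (twins_core_absurd y x c' c (twins_sym x y Htw)).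
    + apply (face_rot S E HS HE HN HM c' x y), (face_rot S E HS HE HN HM y c' x), Hc'.
    + apply (face_rot S E HS HE HN HM y x c), Hc.
    + apply Htwin; auto. rewrite orient_swap; lra.
  - apply (twins_core_absurd x y c c' Htw Hc Hc' G).
Qed.

End Twins.

(** * Vertices with few faces *)

(** A corner that is not strictly convex sees the whole quadrilateral, and so does the opposite one;
    if neither [x2] nor [x4] is of this kind, the diagonal [x1 x3] works. *)
Lemma quad_sees v x1 x2 x3 x4 :
  0 < orient v x1 x2 -> 0 < orient v x2 x3 -> 0 < orient v x3 x4 -> 0 < orient v x4 x1 ->
  (0 < orient x1 x2 x3 /\ 0 < orient x1 x3 x4) \/ (0 < orient x2 x3 x4 /\ 0 < orient x2 x4 x1).
Proof.
  intros H12 H23 H34 H41.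
  assert (Half : forall y1 y2 y3 y4, 0 < orient v y1 y2 -> 0 < orient v y2 y3 -> 0 < orient v y3 y4 -> 0 < orient v y4 y1 ->
    orient y1 y2 y3 <= 0 -> 0 < orient y2 y3 y4 /\ 0 < orient y2 y4 y1).
  { clear. intros y1 y2 y3 y4 H12 H23 H34 H41 Hr.
    pose proof (orient_plucker v y1 y2 y3 y4) as P.
    rewrite (orient_sum v y1 y2 y3) in Hr.
    rewrite (orient_sum v y2 y3 y4), (orient_sum v y2 y4 y1), (orient_swap v y1 y2).
    rewrite (orient_swap v y4 y1) in P.
    set (a := orient v y1 y2) in *. set (b := orient v y2 y3) in *. set (c := orient v y3 y4) in *.
    set (d := orient v y4 y1) in *. set (m := orient v y1 y3) in *. set (n := orient v y2 y4) in *.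
    assert (m * n = a * c - d * b) by lra.
    assert (0 < m) by lra.
    assert (n < c) by (destruct (Rlt_or_le n c); [easy|]; assert (m * c <= m * n) by (apply Rmult_le_compat_l; lra); nra).
    assert (- d < n) by (destruct (Rlt_or_le (- d) n); [easy|]; assert (m * n <= m * (- d)) by (apply Rmult_le_compat_l; lra); nra).
    split; lra. }
  destruct (Rlt_or_le 0 (orient x1 x2 x3)) as [G1|G1]; [|right; apply Half; auto].
  destruct (Rlt_or_le 0 (orient x1 x3 x4)) as [G2|G2]; [left; auto|].
  right. assert (G2' : orient x3 x4 x1 <= 0) by (rewrite <- orient_rot; easy).
  destruct (Half x3 x4 x1 x2) as [K1 K2]; auto.
  rewrite (orient_rot x2 x3 x4), (orient_rot x3 x4 x2), (orient_rot x2 x4 x1). easy.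
Qed.

(** If all three corners failed to be convex, two Plücker relations would give [b + c + d <= m] and
    [a + b + c <= n], whereas the third one gives [n * m = a * d - e * q], which is less than
    [a * d]. *)
Lemma three_reflex v x5 x1 x2 x3 x4 :
  0 < orient v x5 x1 -> 0 < orient v x1 x2 -> 0 < orient v x2 x3 -> 0 < orient v x3 x4 -> 0 < orient v x4 x5 ->
  0 < orient v x5 x2 -> 0 < orient v x1 x3 -> 0 < orient v x2 x4 ->
  0 < orient x5 x1 x2 \/ 0 < orient x1 x2 x3 \/ 0 < orient x2 x3 x4.
Proof.
  intros H51 H12 H23 H34 H45 D1 D2 D3.
  destruct (Rlt_or_le 0 (orient x5 x1 x2)) as [|R1]; [auto|].
  destruct (Rlt_or_le 0 (orient x1 x2 x3)) as [|R2]; [auto|].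
  destruct (Rlt_or_le 0 (orient x2 x3 x4)) as [|R3]; [auto|exfalso].
  rewrite (orient_sum v) in R1, R2, R3.
  pose proof (orient_plucker v x1 x2 x3 x4) as P1.
  pose proof (orient_plucker v x5 x1 x2 x3) as P2.
  pose proof (orient_plucker v x5 x1 x3 x4) as P3.
  rewrite (orient_swap v x4 x5) in P3.
  set (a := orient v x5 x1) in *. set (b := orient v x1 x2) in *. set (c := orient v x2 x3) in *.
  set (d := orient v x3 x4) in *. set (e := orient v x4 x5) in *.
  set (p := orient v x5 x2) in *. set (q := orient v x1 x3) in *. set (r := orient v x2 x4) in *.
  set (m := orient v x1 x4) in *. set (n := orient v x5 x3) in *.
  assert (M1 : b + c + d <= m).
  { assert (c * m = q * r - b * d) by lra.
    assert ((b + c) * (c + d) <= q * r) by (apply Rmult_le_compat; lra).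
    apply Rmult_le_reg_l with c; [easy|]. lra. }
  assert (M2 : a + b + c <= n).
  { assert (b * n = p * q - a * c) by lra.
    assert ((a + b) * (b + c) <= p * q) by (apply Rmult_le_compat; lra).
    apply Rmult_le_reg_l with b; [easy|]. lra. }
  assert ((a + b + c) * (b + c + d) <= n * m) by (apply Rmult_le_compat; lra).
  assert (0 < e * q) by (apply Rmult_lt_0_compat; lra).
  nra.
Qed.

Definition sees (a b c d e : point) : Prop := 0 < orient a b c /\ 0 < orient a c d /\ 0 < orient a d e.

(** Cutting off the ear at [x1] leaves a quadrilateral around [v]. Either of its diagonals ends at
    [x2] or [x5], and this end also sees the ear. *)
Lemma pentagon_ear v x1 x2 x3 x4 x5 :
  0 < orient v x2 x3 -> 0 < orient v x3 x4 -> 0 < orient v x4 x5 ->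
  0 < orient v x5 x2 -> 0 < orient x5 x1 x2 -> sees x2 x3 x4 x5 x1 \/ sees x5 x1 x2 x3 x4.
Proof.
  intros H23 H34 H45 H52 He.
  destruct (quad_sees v x2 x3 x4 x5 H23 H34 H45 H52) as [[G1 G2]|[G1 G2]]; [left|right];
    (split; [|split]); auto; try (rewrite orient_rot; easy); rewrite <- orient_rot; easy.
Qed.

(** The negated conjunctions say that two disjoint spans of two consecutive sides cannot both exceed
    pi. Hence three cyclically consecutive spans are below pi; [three_reflex] finds a convex corner
    among them, and this corner is an ear. *)
Lemma pentagon_sees v x1 x2 x3 x4 x5 :
  0 < orient v x1 x2 -> 0 < orient v x2 x3 -> 0 < orient v x3 x4 -> 0 < orient v x4 x5 -> 0 < orient v x5 x1 ->
  orient v x5 x2 <> 0 -> orient v x1 x3 <> 0 -> orient v x2 x4 <> 0 -> orient v x3 x5 <> 0 -> orient v x4 x1 <> 0 ->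
  ~ (orient v x5 x2 < 0 /\ orient v x2 x4 < 0) -> ~ (orient v x1 x3 < 0 /\ orient v x3 x5 < 0) ->
  ~ (orient v x2 x4 < 0 /\ orient v x4 x1 < 0) -> ~ (orient v x3 x5 < 0 /\ orient v x5 x2 < 0) ->
  ~ (orient v x4 x1 < 0 /\ orient v x1 x3 < 0) ->
  sees x1 x2 x3 x4 x5 \/ sees x2 x3 x4 x5 x1 \/ sees x3 x4 x5 x1 x2 \/ sees x4 x5 x1 x2 x3 \/ sees x5 x1 x2 x3 x4.
Proof.
  intros H12 H23 H34 H45 H51 N1 N2 N3 N4 N5 B1 B2 B3 B4 B5.
  assert (E1 : 0 < orient v x5 x2 -> 0 < orient x5 x1 x2 -> sees x2 x3 x4 x5 x1 \/ sees x5 x1 x2 x3 x4) by (apply pentagon_ear; auto).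
  assert (E2 : 0 < orient v x1 x3 -> 0 < orient x1 x2 x3 -> sees x3 x4 x5 x1 x2 \/ sees x1 x2 x3 x4 x5) by (apply pentagon_ear; auto).
  assert (E3 : 0 < orient v x2 x4 -> 0 < orient x2 x3 x4 -> sees x4 x5 x1 x2 x3 \/ sees x2 x3 x4 x5 x1) by (apply pentagon_ear; auto).
  assert (E4 : 0 < orient v x3 x5 -> 0 < orient x3 x4 x5 -> sees x5 x1 x2 x3 x4 \/ sees x3 x4 x5 x1 x2) by (apply pentagon_ear; auto).
  assert (E5 : 0 < orient v x4 x1 -> 0 < orient x4 x5 x1 -> sees x1 x2 x3 x4 x5 \/ sees x4 x5 x1 x2 x3) by (apply pentagon_ear; auto).
  pose proof (three_reflex v x5 x1 x2 x3 x4 H51 H12 H23 H34 H45) as T1.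
  pose proof (three_reflex v x1 x2 x3 x4 x5 H12 H23 H34 H45 H51) as T2.
  pose proof (three_reflex v x2 x3 x4 x5 x1 H23 H34 H45 H51 H12) as T3.
  pose proof (three_reflex v x3 x4 x5 x1 x2 H34 H45 H51 H12 H23) as T4.
  pose proof (three_reflex v x4 x5 x1 x2 x3 H45 H51 H12 H23 H34) as T5.
  assert (Sg : forall r, r <> 0 -> r < 0 \/ 0 < r) by (intros r Hr; destruct (Rtotal_order r 0) as [|[|]]; auto; easy).
  apply Sg in N1, N2, N3, N4, N5. tauto.
Qed.

Section Counting.

Variables (S : list point) (E : list (point * point)).
Hypothesis HND : NoDup S.
Hypothesis Hlen : (5 <= length S)%nat.
Hypothesis HS : general_position S.
Hypothesis HE : geometric_graph S E.
Hypothesis HN : noncrossing E.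
Hypothesis HM : maximal S E.
Hypothesis Hsup : supporting S E.

(** Positions close to [x] on the edge satisfy every face at [v]: those containing [x] because of
    the small share of [v], the others by assumption. Rigidity then makes [v] and [x] twins. *)
Lemma no_contractible_edge v x : adj E v x ->
  ~ (forall a b, face E v a b -> a <> x -> b <> x -> 0 < orient x a b).
Proof.
  intros Hvx Hsee. apply (no_twins S E HND Hlen HS HE HN HM Hsup v x).
  destruct (adj_in S E _ _ HE Hvx) as [HvS [HxS Nvx]].
  split; [easy|]. intros a b HaS HbS Nav Nax Nbv Nbx Hab.
  assert (Nab : a <> b) by (intros ->; rewrite orient_eq2 in Hab; lra).
  assert (N : orient x a b <> 0) by (apply HS; auto).
  destruct (Rtotal_order (orient x a b) 0) as [G|[G|G]]; [exfalso|easy|easy].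
  destruct (ev_ex _ (ev_and _ _ (ev_lt 1 Rlt_0_1)
     (affine_pos_near (fun w => - orient w a b) x v ltac:(intros t u w; rewrite orient_lerp; ring) ltac:(lra))))
    as [s [_ [Hs Hw]]].
  assert (HR : 0 <= orient (lerp s x v) a b); [|lra].
  apply (rigid S E HND Hlen HS HE HN HM Hsup v _ HvS (ex_intro _ x Hvx)); auto.
  intros c d Hf. pose proof Hf as [_ [_ [Hcd _]]]. rewrite orient_lerp.
  assert (0 < s * orient v c d) by (apply Rmult_lt_0_compat; lra).
  destruct (point_eq_dec c x) as [->|Nc]; [rewrite orient_eq1; lra|].
  destruct (point_eq_dec d x) as [->|Nd]; [rewrite orient_eq3; lra|].
  assert (0 < (1 - s) * orient x c d) by (apply Rmult_lt_0_compat; [lra|auto]). lra.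
Qed.

Lemma sq_dist_pos (v x : point) : v <> x -> 0 < (fst x - fst v) ^ 2 + (snd x - snd v) ^ 2.
Proof.
  intros N. destruct (Req_dec (fst x - fst v) 0) as [H1|H1].
  - destruct (Req_dec (snd x - snd v) 0) as [H2|H2].
    + exfalso. apply N, injective_projections; lra.
    + pose proof (pow2_ge_0 (fst x - fst v)). assert (0 < (snd x - snd v) ^ 2) by nra. lra.
  - pose proof (pow2_ge_0 (snd x - snd v)). assert (0 < (fst x - fst v) ^ 2) by nra. lra.
Qed.

(* The witness minimises the angle at [v] from [x], measured by its cotangent. *)
Lemma nearest_nbr s v x y : adj E v x -> adj E v y -> 0 < s * orient v x y ->
  exists z, adj E v z /\ 0 < s * orient v x z /\
    forall z', adj E v z' -> 0 < s * orient v x z' -> 0 < s * orient v z' z -> False.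
Proof.
  intros Hx Hy Hxy.
  destruct (adj_in S E _ _ HE Hx) as [HvS [HxS Nvx]].
  set (dot := fun z => (fst z - fst v) * (fst x - fst v) + (snd z - snd v) * (snd x - snd v)).
  set (l := cfilter (fun z => adj E v z /\ 0 < s * orient v x z) S).
  assert (Hl : forall z, In z l <-> adj E v z /\ 0 < s * orient v x z).
  { intros z. unfold l. rewrite in_cfilter. split; [tauto|]. intros [H1 H2].
    destruct (adj_in S E _ _ HE H1) as [_ [? _]]. auto. }
  destruct (list_argmin (fun z => - (dot z / (s * orient v x z))) l) as [z [Hz Hmin]].
  { intros Hnil. assert (In y l) by (apply Hl; auto). rewrite Hnil in H. destruct H. }
  apply Hl in Hz. destruct Hz as [Hz Hxz].
  exists z. split; [easy|]. split; [easy|]. intros z' Hz' Hxz' Hz'z.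
  assert (Hin : In z' l) by (apply Hl; auto). specialize (Hmin z' Hin). simpl in Hmin.
  (* The difference of the two cotangents, cleared of denominators. *)
  assert (Id : dot z' * (s * orient v x z) - dot z * (s * orient v x z') =
     ((fst x - fst v) ^ 2 + (snd x - snd v) ^ 2) * (s * orient v z' z)) by (unfold dot, orient; ring).
  assert (H1 : dot z' / (s * orient v x z') <= dot z / (s * orient v x z)) by lra.
  set (p := s * orient v x z) in *. set (p' := s * orient v x z') in *.
  apply (Rmult_le_compat_r (p' * p)) in H1; [|nra].
  replace (dot z' / p' * (p' * p)) with (dot z' * p) in H1 by (field; lra).
  replace (dot z / p * (p' * p)) with (dot z * p') in H1 by (field; lra).
  pose proof (Rmult_lt_0_compat _ _ (sq_dist_pos v x Nvx) Hz'z). lra.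
Qed.

Lemma next_face v x y : adj E v x -> adj E v y -> 0 < orient v x y -> exists z, face E v x z.
Proof.
  intros Hx Hy Hxy.
  destruct (nearest_nbr 1 v x y Hx Hy) as [z [H1 [H2 H3]]]; [lra|].
  exists z. split; [easy|]. split; [easy|]. split; [lra|].
  intros z' Hz' G1 G2. apply (H3 z' Hz'); lra.
Qed.

Lemma prev_face v x y : adj E v x -> adj E v y -> 0 < orient v y x -> exists z, face E v z x.
Proof.
  intros Hx Hy Hxy.
  destruct (nearest_nbr (-1) v x y Hx Hy) as [z [H1 [H2 H3]]]; [rewrite orient_swap; lra|].
  exists z. split; [easy|]. split; [easy|]. split; [rewrite orient_swap; lra|].
  intros z' Hz' G1 G2. rewrite orient_swap in G1, G2. apply (H3 z' Hz'); lra.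
Qed.

Definition faces_at (v : point) : list (point * point) :=
  cfilter (fun xy => face E v (fst xy) (snd xy)) (list_prod S S).

Lemma in_faces_at v x y : In (x, y) (faces_at v) <-> face E v x y.
Proof.
  unfold faces_at. rewrite in_cfilter, in_prod_iff. simpl. split; [tauto|].
  intros H. split; [|easy]. destruct H as [H1 [H2 _]].
  apply (adj_in S E _ _ HE) in H1, H2. tauto.
Qed.

Lemma faces_at_length v l : NoDup l -> (forall x y, In (x, y) l -> face E v x y) ->
  (length l <= length (faces_at v))%nat.
Proof.
  intros Hl H. apply NoDup_incl_length; [easy|]. intros [x y] Hxy. apply in_faces_at; auto.
Qed.

(** With [x0] the last neighbour counterclockwise and [y1] the one before it, at most two faces
    would all contain [y1], so the edge [v y1] could be contracted. If [x0] is the only neighbour,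
    there is no face to respect. *)
Lemma boundary_many_faces v x0 : adj E v x0 -> (forall z, adj E v z -> ~ 0 < orient v x0 z) ->
  (3 <= length (faces_at v))%nat.
Proof.
  intros Hx0 Hno. destruct (Compare_dec.le_lt_dec 3 (length (faces_at v))) as [|Hlt]; [easy|exfalso].
  destruct (adj_in S E _ _ HE Hx0) as [HvS [HxS Nvx]].
  destruct (classic (exists z, adj E v z /\ z <> x0)) as [[z [Hz Nz]]|Hone].
  2: { apply (no_contractible_edge v x0 Hx0). intros a b [Ha _] Na. exfalso; eauto. }
  destruct (adj_in S E _ _ HE Hz) as [_ [HzS Nvz]].
  assert (Side : forall z, adj E v z -> z <> x0 -> 0 < orient v z x0).
  { intros y Hy Ny. destruct (adj_in S E _ _ HE Hy) as [_ [HyS Nvy]].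
    destruct (Rtotal_order (orient v x0 y) 0) as [G|[G|G]].
    - rewrite orient_swap; lra.
    - exfalso. apply (HS v x0 y); auto.
    - exfalso. apply (Hno y Hy G). }
  destruct (prev_face v x0 z Hx0 Hz (Side z Hz Nz)) as [y1 Hy1].
  pose proof Hy1 as [Ay1 [_ [P1 B1]]].
  destruct (adj_in S E _ _ HE Ay1) as [_ [Hy1S Nvy1]].
  assert (Ny1 : y1 <> x0) by (intros ->; rewrite orient_eq2 in P1; lra).
  destruct (classic (exists z, adj E v z /\ 0 < orient v z y1)) as [[y [Hy Py]]|Hlast].
  - destruct (prev_face v y1 y Ay1 Hy Py) as [y2 Hy2].
    pose proof Hy2 as [Ay2 [_ [P2 B2]]].
    assert (Ny2 : y2 <> y1) by (intros ->; rewrite orient_eq2 in P2; lra).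
    apply (no_contractible_edge v y1 Ay1). intros a b Hab Na Nb. exfalso.
    assert (Hl : (3 <= length (faces_at v))%nat); [|lia].
    change 3%nat with (length [(y1, x0); (y2, y1); (a, b)]). apply faces_at_length.
    + repeat constructor; simpl; intuition congruence.
    + simpl. intros c d [H|[H|[H|[]]]]; inversion H; subst; easy.
  - apply (no_contractible_edge v y1 Ay1). intros a b Hab Na Nb. exfalso.
    pose proof Hab as [Aa [Ab [Pab _]]].
    assert (Na0 : a <> x0) by (intros ->; apply (Hno b Ab Pab)).
    apply (B1 a Aa); [|apply Side; auto].
    destruct (adj_in S E _ _ HE Aa) as [_ [HaS Nva]].
    destruct (Rtotal_order (orient v y1 a) 0) as [G|[G|G]]; [| |easy].
    + exfalso. apply Hlast. exists a. split; [easy|]. rewrite orient_swap; lra.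
    + exfalso. apply (HS v y1 a); auto.
Qed.

Section Interior.

Variable v : point.
Hypothesis Hint : forall x, adj E v x -> exists y, adj E v y /\ 0 < orient v x y.
Hypothesis Hfew : (length (faces_at v) <= 5)%nat.

Lemma next_total x : adj E v x -> exists z, face E v x z.
Proof. intros Hx. destruct (Hint x Hx) as [y [Hy Hxy]]. apply (next_face v x y); easy. Qed.

Lemma face_neq a b : face E v a b -> a <> b.
Proof. intros [_ [_ [H _]]] ->. rewrite orient_eq2 in H; lra. Qed.

Lemma face_neq2 a b c : face E v a b -> face E v b c -> a <> c.
Proof. intros [_ [_ [H _]]] [_ [_ [H' _]]] ->. rewrite orient_swap in H'; lra. Qed.

(** A face starting outside [C] has two successors that start outside as well, since [C] is closed
    under predecessors. Together with three faces starting in [C] these would be six. *)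
Lemma cycle_exhausts C s0 s1 s2 s3 : face E v s0 s1 -> face E v s1 s2 -> face E v s2 s3 ->
  In s0 C -> In s1 C -> In s2 C -> (forall a b, In b C -> face E v a b -> In a C) ->
  forall a b, face E v a b -> In a C.
Proof.
  intros F0 F1 F2 I0 I1 I2 Hpred a b Fab.
  destruct (classic (In a C)) as [|Hn]; [easy|exfalso].
  destruct (next_total b ltac:(apply Fab)) as [c Fbc].
  destruct (next_total c ltac:(apply Fbc)) as [d Fcd].
  assert (Nb : ~ In b C) by (intros H; apply Hn, (Hpred a b); auto).
  assert (Nc : ~ In c C) by (intros H; apply Nb, (Hpred b c); auto).
  assert (Hl : (6 <= length (faces_at v))%nat); [|lia].
  change 6%nat with (length [(s0, s1); (s1, s2); (s2, s3); (a, b); (b, c); (c, d)]).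
  apply faces_at_length.
  - apply (NoDup_map_inv fst). simpl.
    pose proof (face_neq _ _ F0); pose proof (face_neq _ _ F1); pose proof (face_neq2 _ _ _ F0 F1).
    pose proof (face_neq _ _ Fab); pose proof (face_neq _ _ Fbc); pose proof (face_neq2 _ _ _ Fab Fbc).
    repeat constructor; simpl; intuition (subst; easy).
  - simpl. intros x y H. repeat destruct H as [H|H]; try (inversion H; subst; easy).
Qed.

(** The successor map along faces returns to [s0] after three, four or five steps, or six different
    faces appear. When it returns, the faces form a star-shaped polygon around [v], and [v]
    contracts to a corner that sees it. *)
Lemma interior_absurd s0 : adj E v s0 -> False.
Proof.
  intros A0.
  destruct (next_total s0 A0) as [s1 F0]. pose proof F0 as [_ [A1 [P0 B0]]].
  destruct (next_total s1 A1) as [s2 F1]. pose proof F1 as [_ [A2 [P1 B1]]].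
  destruct (next_total s2 A2) as [s3 F2]. pose proof F2 as [_ [A3 [P2 B2]]].
  destruct (next_total s3 A3) as [s4 F3]. pose proof F3 as [_ [A4 [P3 B3]]].
  destruct (next_total s4 A4) as [s5 F4]. pose proof F4 as [_ [A5 [P4 B4]]].
  destruct (next_total s5 A5) as [s6 F5]. pose proof F5 as [_ [A6 [P5 B5]]].
  assert (U : forall a b c d, face E v a b -> face E v c d -> b = d -> a = c).
  { intros a b c d Hab Hcd ->. apply (face_unique_l S E HS HE v a c d); easy. }
  assert (R : forall a b c, face E v a b -> face E v a c -> b = c) by (intros a b c; apply (face_unique_r S E HS HE)).
  destruct (point_eq_dec s3 s0) as [E3|N3]; [|destruct (point_eq_dec s4 s0) as [E4|N4]; [|destruct (point_eq_dec s5 s0) as [E5|N5]]].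
  - subst s3.
    assert (HC : forall a b, face E v a b -> In a [s0; s1; s2]).
    { apply (cycle_exhausts [s0; s1; s2] s0 s1 s2 s0 F0 F1 F2); simpl; auto.
      intros a b [<-|[<-|[<-|[]]]] H; [rewrite (U _ _ _ _ H F2)|rewrite (U _ _ _ _ H F0)|rewrite (U _ _ _ _ H F1)]; auto. }
    apply (no_contractible_edge v s0 A0). intros a b Hab Na Nb.
    destruct (HC a b Hab) as [<-|[<-|[<-|[]]]]; [easy| |].
    + rewrite (R _ _ _ Hab F1), (orient_sum v s0 s1 s2), (orient_swap v s2 s0) in *. lra.
    + exfalso. apply Nb, (R _ _ _ Hab F2).
  - subst s4.
    assert (HC : forall a b, face E v a b -> In a [s0; s1; s2; s3]).
    { apply (cycle_exhausts [s0; s1; s2; s3] s0 s1 s2 s3 F0 F1 F2); simpl; auto.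
      intros a b [<-|[<-|[<-|[<-|[]]]]] H; [rewrite (U _ _ _ _ H F3)|rewrite (U _ _ _ _ H F0)|rewrite (U _ _ _ _ H F1)|rewrite (U _ _ _ _ H F2)]; auto. }
    destruct (quad_sees v s0 s1 s2 s3 P0 P1 P2 P3) as [[G1 G2]|[G1 G2]].
    + apply (no_contractible_edge v s0 A0). intros a b Hab Na Nb.
      destruct (HC a b Hab) as [<-|[<-|[<-|[<-|[]]]]]; try easy.
      * rewrite (R _ _ _ Hab F1); easy.
      * rewrite (R _ _ _ Hab F2); easy.
      * exfalso. apply Nb, (R _ _ _ Hab F3).
    + apply (no_contractible_edge v s1 A1). intros a b Hab Na Nb.
      destruct (HC a b Hab) as [<-|[<-|[<-|[<-|[]]]]]; try easy.
      * exfalso. apply Nb, (R _ _ _ Hab F0).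
      * rewrite (R _ _ _ Hab F2); easy.
      * rewrite (R _ _ _ Hab F3); easy.
  - subst s5.
    assert (HC : forall a b, face E v a b -> In a [s0; s1; s2; s3; s4]).
    { apply (cycle_exhausts [s0; s1; s2; s3; s4] s0 s1 s2 s3 F0 F1 F2); simpl; auto.
      intros a b [<-|[<-|[<-|[<-|[<-|[]]]]]] H; [rewrite (U _ _ _ _ H F4)|rewrite (U _ _ _ _ H F0)|rewrite (U _ _ _ _ H F1)|rewrite (U _ _ _ _ H F2)|rewrite (U _ _ _ _ H F3)]; auto 6. }
    assert (NZ : forall a b, adj E v a -> adj E v b -> a <> b -> orient v a b <> 0).
    { intros a b Ha Hb Nab. destruct (adj_in S E _ _ HE Ha) as [HvS [HaS Nva]].
      destruct (adj_in S E _ _ HE Hb) as [_ [HbS Nvb]]. apply HS; auto. }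
    assert (BT : forall a b z, face E v a b -> adj E v z -> ~ (orient v b z < 0 /\ orient v z a < 0)).
    { intros a b z [_ [_ [_ HB]]] Hz [H1 H2]. apply (HB z Hz); rewrite orient_swap; lra. }
    destruct (pentagon_sees v s0 s1 s2 s3 s4 P0 P1 P2 P3 P4) as [G|[G|[G|[G|G]]]].
    + apply NZ; [assumption|assumption|]. intros H; apply (face_neq2 _ _ _ F4 F0); auto.
    + apply NZ; [assumption|assumption|]. apply (face_neq2 _ _ _ F0 F1).
    + apply NZ; [assumption|assumption|]. apply (face_neq2 _ _ _ F1 F2).
    + apply NZ; [assumption|assumption|]. apply (face_neq2 _ _ _ F2 F3).
    + apply NZ; [assumption|assumption|]. apply (face_neq2 _ _ _ F3 F4).
    + apply BT; easy.
    + apply BT; easy.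
    + apply BT; easy.
    + apply BT; easy.
    + apply BT; easy.
    + destruct G as [G1 [G2 G3]]. apply (no_contractible_edge v s0 A0). intros a b Hab Na Nb.
      destruct (HC a b Hab) as [<-|[<-|[<-|[<-|[<-|[]]]]]]; try easy.
      * rewrite (R _ _ _ Hab F1); easy.
      * rewrite (R _ _ _ Hab F2); easy.
      * rewrite (R _ _ _ Hab F3); easy.
      * exfalso. apply Nb, (R _ _ _ Hab F4).
    + destruct G as [G1 [G2 G3]]. apply (no_contractible_edge v s1 A1). intros a b Hab Na Nb.
      destruct (HC a b Hab) as [<-|[<-|[<-|[<-|[<-|[]]]]]]; try easy.
      * exfalso. apply Nb, (R _ _ _ Hab F0).
      * rewrite (R _ _ _ Hab F2); easy.
      * rewrite (R _ _ _ Hab F3); easy.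
      * rewrite (R _ _ _ Hab F4); easy.
    + destruct G as [G1 [G2 G3]]. apply (no_contractible_edge v s2 A2). intros a b Hab Na Nb.
      destruct (HC a b Hab) as [<-|[<-|[<-|[<-|[<-|[]]]]]]; try easy.
      * rewrite (R _ _ _ Hab F0); easy.
      * exfalso. apply Nb, (R _ _ _ Hab F1).
      * rewrite (R _ _ _ Hab F3); easy.
      * rewrite (R _ _ _ Hab F4); easy.
    + destruct G as [G1 [G2 G3]]. apply (no_contractible_edge v s3 A3). intros a b Hab Na Nb.
      destruct (HC a b Hab) as [<-|[<-|[<-|[<-|[<-|[]]]]]]; try easy.
      * rewrite (R _ _ _ Hab F0); easy.
      * rewrite (R _ _ _ Hab F1); easy.
      * exfalso. apply Nb, (R _ _ _ Hab F2).
      * rewrite (R _ _ _ Hab F4); easy.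
    + destruct G as [G1 [G2 G3]]. apply (no_contractible_edge v s4 A4). intros a b Hab Na Nb.
      destruct (HC a b Hab) as [<-|[<-|[<-|[<-|[<-|[]]]]]]; try easy.
      * rewrite (R _ _ _ Hab F0); easy.
      * rewrite (R _ _ _ Hab F1); easy.
      * rewrite (R _ _ _ Hab F2); easy.
      * exfalso. apply Nb, (R _ _ _ Hab F3).
  (* No return within five steps. A coincidence of two later neighbours would, by uniqueness of
     predecessors, propagate back to an earlier coincidence already excluded. *)
  - assert (Hl : (6 <= length (faces_at v))%nat); [|lia].
    change 6%nat with (length [(s0, s1); (s1, s2); (s2, s3); (s3, s4); (s4, s5); (s5, s6)]).
    apply faces_at_length.
    + apply (NoDup_map_inv fst). simpl.
      pose proof (face_neq _ _ F0); pose proof (face_neq _ _ F1); pose proof (face_neq _ _ F2);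
      pose proof (face_neq _ _ F3); pose proof (face_neq _ _ F4);
      pose proof (face_neq2 _ _ _ F0 F1); pose proof (face_neq2 _ _ _ F1 F2);
      pose proof (face_neq2 _ _ _ F2 F3); pose proof (face_neq2 _ _ _ F3 F4).
      assert (s4 <> s1) by (intros H'; apply N3, (U _ _ _ _ F3 F0 H')).
      assert (s5 <> s2) by (intros H'; apply H8, (U _ _ _ _ F4 F1 H')).
      assert (s5 <> s1) by (intros H'; apply N4, (U _ _ _ _ F4 F0 H')).
      repeat constructor; simpl; intuition congruence.
    + simpl. intros x y H. repeat destruct H as [H|H]; try (inversion H; subst; easy).
Qed.

End Interior.

End Counting.

(** * Counting faces *)

Definition ind (P : Prop) : nat := if excluded_middle_informative P then 1%nat else 0%nat.

Lemma ind_true P : P -> ind P = 1%nat.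
Proof. unfold ind. destruct (excluded_middle_informative P); easy. Qed.

Lemma ind_false P : ~ P -> ind P = 0%nat.
Proof. unfold ind. destruct (excluded_middle_informative P); easy. Qed.

Lemma ind_iff P Q : (P <-> Q) -> ind P = ind Q.
Proof.
  intros H. destruct (classic P) as [HP|HP].
  - rewrite !ind_true; tauto.
  - rewrite !ind_false; tauto.
Qed.

Definition sum_over {A} (l : list A) (f : A -> nat) : nat := list_sum (map f l).

Lemma sum_over_ext {A} (l : list A) f g : (forall x, In x l -> f x = g x) -> sum_over l f = sum_over l g.
Proof. intros H. unfold sum_over. f_equal. apply map_ext_in, H. Qed.

Lemma sum_over_add {A} (l : list A) f g : sum_over l (fun x => (f x + g x)%nat) = (sum_over l f + sum_over l g)%nat.
Proof. unfold sum_over. induction l; simpl; lia. Qed.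

Lemma sum_over_0 {A} (l : list A) f : (forall x, In x l -> f x = 0%nat) -> sum_over l f = 0%nat.
Proof. unfold sum_over. induction l; simpl; intros H; [easy|]. rewrite (H a), IHl; auto. Qed.

Lemma sum_over_swap {A B} (l : list A) (m : list B) f :
  sum_over l (fun x => sum_over m (fun y => f x y)) = sum_over m (fun y => sum_over l (fun x => f x y)).
Proof.
  induction l as [|a l IH].
  - symmetry. apply sum_over_0. easy.
  - change (sum_over m (f a) + sum_over l (fun x => sum_over m (fun y => f x y)) =
            sum_over m (fun y => f a y + sum_over l (fun x => f x y)))%nat.
    rewrite IH, <- sum_over_add. easy.
Qed.

Lemma sum_over_le {A} (l : list A) f g : (forall x, In x l -> (f x <= g x)%nat) -> (sum_over l f <= sum_over l g)%nat.
Proof.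
  unfold sum_over. induction l; simpl; intros H; [lia|].
  pose proof (H a (or_introl eq_refl)). specialize (IHl (fun x Hx => H x (or_intror Hx))). lia.
Qed.

Lemma sum_over_lt {A} (l : list A) f g y : (forall x, In x l -> (f x <= g x)%nat) -> In y l -> (f y < g y)%nat ->
  (sum_over l f < sum_over l g)%nat.
Proof.
  induction l as [|a l IH]; simpl; intros H Hy Hlt; [easy|]. unfold sum_over in *. simpl.
  pose proof (sum_over_le l f g (fun x Hx => H x (or_intror Hx))) as Hle. unfold sum_over in Hle.
  pose proof (H a (or_introl eq_refl)).
  destruct Hy as [->|Hy]; [lia|]. specialize (IH (fun x Hx => H x (or_intror Hx)) Hy Hlt). lia.
Qed.

Lemma sum_over_unique {A} (l : list A) f : NoDup l -> (forall x, In x l -> (f x <= 1)%nat) ->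
  (forall x y, In x l -> In y l -> f x <> 0%nat -> f y <> 0%nat -> x = y) -> (sum_over l f <= 1)%nat.
Proof.
  unfold sum_over. induction l as [|a l IH]; simpl; intros HND H1 Hu; [lia|].
  inversion HND; subst.
  destruct (Nat.eq_dec (f a) 0) as [Hz|Hz].
  - rewrite Hz. simpl. apply IH; auto.
  - assert (Hr : sum_over l f = 0%nat).
    { apply sum_over_0. intros x Hx. destruct (Nat.eq_dec (f x) 0) as [|Hx0]; [easy|].
      exfalso. rewrite (Hu a x (or_introl eq_refl) (or_intror Hx) Hz Hx0) in H2. easy. }
    unfold sum_over in Hr. rewrite Hr. pose proof (H1 a (or_introl eq_refl)). lia.
Qed.

Lemma sum_over_nonzero {A} (l : list A) f : sum_over l f <> 0%nat -> exists x, In x l /\ f x <> 0%nat.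
Proof.
  intros H. destruct (classic (exists x, In x l /\ f x <> 0%nat)) as [|Hn]; [easy|].
  exfalso. apply H, sum_over_0. intros x Hx. destruct (Nat.eq_dec (f x) 0); [easy|]. exfalso; eauto.
Qed.

Lemma sum_pairs_unique {A} (l : list A) (P : A -> A -> Prop) : NoDup l ->
  (forall x y x' y', P x y -> P x' y' -> x = x' /\ y = y') ->
  (sum_over l (fun x => sum_over l (fun y => ind (P x y))) <= 1)%nat.
Proof.
  intros HND H.
  assert (I : forall Q, ind Q <> 0%nat -> Q).
  { intros Q HQ. destruct (classic Q); [easy|]. rewrite ind_false in HQ by easy. easy. }
  apply sum_over_unique; [easy| |].
  - intros x _. apply sum_over_unique; [easy| |].
    + intros y _. unfold ind. destruct (excluded_middle_informative _); lia.
    + intros y y' _ _ Hy Hy'. apply I in Hy, Hy'. apply (H x y x y'); easy.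
  - intros x x' _ _ Hx Hx'.
    destruct (sum_over_nonzero _ _ Hx) as [y [_ Hy]]. destruct (sum_over_nonzero _ _ Hx') as [y' [_ Hy']].
    apply I in Hy, Hy'. apply (H x y x' y'); easy.
Qed.

Lemma length_cfilter_prod {A} (l m : list A) (P : A -> A -> Prop) :
  length (cfilter (fun xy => P (fst xy) (snd xy)) (list_prod l m)) = sum_over l (fun x => sum_over m (fun y => ind (P x y))).
Proof.
  unfold cfilter, sum_over. induction l as [|a l IH]; [easy|]. simpl.
  rewrite filter_app, length_app, IH. f_equal.
  clear IH. induction m as [|b m IH]; [easy|]. simpl. unfold ind at 1.
  destruct (excluded_middle_informative (P a b)); simpl; rewrite IH; easy.
Qed.

(* For [s = 1] this is the lexicographic order of the points, for [s = -1] its reverse. *)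
Definition side (s : R) (v x : point) : Prop :=
  0 < s * (fst x - fst v) \/ (fst x = fst v /\ 0 < s * (snd x - snd v)).

(** Turning from [x] over [y] towards [z] is not transitive in general; it is when [x] and [y] lie
    on one side of the vertical line through [v] and [z] on the other. *)
Lemma side_trans_orient s v x y z : s * s = 1 -> side s v x -> side s v y -> side (- s) v z ->
  0 < orient v x y -> orient v y z < 0 -> orient v x z < 0.
Proof.
  unfold side, orient. intros Hs Hx Hy Hz.
  assert (Hs' : s = 1 \/ s = -1).
  { assert (H : (s - 1) * (s + 1) = 0) by lra. apply Rmult_integral in H. destruct H; [left|right]; lra. }
  assert (Hx' : 0 < s * (fst x - fst v) \/ (fst x - fst v = 0 /\ 0 < s * (snd x - snd v))) by (destruct Hx as [|[]]; [left|right; split]; lra).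
  assert (Hy' : 0 < s * (fst y - fst v) \/ (fst y - fst v = 0 /\ 0 < s * (snd y - snd v))) by (destruct Hy as [|[]]; [left|right; split]; lra).
  assert (Hz' : 0 < - s * (fst z - fst v) \/ (fst z - fst v = 0 /\ 0 < - s * (snd z - snd v))) by (destruct Hz as [|[]]; [left|right; split]; lra).
  clear Hx Hy Hz Hs.
  generalize dependent (fst x - fst v); generalize dependent (snd x - snd v).
  generalize dependent (fst y - fst v); generalize dependent (snd y - snd v).
  generalize dependent (fst z - fst v); generalize dependent (snd z - snd v).
  intros z2 z1 Hz' y2 y1 Hy' x2 x1 Hx'.
  intros H1 H2.
  (* A Plücker relation whose fourth vector is the vertical direction. *)
  assert (Id : y1 * (x1 * z2 - x2 * z1) = x1 * (y1 * z2 - y2 * z1) + z1 * (x1 * y2 - x2 * y1)) by ring.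
  destruct Hs' as [-> | ->]; destruct Hx' as [Hx|[Hx Hx2]], Hy' as [Hy|[Hy Hy2]], Hz' as [Hz|[Hz Hz2]]; subst; nra.
Qed.

Lemma side_total v x : v <> x -> side 1 v x \/ side (-1) v x.
Proof.
  intros N. unfold side.
  destruct (Rtotal_order (fst x) (fst v)) as [H|[H|H]]; [right; left; lra| |left; left; lra].
  destruct (Rtotal_order (snd x) (snd v)) as [H'|[H'|H']]; [right; right; split; lra| |left; right; split; lra].
  exfalso. apply N, injective_projections; lra.
Qed.

Lemma side_sym s v x : side s v x -> side (- s) x v.
Proof. unfold side. intros [|[]]; [left|right; split]; lra. Qed.

Lemma side_asym s v x : side s v x -> ~ side (- s) v x.
Proof. unfold side. intros [|[]] [|[]]; lra || nra. Qed.

Lemma side_trans s x y z : side s x y -> side s y z -> side s x z.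
Proof.
  unfold side. intros [|[E]] [|[E']].
  - left; lra.
  - left; rewrite E'; easy.
  - left; rewrite <- E; easy.
  - right; split; lra.
Qed.

Definition between (v x y : point) : Prop :=
  (side 1 v x /\ side (-1) v y) \/ (side (-1) v x /\ side 1 v y).

Lemma between_exactly_one a b c : a <> b -> b <> c -> a <> c ->
  (ind (between a b c) + ind (between b c a) + ind (between c a b) = 1)%nat.
Proof.
  intros Nab Nbc Nac.
  assert (S1 : forall x y, side 1 x y <-> side (-1) y x).
  { intros x y. split; intros H; apply side_sym in H; [easy|]. replace (- -1) with 1 in H by ring. easy. }
  assert (A1 : forall x y, side 1 x y -> ~ side 1 y x).
  { intros x y H H'. apply S1 in H'. apply (side_asym 1 x y); easy. }
  assert (T : forall x y z, side 1 x y -> side 1 y z -> side 1 x z) by (intros; eapply side_trans; eauto).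
  assert (D : forall x y, x <> y -> side 1 x y \/ side 1 y x).
  { intros x y N. destruct (side_total x y N); [auto|]. right. apply S1. easy. }
  assert (B : forall x y z, between x y z <-> (side 1 x y /\ side 1 z x) \/ (side 1 y x /\ side 1 x z)).
  { intros x y z. unfold between. rewrite <- !S1. tauto. }
  pose proof (T a b c); pose proof (T b c a); pose proof (T c a b); pose proof (T a c b); pose proof (T c b a); pose proof (T b a c).
  pose proof (A1 a b); pose proof (A1 b a); pose proof (A1 b c); pose proof (A1 c b); pose proof (A1 a c); pose proof (A1 c a).
  rewrite (ind_iff _ _ (B a b c)), (ind_iff _ _ (B b c a)), (ind_iff _ _ (B c a b)).
  destruct (D a b Nab), (D b c Nbc), (D a c Nac); try tauto;
    unfold ind; repeat destruct excluded_middle_informative; try lia; tauto.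
Qed.

(** * Double counting of faces over corners and middle vertices *)

Section Count.

Variables (S : list point) (E : list (point * point)).
Hypothesis HND : NoDup S.
Hypothesis Hlen : (5 <= length S)%nat.
Hypothesis HS : general_position S.
Hypothesis HE : geometric_graph S E.
Hypothesis HN : noncrossing E.
Hypothesis HM : maximal S E.
Hypothesis Hsup : supporting S E.

Definition middle_faces (v : point) : nat :=
  sum_over S (fun x => sum_over S (fun y => ind (face E v x y /\ between v x y))).

Lemma face_orient v x y : face E v x y -> 0 < orient v x y.
Proof. intros [_ [_ [H _]]]; easy. Qed.

Lemma face_rot_iff v x y : face E v x y <-> face E x y v.
Proof.
  split; intros H.
  - apply (face_rot S E HS HE HN HM); easy.
  - apply (face_rot S E HS HE HN HM y v x), (face_rot S E HS HE HN HM x y v), H.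
Qed.

(** By [face_rot] each triangle appears at its three corners, each time in one cyclic order, and
    exactly one corner is the middle one. Exchanging the sums identifies the three rotated terms. *)
Lemma sum_faces : sum_over S (fun v => length (faces_at S E v)) = (3 * sum_over S middle_faces)%nat.
Proof.
  set (m := fun v x y => ind (face E v x y /\ between v x y)).
  transitivity (sum_over S (fun v => sum_over S (fun x => sum_over S (fun y => (m v x y + m x y v + m y v x)%nat)))).
  - apply sum_over_ext. intros v _. unfold faces_at. rewrite length_cfilter_prod.
    apply sum_over_ext. intros x _. apply sum_over_ext. intros y _. unfold m.
    destruct (classic (face E v x y)) as [Hf|Hf].
    + rewrite (ind_true _ Hf).
      pose proof (proj1 (face_rot_iff _ _ _) Hf) as Hf1. pose proof (proj1 (face_rot_iff _ _ _) Hf1) as Hf2.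
      destruct (orient_neq0_distinct v x y) as [N1 [N2 N3]]; [pose proof (face_orient _ _ _ Hf); lra|].
      rewrite (ind_iff (face E v x y /\ between v x y) (between v x y)) by tauto.
      rewrite (ind_iff (face E x y v /\ between x y v) (between x y v)) by tauto.
      rewrite (ind_iff (face E y v x /\ between y v x) (between y v x)) by tauto.
      symmetry. apply between_exactly_one; auto.
    + assert (Hf1 : ~ face E x y v) by (intros H; apply Hf, face_rot_iff, H).
      assert (Hf2 : ~ face E y v x) by (intros H; apply Hf1, face_rot_iff, H).
      rewrite !ind_false; tauto.
  - transitivity (sum_over S (fun v => sum_over S (fun x => sum_over S (fun y => m v x y))) +
                  sum_over S (fun v => sum_over S (fun x => sum_over S (fun y => m x y v))) +
                  sum_over S (fun v => sum_over S (fun x => sum_over S (fun y => m y v x))))%nat.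
    { rewrite <- !sum_over_add. apply sum_over_ext. intros v _.
      rewrite <- !sum_over_add. apply sum_over_ext. intros x _.
      rewrite <- !sum_over_add. easy. }
    assert (H1 : sum_over S (fun v => sum_over S (fun x => sum_over S (fun y => m x y v))) = sum_over S middle_faces).
    { rewrite sum_over_swap. apply sum_over_ext. intros x _. apply sum_over_swap. }
    assert (H2 : sum_over S (fun v => sum_over S (fun x => sum_over S (fun y => m y v x))) = sum_over S middle_faces).
    { transitivity (sum_over S (fun v => sum_over S (fun y => sum_over S (fun x => m y v x)))).
      - apply sum_over_ext. intros v _. apply sum_over_swap.
      - apply sum_over_swap. }
    rewrite H1, H2. change (sum_over S (fun v => sum_over S (fun x => sum_over S (fun y => m v x y)))) with (sum_over S middle_faces).
    lia.
Qed.

(** The faces whose angle at [v] contains the ray upwards for [s = 1] and downwards for [s = -1], up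
    to the lexicographic treatment of vertical ties. *)
Definition side_faces (s : R) (v : point) : nat :=
  sum_over S (fun x => sum_over S (fun y => ind (face E v x y /\ side s v x /\ side (- s) v y))).

Lemma middle_split v : middle_faces v = (side_faces 1 v + side_faces (-1) v)%nat.
Proof.
  unfold middle_faces, side_faces.
  rewrite <- sum_over_add. apply sum_over_ext. intros x _.
  rewrite <- sum_over_add. apply sum_over_ext. intros y _.
  replace (- -1) with 1 by ring. change (- (1)) with (-1).
  pose proof (side_asym 1 v x) as A. unfold between.
  unfold ind. repeat destruct excluded_middle_informative; try lia; tauto.
Qed.

(** The first neighbour of such a face is the last one on its side in counterclockwise order: a
    later one would lie inside the angle of the face. *)
Lemma side_faces_le s v : s * s = 1 -> (side_faces s v <= 1)%nat.
Proof.
  intros Hs. apply sum_pairs_unique; [easy|].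
  assert (Hx : forall x y x' y', (face E v x y /\ side s v x /\ side (- s) v y) ->
     (face E v x' y' /\ side s v x' /\ side (- s) v y') -> ~ 0 < orient v x x').
  { intros x y x' y' [F [X Y]] [F' [X' Y']] G.
    destruct F as [Ax [Ay [P B]]]. destruct F' as [Ax' [Ay' [P' B']]].
    destruct (adj_in S E _ _ HE Ax') as [Hv [HxS Nx]]. destruct (adj_in S E _ _ HE Ay) as [_ [HyS Ny]].
    destruct (Rtotal_order (orient v x' y) 0) as [G'|[G'|G']].
    - pose proof (side_trans_orient s v x x' y Hs X X' Y G G'). lra.
    - assert (x' <> y) by (intros ->; apply (side_asym s v y); easy).
      apply (HS v x' y); auto.
    - apply (B x'); auto. }
  intros x y x' y' H H'.
  assert (Exx : x = x').
  { destruct (Rtotal_order (orient v x x') 0) as [G|[G|G]].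
    - exfalso. apply (Hx x' y' x y H' H). rewrite orient_swap; lra.
    - destruct H as [[Ax _] _]. destruct H' as [[Ax' _] _].
      destruct (adj_in S E _ _ HE Ax) as [Hv [HxS Nx]]. destruct (adj_in S E _ _ HE Ax') as [_ [HxS' Nx']].
      symmetry. apply (orient_zero_eq S HS v x x'); auto.
    - exfalso. apply (Hx x y x' y' H H'). easy. }
  subst x'. split; [easy|]. apply (face_unique_r S E HS HE v x); tauto.
Qed.

(** The last neighbour [x0] is on side [s] and everything else is clockwise of it, so turning
    counterclockwise from side [s] to the other side meets no face. *)
Lemma side_faces_boundary s v x0 : s * s = 1 -> adj E v x0 -> side s v x0 ->
  (forall z, adj E v z -> ~ 0 < orient v x0 z) -> side_faces s v = 0%nat.
Proof.
  intros Hs A0 S0 Hno. apply sum_over_0. intros x _. apply sum_over_0. intros y _.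
  apply ind_false. intros [[Ax [Ay [P B]]] [X Y]].
  destruct (adj_in S E _ _ HE A0) as [Hv [H0S N0]].
  destruct (adj_in S E _ _ HE Ax) as [_ [HxS Nx]]. destruct (adj_in S E _ _ HE Ay) as [_ [HyS Ny]].
  assert (Nx0y : x0 <> y) by (intros ->; apply (side_asym s v y); easy).
  assert (Hy : orient v x0 y < 0).
  { destruct (Rtotal_order (orient v x0 y) 0) as [|[G|G]]; [easy| |].
    - exfalso. apply (HS v x0 y); auto.
    - exfalso. apply (Hno y Ay G). }
  destruct (point_eq_dec x x0) as [->|Nxx0]; [lra|].
  assert (Hx : 0 < orient v x x0).
  { destruct (Rtotal_order (orient v x x0) 0) as [G|[G|G]]; [| |easy].
    - exfalso. apply (Hno x Ax). rewrite orient_swap; lra.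
    - exfalso. apply (HS v x x0); auto. }
  pose proof (side_trans_orient s v x x0 y Hs X S0 Y Hx Hy). lra.
Qed.

Lemma list_first l : l <> [] -> exists v : point, In v l /\ forall x, In x l -> x <> v -> side 1 v x.
Proof.
  induction l as [|a l IH]; [easy|]. intros _.
  destruct l as [|b l].
  - exists a. split; [left; easy|]. intros x [<-|[]] N; easy.
  - destruct IH as [v [Hv H]]; [easy|].
    destruct (point_eq_dec a v) as [->|N].
    { exists v. split; [left; easy|]. intros x [<-|Hx] Nx; [easy|auto]. }
    destruct (side_total v a ltac:(auto)) as [G|G].
    + exists v. split; [right; easy|]. intros x [<-|Hx] Nx; auto.
    + apply side_sym in G. replace (- -1) with 1 in G by ring.
      exists a. split; [left; easy|]. intros x [<-|Hx] Nx; [easy|].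
      destruct (point_eq_dec x v) as [->|Nv]; [easy|]. apply (side_trans 1 a v x); auto.
Qed.

Lemma triangulation_absurd : False.
Proof.
  set (isolated := fun v => forall y, ~ adj E v y).
  set (interior := fun v => forall x, adj E v x -> exists y, adj E v y /\ 0 < orient v x y).
  (* [W] separates the two counts: three times the middle faces at [v] is at most [W v], which is at
     most the number of faces at [v]. *)
  set (W := fun v => if excluded_middle_informative (isolated v) then 0%nat
                     else if excluded_middle_informative (interior v) then 6%nat else 3%nat).
  assert (Hmany : forall v, In v S -> (W v <= length (faces_at S E v))%nat).
  { intros v Hv. unfold W.
    destruct (excluded_middle_informative (isolated v)) as [|Hiso]; [lia|].
    assert (Hex : exists y, adj E v y).
    { destruct (classic (exists y, adj E v y)) as [|Hn]; [easy|]. exfalso. apply Hiso. intros y Hy; eauto. }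
    destruct Hex as [y0 Hy0].
    destruct (excluded_middle_informative (interior v)) as [Hint|Hint].
    - destruct (Compare_dec.le_lt_dec 6 (length (faces_at S E v))) as [|Hlt]; [easy|exfalso].
      apply (interior_absurd S E HND Hlen HS HE HN HM Hsup v Hint) with y0; [lia|easy].
    - assert (Hb : exists x0, adj E v x0 /\ forall z, adj E v z -> ~ 0 < orient v x0 z).
      { apply NNPP. intros Hn. apply Hint. intros x Hx. apply NNPP. intros Hn'. apply Hn.
        exists x. split; [easy|]. intros z Hz Hp. apply Hn'. eauto. }
      destruct Hb as [x0 [A0 Hno]].
      apply (boundary_many_faces S E HND Hlen HS HE HN HM Hsup v x0); easy. }
  assert (Hiso0 : forall v, isolated v -> middle_faces v = 0%nat).
  { intros v Hv. apply sum_over_0. intros x _. apply sum_over_0. intros y _.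
    apply ind_false. intros [[Hx _] _]. apply (Hv x Hx). }
  assert (Hfew : forall v, In v S -> (3 * middle_faces v <= W v)%nat).
  { intros v Hv. unfold W.
    destruct (excluded_middle_informative (isolated v)) as [Hi|Hi]; [rewrite Hiso0; easy|].
    rewrite middle_split.
    pose proof (side_faces_le 1 v ltac:(lra)). pose proof (side_faces_le (-1) v ltac:(lra)).
    destruct (excluded_middle_informative (interior v)) as [Hint|Hint]; [lia|].
    assert (Hb : exists x0, adj E v x0 /\ forall z, adj E v z -> ~ 0 < orient v x0 z).
    { apply NNPP. intros Hn. apply Hint. intros x Hx. apply NNPP. intros Hn'. apply Hn.
      exists x. split; [easy|]. intros z Hz Hp. apply Hn'. eauto. }
    destruct Hb as [x0 [A0 Hno]].
    destruct (adj_in S E _ _ HE A0) as [_ [_ N0]].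
    destruct (side_total v x0 N0) as [G|G].
    - rewrite (side_faces_boundary 1 v x0); auto; [lia|lra].
    - rewrite (side_faces_boundary (-1) v x0); auto; [lia|lra]. }
  (* Isolated vertices are skipped in the choice of the first vertex: strictness needs [W v0] to be
     positive while no face has [v0] as its middle. *)
  set (l := cfilter (fun v => ~ isolated v) S).
  destruct (list_first l) as [v0 [Hv0 Hfirst]].
  { destruct (exists_not_in S [] HND) as [a [Ha _]]; [simpl; lia|].
    destruct (exists_not_in S [a] HND) as [b [Hb Nab]]; [simpl; lia|].
    simpl in Nab.
    assert (HeE : exists c d, adj E c d).
    { destruct (classic (adj E a b)) as [H|H]; [eauto|].
      destruct (HM a b Ha Hb ltac:(intuition) H) as [c [d [Hcd _]]]. exists c, d. left; easy. }
    destruct HeE as [c [d Hcd]]. intros Hnil.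
    assert (Hc : In c l).
    { apply in_cfilter. split; [apply (adj_in S E _ _ HE Hcd)|]. intros Hi. apply (Hi d Hcd). }
    rewrite Hnil in Hc. destruct Hc. }
  apply in_cfilter in Hv0. destruct Hv0 as [Hv0S Hv0].
  assert (H0 : middle_faces v0 = 0%nat).
  { apply sum_over_0. intros x _. apply sum_over_0. intros y _. apply ind_false.
    intros [[Ax [Ay _]] Hb].
    assert (Hr : forall z, adj E v0 z -> side 1 v0 z).
    { intros z Hz. destruct (adj_in S E _ _ HE Hz) as [_ [HzS Nz]].
      apply Hfirst; [|auto]. apply in_cfilter. split; [easy|]. intros Hi. apply (Hi v0), adj_sym, Hz. }
    destruct Hb as [[_ Hb]|[Hb _]].
    - apply (side_asym 1 v0 y); auto.
    - apply (side_asym 1 v0 x); auto. }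
  assert (Hlt : (sum_over S (fun v => 3 * middle_faces v) < sum_over S (fun v => length (faces_at S E v)))%nat).
  { apply (sum_over_lt S _ _ v0); [|easy|].
    - intros v Hv. pose proof (Hfew v Hv). pose proof (Hmany v Hv). lia.
    - pose proof (Hmany v0 Hv0S) as Hm. rewrite H0. unfold W in Hm.
      destruct (excluded_middle_informative (isolated v0)); [easy|].
      destruct (excluded_middle_informative (interior v0)); lia. }
  rewrite sum_faces in Hlt.
  assert (Hmul : forall l : list point, (sum_over l (fun v => 3 * middle_faces v) = 3 * sum_over l middle_faces)%nat).
  { clear. intros l. unfold sum_over. induction l; simpl in *; lia. }
  rewrite Hmul in Hlt. lia.
Qed.

End Count.

(** Greedy choice over all pairs: a pair is added unless it crosses a present edge, and a rejected
    pair stays crossed because edges are only added. *)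
Lemma extend_maximal S E : geometric_graph S E -> noncrossing E -> general_position S ->
  exists E', incl E E' /\ geometric_graph S E' /\ noncrossing E' /\ maximal S E'.
Proof.
  intros HE HN HS.
  assert (Hstep : forall l, (forall ab, In ab l -> In (fst ab) S /\ In (snd ab) S) ->
    exists E', incl E E' /\ geometric_graph S E' /\ noncrossing E' /\
      forall a b, In (a, b) l -> a <> b -> ~ adj E' a b -> exists c d, In (c, d) E' /\ crosses a b c d).
  { induction l as [|[a b] l IH]; intros Hl.
    - exists E. split; [apply incl_refl|]. split; [easy|]. split; [easy|]. intros a b [].
    - destruct IH as [E' [Hinc [HE' [HN' HM']]]]; [intros; apply Hl; right; easy|].
      destruct (classic (a = b \/ exists c d, In (c, d) E' /\ crosses a b c d)) as [Hx|Hx].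
      + exists E'. split; [easy|]. split; [easy|]. split; [easy|].
        intros a' b' [H|H] Nab Nadj; [|apply HM'; easy]. inversion H; subst. tauto.
      + exists ((a, b) :: E'). split; [apply incl_tl; easy|]. split; [|split].
        * intros e [<-|He]; [|apply HE'; easy]. simpl. destruct (Hl (a, b)); [left; easy|]. simpl in *. tauto.
        * intros p q r s [H1|H1] [H2|H2] HX.
          -- inversion H1; inversion H2; subst. destruct HX as [HX _]. rewrite orient_eq3 in HX. lra.
          -- inversion H1; subst. apply Hx. right. eauto.
          -- inversion H2; subst. apply Hx. right. exists p, q. split; [easy|]. apply crosses_sym; easy.
          -- apply (HN' _ _ _ _ H1 H2 HX).
        * intros a' b' [H|H] Nab Nadj.
          -- inversion H; subst. exfalso. apply Nadj. left; left; easy.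
          -- destruct (HM' a' b' H Nab) as [c [d [Hcd HX]]].
             { intros [G|G]; apply Nadj; [left|right]; right; easy. }
             exists c, d. split; [right|]; easy. }
  destruct (Hstep (list_prod S S)) as [E' [H1 [H2 [H3 H4]]]].
  { intros [a b] H. apply in_prod_iff in H. easy. }
  exists E'. split; [easy|]. split; [easy|]. split; [easy|].
  intros a b Ha Hb. apply H4. apply in_prod_iff; easy.
Qed.

Lemma lerp_interior s p q : p <> q -> 0 < s < 1 -> lerp s p q <> p /\ lerp s p q <> q.
Proof.
  intros N Hs. split; intros H; apply N.
  - assert (H1 := f_equal fst H). assert (H2 := f_equal snd H). simpl in H1, H2.
    apply injective_projections; apply Rmult_eq_reg_l with s; lra.
  - assert (H1 := f_equal fst H). assert (H2 := f_equal snd H). simpl in H1, H2.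
    apply injective_projections; apply Rmult_eq_reg_l with (1 - s); lra.
Qed.

Lemma crosses_has_crossing S E a b c d : geometric_graph S E -> In (a, b) E -> In (c, d) E -> crosses a b c d ->
  has_crossing E.
Proof.
  intros HE Hab Hcd HX.
  destruct (crosses_point a b c d HX) as [s [t [Hs [Ht Heq]]]].
  destruct (HE _ Hab) as [_ [_ Nab]]. simpl in Nab.
  destruct (lerp_interior s a b Nab Hs) as [Na Nb].
  exists (a, b), (c, d). split; [easy|]. split; [easy|]. exists (lerp s a b). simpl.
  split; [exists s; split; [lra|easy]|].
  split; [rewrite Heq; exists t; split; [lra|easy]|].
  split; [tauto|]. destruct HX as [HX _].
  split; intros [-> ->].
  - rewrite orient_eq3 in HX. lra.
  - rewrite orient_eq2 in HX. lra.
Qed.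

Theorem theorem5 (S : list point) (E : list (point * point)) :
  NoDup S -> (9 <= length S)%nat -> general_position S ->
  geometric_graph S E -> supporting S E -> has_crossing E.
Proof.
  intros HND Hlen HS HE Hsup.
  destruct (classic (has_crossing E)) as [|Hno]; [easy|exfalso].
  assert (HN : noncrossing E).
  { intros a b c d Hab Hcd HX. apply Hno, (crosses_has_crossing S E a b c d); easy. }
  destruct (extend_maximal S E HE HN HS) as [E' [Hinc [HE' [HN' HM']]]].
  (* Further edges only restrict the admissible isotopies, so the extension inherits the
     property. *)
  assert (Hsup' : supporting S E').
  { intros f Hf H. apply Hsup; [easy|]. intros t Ht. split; [|apply H, Ht].
    intros e He. apply H; auto. }
  apply (triangulation_absurd S E'); auto. lia.
Qed.
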